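(* Consider the variational model described in the context (finite-state-controller policies for agents $n=1,\dots,N$ with stick-breaking/Dirichlet priors and Gamma hyper-priors, a dataset of $K$ trajectories, and the mean-field variational family below). With conjugate priors and the mean-field assumption, maximizing the objective $\mathrm{ELBO}(q)$ coordinate-wise over each variational factor (the others held fixed) reduces to the following parameter updates of the variational distributions: \[ \begin{aligned} &\delta_n^i=1+\sum_{k=1}^{K}\frac{1}{K}\sum_{t=0}^{T_k}q_{n,t}^k(z_{n,0}^{k}=i), \qquad \mu_n^i=\frac{g_n}{h_n}+\sum_{k=1}^{K}\frac{1}{K}\sum_{t=0}^{T_k}\sum_{m=i+1}^{|\mathcal{Z}_n|}q_{n,t}^k(z_{n,0}^{k}=m),\\ &\phi_{n,i}^{a}=\theta_{n,i}^{a}+\sum_{k=1}^{K}\frac{1}{K}\sum_{t=0}^{T_k}\sum_{\tau=0}^{t}q_{n,t}^k(z_{n,\tau}^{k}=i)\,\mathbb{I}(a_{n,\tau}^{k}=a),\\ &\sigma_{n,a,o}^{i,j}=1+\sum_{k=1}^{K}\frac{1}{K}\sum_{t=0}^{T_k}\sum_{\tau=1}^{t}q_{n,t}^k(z_{n,\tau-1}^{k}=i,z_{n,\tau}^{k}=j)\,\mathbb{I}(a_{n,\tau-1}^{k}=a,o_{n,\tau}^{k}=o),\\ &\lambda_{n,a,o}^{i,j}=\frac{a_{n,a,o}^{i}}{b_{n,a,o}^{i}}+\sum_{k=1}^{K}\frac{1}{K}\sum_{t=0}^{T_k}\sum_{\tau=1}^{t}\sum_{m=j+1}^{|\mathcal{Z}_n|}q_{n,t}^k(z_{n,\tau-1}^{k}=i,z_{n,\tau}^{k}=m)\,\mathbb{I}(a_{n,\tau-1}^{k}=a,o_{n,\tau}^{k}=o),\\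 &g_n=e+|\mathcal{Z}_n|,\qquad h_n=f-\sum_{i=1}^{|\mathcal{Z}_n|}\left[\Psi(\mu_{n}^{i})-\Psi(\delta_{n}^{i}+\mu_{n}^{i})\right],\\ &a_{n,a,o}^{i}=c_{n,a,o}+|\mathcal{Z}_n|,\qquad b_{n,a,o}^{i}=d_{n,a,o}-\sum_{j=1}^{|\mathcal{Z}_n|}\left[\Psi(\lambda_{n,a,o}^{i,j})-\Psi(\sigma_{n,a,o}^{i,j}+\lambda_{n,a,o}^{i,j})\right], \end{aligned} \] where $\Psi$ is the digamma function, $\mathbb{I}$ is the indicator function, and \[ q_{n,t}^k(z_{n,\tau}^{k}=i)=\tilde{\nu}_t^k\, p(z_{n,\tau}^{k}=i\mid a_{n,0:t}^k,o_{n,1:t}^k,\tilde{\Theta}),\qquad q_{n,t}^k(z_{n,\tau-1}^{k}=i,z_{n,\tau}^{k}=j)=\tilde{\nu}_t^k\, p(z_{n,\tau-1}^{k}=i,z_{n,\tau}^{k}=j\mid a_{n,0:t}^k,o_{n,1:t}^k,\tilde{\Theta}) \] are the marginals of $q_{n,t}^k(z_{n,0:t}^{k})$ for $\tau=0,\dots,t$.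
   Context: Agents $n=1,\dots,N$; agent $n$ has a finite action set $\mathcal{A}_n$, finite observation set $\mathcal{O}_n$ and a (truncated) finite node set $\mathcal{Z}_n=\{1,\dots,|\mathcal{Z}_n|\}$. A finite state controller (FSC) policy $\Theta_n=(\eta_n,\omega_n,\pi_n)$ for agent $n$ consists of an initial node distribution $\eta_n^i$, node transition probabilities $\omega_{n,a,o}^{i,j}$ (probability of moving to node $j$ from node $i$ after action $a$ and observation $o$), and action probabilities $\pi_{n,i}^a$ at node $i$. For action history $a_{n,0:t}$, observation history $o_{n,1:t}$ and node history $z_{n,0:t}$, $p(a_{n,0:t},z_{n,0:t}\mid o_{n,1:t},\Theta)=\eta_n^{z_0}\pi_{n,z_0}^{a_0}\prod_{\tau=1}^{t}\omega_{n,a_{\tau-1},o_\tau}^{z_{\tau-1},z_\tau}\pi_{n,z_\tau}^{a_\tau}$, and $p(a_{n,0:t}\mid o_{n,1:t},\Theta)$ is its sum over $z_{n,0:t}$. Prior: $\eta_n^1=u_n^1$, $\eta_n^i=u_n^i\prod_{m<i}(1-u_n^m)$; $\omega_{n,a,o}^{i,1}=V_{n,a,o}^{i,1}$, $\omega_{n,a,o}^{i,j}=V_{n,a,o}^{i,j}\prod_{m<j}(1-V_{n,a,o}^{i,m})$; $u_n^i\sim\mathrm{Beta}(1,\rho_n)$, $\rho_n\sim\mathrm{Gamma}(e,f)$; $V_{n,a,o}^{i,j}\sim\mathrm{Beta}(1,\alpha_{n,a,o}^i)$, $\alpha_{n,a,o}^i\sim\mathrm{Gamma}(c_{n,a,o},d_{n,a,o})$;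 $\pi_{n,i}\sim\mathrm{Dirichlet}(\theta_{n,i}^{1},\dots,\theta_{n,i}^{|\mathcal{A}_n|})$ (Gamma in shape–rate form). Data: $K$ trajectories; trajectory $k$ has length $T_k$, actions $a_{n,\tau}^k$, observations $o_{n,\tau}^k$, and rewards $r_t^k$; $R_{\min}$ is the minimal reward, $\gamma\in[0,1)$ a discount factor, and $\Pi$ a behavior policy giving probabilities $p(a_{n,0:t}^k\mid o_{n,1:t}^k,\Pi)$. Let $\tilde r_t^k=\gamma^t (r_t^k-R_{\min})/\prod_{n}p(a_{n,0:t}^k\mid o_{n,1:t}^k,\Pi)$ and the empirical value $\hat V(\mathcal{D}^K;\Theta)=\frac1K\sum_{k}\sum_{t=0}^{T_k}\tilde r_t^k\prod_n p(a_{n,0:t}^k\mid o_{n,1:t}^k,\Theta)$. Variational family (mean field): $q(u_n^i)=\mathrm{Beta}(\delta_n^i,\mu_n^i)$, $q(V_{n,a,o}^{i,j})=\mathrm{Beta}(\sigma_{n,a,o}^{i,j},\lambda_{n,a,o}^{i,j})$, $q(\rho_n)=\mathrm{Gamma}(g_n,h_n)$, $q(\alpha_{n,a,o}^i)=\mathrm{Gamma}(a_{n,a,o}^i,b_{n,a,o}^i)$, $q(\pi_{n,i})=\mathrm{Dirichlet}(\phi_{n,i}^1,\dots,\phi_{n,i}^{|\mathcal{A}_n|})$, and $q(z_{n,0:t}^k)=\tilde\nu_t^k\,p(z_{n,0:t}^k\mid a_{n,0:t}^k,o_{n,1:t}^k,\tilde\Theta)$, where $\tilde\Theta=(\tilde\eta,\tilde\omega,\tilde\pi)$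 with $\tilde\eta_n^i=\exp\mathrm{E}_q[\ln\eta_n^i]$, $\tilde\omega_{n,a,o}^{i,j}=\exp\mathrm{E}_q[\ln\omega_{n,a,o}^{i,j}]$, $\tilde\pi_{n,i}^a=\exp\mathrm{E}_q[\ln\pi_{n,i}^a]$, and $\tilde\nu_t^k=\gamma^t(r_t^k-R_{\min})\prod_n p(a_{n,0:t}^k\mid o_{n,1:t}^k,\tilde\Theta)/\big(\prod_n p(a_{n,0:t}^k\mid o_{n,1:t}^k,\Pi)\,\hat V(\mathcal{D}^K;\tilde\Theta)\big)$. Objective: $\mathrm{ELBO}(q)=\frac1K\sum_k\sum_{t}\sum_{\vec z_{0:t}^k}q(\vec z_{0:t}^k)\,\mathrm{E}_{q(\Theta)}\big[\ln \tilde r_t^k\prod_n p(a_{n,0:t}^k,z_{n,0:t}^k\mid o_{n,1:t}^k,\Theta)\big]+\mathrm{E}_q[\ln p(\Theta\mid\rho,\alpha)]+\mathrm{E}_q[\ln p(\rho)]+\mathrm{E}_q[\ln p(\alpha)]-\mathrm{E}_q[\ln q(\Theta)q(\rho)q(\alpha)\prod_n q(z_{n,0:t}^k)]$, with $q(\vec z_{0:t}^k)=\prod_n q(z_{n,0:t}^k)$.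
   Formalization: The joint q(z) over agents is taken as ν̃ ∏_n p(z_n | a_n, o_n, Θ̃), with one factor ν̃, instead of the literal product ∏_n q(z_n), which carries ν̃^N and makes the stated updates false for N ≥ 2. *)

(* Defs.v *)
From HB Require Import structures.
From mathcomp Require Import all_boot all_order all_algebra.
From mathcomp Require Import all_classical all_reals.
From mathcomp Require Import topology normedtype sequences derive exp.
From mathcomp Require Import measure lebesgue_measure lebesgue_integral.
Unset Strict Implicit. Unset Printing Implicit Defensive.
Import Order.TTheory GRing.Theory Num.Theory.
Import numFieldNormedType.Exports.
Local Open Scope classical_set_scope.
Local Open Scope ring_scope.

Section FSC.
Variable R : realType.

Definition GammaR (x : R) : R :=
  \int[@lebesgue_measure R]_(s in `]0%R, +oo[) (s `^ (x - 1) * expR (- s)).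

Definition digamma (x : R) : R := derive1 (fun y => ln (GammaR y)) x.

Definition beta_dens (a b x : R) : R :=
  if (0 < x) && (x < 1) then
    x `^ (a - 1) * (1 - x) `^ (b - 1) * GammaR (a + b) / (GammaR a * GammaR b)
  else 0.

Definition gamma_dens (a b x : R) : R :=
  if 0 < x then b `^ a * x `^ (a - 1) * expR (- (b * x)) / GammaR a else 0.

(* Dirichlet(phi_0..phi_{m-1}) density of the point p of the simplex,
   viewed as a density of the m-1 free coordinates p_0..p_{m-2}
   (p_{m-1} = 1 - sum of the others). *)
Definition dir_dens (m : nat) (phi : nat -> R) (p : nat -> R) : R :=
  if [forall a : 'I_m, 0 < p a] then
    GammaR (\sum_(a < m) phi a) / (\prod_(a < m) GammaR (phi a)) *
    \prod_(a < m) p a `^ (phi a - 1)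
  else 0.

(* Agents n < NA; actions of agent n are 0..nA n - 1, observations     *)
(* 0..nO n - 1, controller nodes 0..nZ n - 1 (node i+1 of the paper is *)
(* node i here). Trajectories k < KK, times 0..TT k.                    *)
Record model := Model {
  NA : nat;
  nA : nat -> nat; nO : nat -> nat; nZ : nat -> nat;
  KK : nat; TT : nat -> nat;
  act : nat -> nat -> nat -> nat;      (* act k n tau = a_{n,tau}^k *)
  obs : nat -> nat -> nat -> nat;      (* obs k n tau = o_{n,tau}^k  (tau >= 1) *)
  rew : nat -> nat -> R;               (* rew k t = r_t^k *)
  Rmin : R; gam : R;
  pPi : nat -> nat -> nat -> R;        (* pPi k n t = p(a^k_{n,0:t} | o^k_{n,1:t}, Pi) *)
  he : R; hf : R;                      (* rho_n ~ Gamma(e,f) *)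
  hc : nat -> nat -> nat -> R;         (* hc n a o = c_{n,a,o} *)
  hd : nat -> nat -> nat -> R;         (* hd n a o = d_{n,a,o} *)
  htheta : nat -> nat -> nat -> R      (* htheta n i a = theta_{n,i}^a *)
}.

Definition wf_model (M : model) : Prop :=
  [/\ (0 < KK M)%N,
      (forall n, (n < NA M)%N -> [/\ (0 < nA M n)%N, (0 < nO M n)%N & (0 < nZ M n)%N]),
      (forall k n tau, (k < KK M)%N -> (n < NA M)%N -> (tau <= TT M k)%N ->
          (act M k n tau < nA M n)%N /\ ((0 < tau)%N -> (obs M k n tau < nO M n)%N)),
      (forall k t, (k < KK M)%N -> (t <= TT M k)%N -> Rmin M <= rew M k t) /\
      (0 <= gam M < 1) &
      [/\ (forall k n t, (k < KK M)%N -> (n < NA M)%N -> (t <= TT M k)%N ->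
             0 < pPi M k n t <= 1),
          0 < he M, 0 < hf M,
          (forall n a o, (n < NA M)%N -> (a < nA M n)%N -> (o < nO M n)%N ->
             0 < hc M n a o /\ 0 < hd M n a o) &
          (forall n i a, (n < NA M)%N -> (i < nZ M n)%N -> (a < nA M n)%N ->
             0 < htheta M n i a)]].

Record vparams := VParams {
  vdelta : nat -> nat -> R;  vmu : nat -> nat -> R;             (* n i *)
  vsigma : nat -> nat -> nat -> nat -> nat -> R;                (* n a o i j *)
  vlambda : nat -> nat -> nat -> nat -> nat -> R;
  vg : nat -> R; vh : nat -> R;                                 (* n *)
  va : nat -> nat -> nat -> nat -> R; vb : nat -> nat -> nat -> nat -> R; (* n a o i *)
  vphi : nat -> nat -> nat -> R                                 (* n i a *)
}.

Definition vpos (M : model) (P : vparams) : Prop :=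
  forall n, (n < NA M)%N ->
  [/\ 0 < vg P n /\ 0 < vh P n,
      (forall i, (i < nZ M n)%N -> 0 < vdelta P n i /\ 0 < vmu P n i),
      (forall i a, (i < nZ M n)%N -> (a < nA M n)%N -> 0 < vphi P n i a),
      (forall a o i, (a < nA M n)%N -> (o < nO M n)%N -> (i < nZ M n)%N ->
          0 < va P n a o i /\ 0 < vb P n a o i) &
      (forall a o i j, (a < nA M n)%N -> (o < nO M n)%N -> (i < nZ M n)%N ->
          (j < nZ M n)%N -> 0 < vsigma P n a o i j /\ 0 < vlambda P n a o i j)].

Definition key := seq nat.
Definition keyU (n i : nat) : key := [:: 0; n; i]%N.
Definition keyV (n a o i j : nat) : key := [:: 1; n; a; o; i; j]%N.
Definition keyRho (n : nat) : key := [:: 2; n]%N.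
Definition keyAl (n a o i : nat) : key := [:: 3; n; a; o; i]%N.
Definition keyPi (n i a : nat) : key := [:: 4; n; i; a]%N.

(* free real coordinates of (Theta, rho, alpha); the last coordinate of each
   pi_{n,i} is determined by the others (simplex) *)
Definition vars (M : model) : seq key :=
  [seq keyU n i | n <- iota 0 (NA M), i <- iota 0 (nZ M n)] ++
  flatten [seq flatten [seq flatten [seq
     [seq keyV n a o i j | i <- iota 0 (nZ M n), j <- iota 0 (nZ M n)]
       | o <- iota 0 (nO M n)] | a <- iota 0 (nA M n)] | n <- iota 0 (NA M)] ++
  [seq keyRho n | n <- iota 0 (NA M)] ++
  flatten [seq flatten [seq
     [seq keyAl n a o i | o <- iota 0 (nO M n), i <- iota 0 (nZ M n)]
       | a <- iota 0 (nA M n)] | n <- iota 0 (NA M)] ++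
  flatten [seq [seq keyPi n i a | i <- iota 0 (nZ M n), a <- iota 0 (nA M n).-1]
     | n <- iota 0 (NA M)].

Definition assign := key -> R.
Definition upd (x : assign) (k : key) (y : R) : assign :=
  fun k' => if k' == k then y else x k'.

Fixpoint iint (l : seq key) (F : assign -> R) (x : assign) : R :=
  match l with
  | [::] => F x
  | k :: l' => \int[@lebesgue_measure R]_(y in [set: R]) iint l' F (upd x k y)
  end.

Definition uX (x : assign) n i := x (keyU n i).
Definition VX (x : assign) n a o i j := x (keyV n a o i j).
Definition rhoX (x : assign) n := x (keyRho n).
Definition alX (x : assign) n a o i := x (keyAl n a o i).
Definition piX (M : model) (x : assign) n i a : R :=
  if a == (nA M n).-1 then 1 - \sum_(b < (nA M n).-1) x (keyPi n i b)
  else x (keyPi n i a).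

Record fsc := FSC {
  feta : nat -> nat -> R;                        (* n i       : eta_n^i *)
  fom : nat -> nat -> nat -> nat -> nat -> R;    (* n a o i j : omega_{n,a,o}^{i,j} *)
  fpi : nat -> nat -> nat -> R                   (* n i a     : pi_{n,i}^a *)
}.

(* stick-breaking construction from an assignment *)
Definition ThetaX (M : model) (x : assign) : fsc :=
  FSC (fun n i => uX x n i * \prod_(m < i) (1 - uX x n m))
      (fun n a o i j => VX x n a o i j * \prod_(m < j) (1 - VX x n a o i m))
      (fun n i a => piX M x n i a).

Definition zpath (M : model) (n t : nat) := {ffun 'I_t.+1 -> 'I_(nZ M n)}.

Definition pjoint (M : model) (th : fsc) (k n t : nat) (z : zpath M n t) : R :=
  feta th n (z ord0) * fpi th n (z ord0) (act M k n 0) *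
  \prod_(tau < t)
     (fom th n (act M k n tau) (obs M k n tau.+1)
          (z (inord tau)) (z (inord tau.+1)) *
      fpi th n (z (inord tau.+1)) (act M k n tau.+1)).

Definition pact (M : model) (th : fsc) (k n t : nat) : R :=
  \sum_(z : zpath M n t) pjoint M th k n t z.

Definition prior_Theta (M : model) (x : assign) : R :=
  (\prod_(n < NA M) \prod_(i < nZ M n) beta_dens 1 (rhoX x n) (uX x n i)) *
  (\prod_(n < NA M) \prod_(a < nA M n) \prod_(o < nO M n) \prod_(i < nZ M n)
     \prod_(j < nZ M n) beta_dens 1 (alX x n a o i) (VX x n a o i j)) *
  (\prod_(n < NA M) \prod_(i < nZ M n)
     dir_dens (nA M n) (htheta M n i) (piX M x n i)).

Definition prior_rho (M : model) (x : assign) : R :=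
  \prod_(n < NA M) gamma_dens (he M) (hf M) (rhoX x n).

Definition prior_alpha (M : model) (x : assign) : R :=
  \prod_(n < NA M) \prod_(a < nA M n) \prod_(o < nO M n) \prod_(i < nZ M n)
    gamma_dens (hc M n a o) (hd M n a o) (alX x n a o i).

Definition qdens (M : model) (P : vparams) (x : assign) : R :=
  (\prod_(n < NA M) \prod_(i < nZ M n)
     beta_dens (vdelta P n i) (vmu P n i) (uX x n i)) *
  (\prod_(n < NA M) \prod_(a < nA M n) \prod_(o < nO M n) \prod_(i < nZ M n)
     \prod_(j < nZ M n)
     beta_dens (vsigma P n a o i j) (vlambda P n a o i j) (VX x n a o i j)) *
  (\prod_(n < NA M) gamma_dens (vg P n) (vh P n) (rhoX x n)) *
  (\prod_(n < NA M) \prod_(a < nA M n) \prod_(o < nO M n) \prod_(i < nZ M n)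
     gamma_dens (va P n a o i) (vb P n a o i) (alX x n a o i)) *
  (\prod_(n < NA M) \prod_(i < nZ M n)
     dir_dens (nA M n) (vphi P n i) (piX M x n i)).

Definition Eq (M : model) (P : vparams) (F : assign -> R) : R :=
  iint (vars M) (fun x => qdens M P x * F x) (fun _ => 0).

Definition Theta_tilde (M : model) (P : vparams) : fsc :=
  FSC (fun n i => expR (Eq M P (fun x => ln (feta (ThetaX M x) n i))))
      (fun n a o i j => expR (Eq M P (fun x => ln (fom (ThetaX M x) n a o i j))))
      (fun n i a => expR (Eq M P (fun x => ln (fpi (ThetaX M x) n i a)))).

Definition pPi_all (M : model) k t : R := \prod_(n < NA M) pPi M k n t.

Definition rtilde (M : model) k t : R :=
  gam M ^+ t * (rew M k t - Rmin M) / pPi_all M k t.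

Definition Vhat (M : model) (th : fsc) : R :=
  (KK M)%:R^-1 * \sum_(k < KK M) \sum_(t < (TT M k).+1)
     rtilde M k t * \prod_(n < NA M) pact M th k n t.

Definition nutilde (M : model) (P0 : vparams) k t : R :=
  let th := Theta_tilde M P0 in
  gam M ^+ t * (rew M k t - Rmin M) * (\prod_(n < NA M) pact M th k n t) /
  (pPi_all M k t * Vhat M th).

Definition zvec (M : model) (t : nat) :=
  {dffun forall n : 'I_(NA M), zpath M n t}.

Definition qz (M : model) (P0 : vparams) k t (zz : zvec M t) : R :=
  let th := Theta_tilde M P0 in
  nutilde M P0 k t * \prod_(n < NA M) (pjoint M th k n t (zz n) / pact M th k n t).

Definition qmarg1 (M : model) (P0 : vparams) k n t tau (i : nat) : R :=
  let th := Theta_tilde M P0 in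
  nutilde M P0 k t *
  ((\sum_(z : zpath M n t | (z (inord tau) : nat) == i) pjoint M th k n t z) / pact M th k n t).

Definition qmarg2 (M : model) (P0 : vparams) k n t tau (i j : nat) : R :=
  let th := Theta_tilde M P0 in
  nutilde M P0 k t *
  ((\sum_(z : zpath M n t | ((z (inord tau.-1) : nat) == i) && ((z (inord tau) : nat) == j))
      pjoint M th k n t z) / pact M th k n t).

(* ELBO (q(z) fixed, built from parameters P0; q(Theta,rho,alpha) from P) *)
Definition ELBO (M : model) (P0 P : vparams) : R :=
  (KK M)%:R^-1 * \sum_(k < KK M) \sum_(t < (TT M k).+1) \sum_(zz : zvec M t)
     qz M P0 k t zz *
     Eq M P (fun x => ln (rtilde M k t *
                          \prod_(n < NA M) pjoint M (ThetaX M x) k n t (zz n)))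
  + Eq M P (fun x => ln (prior_Theta M x))
  + Eq M P (fun x => ln (prior_rho M x))
  + Eq M P (fun x => ln (prior_alpha M x))
  - Eq M P (fun x => ln (qdens M P x))
  - (KK M)%:R^-1 * \sum_(k < KK M) \sum_(t < (TT M k).+1) \sum_(zz : zvec M t)
     qz M P0 k t zz * ln (qz M P0 k t zz).

Definition set_u (P : vparams) n0 i0 (d m : R) : vparams :=
  VParams (fun n i => if (n == n0) && (i == i0) then d else vdelta P n i)
          (fun n i => if (n == n0) && (i == i0) then m else vmu P n i)
          (vsigma P) (vlambda P) (vg P) (vh P) (va P) (vb P) (vphi P).

Definition set_V (P : vparams) n0 a0 o0 i0 j0 (s l : R) : vparams :=
  let hit n a o i j := [&& n == n0, a == a0, o == o0, i == i0 & j == j0] in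
  VParams (vdelta P) (vmu P)
          (fun n a o i j => if hit n a o i j then s else vsigma P n a o i j)
          (fun n a o i j => if hit n a o i j then l else vlambda P n a o i j)
          (vg P) (vh P) (va P) (vb P) (vphi P).

Definition set_rho (P : vparams) n0 (g h : R) : vparams :=
  VParams (vdelta P) (vmu P) (vsigma P) (vlambda P)
          (fun n => if n == n0 then g else vg P n)
          (fun n => if n == n0 then h else vh P n)
          (va P) (vb P) (vphi P).

Definition set_alpha (P : vparams) n0 a0 o0 i0 (a' b' : R) : vparams :=
  let hit n a o i := [&& n == n0, a == a0, o == o0 & i == i0] in
  VParams (vdelta P) (vmu P) (vsigma P) (vlambda P) (vg P) (vh P)
          (fun n a o i => if hit n a o i then a' else va P n a o i)
          (fun n a o i => if hit n a o i then b' else vb P n a o i)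
          (vphi P).

Definition set_pi (P : vparams) n0 i0 (v : nat -> R) : vparams :=
  VParams (vdelta P) (vmu P) (vsigma P) (vlambda P) (vg P) (vh P) (va P) (vb P)
          (fun n i a => if (n == n0) && (i == i0) then v a else vphi P n i a).

Definition avg (M : model) (F : nat -> nat -> R) : R :=
  \sum_(k < KK M) (KK M)%:R^-1 * \sum_(t < (TT M k).+1) F k t.

Definition upd_delta M P0 (P : vparams) n i : R :=
  1 + avg M (fun k t => qmarg1 M P0 k n t 0 i).
Definition upd_mu M P0 (P : vparams) n i : R :=
  vg P n / vh P n +
  avg M (fun k t => \sum_(i.+1 <= m < nZ M n) qmarg1 M P0 k n t 0 m).
Definition upd_phi M P0 (P : vparams) n i (a : nat) : R :=
  htheta M n i a +
  avg M (fun k t => \sum_(0 <= tau < t.+1)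
     qmarg1 M P0 k n t tau i * (act M k n tau == a)%:R).
Definition upd_sigma M P0 (P : vparams) n a o i j : R :=
  1 + avg M (fun k t => \sum_(1 <= tau < t.+1)
     qmarg2 M P0 k n t tau i j *
     ((act M k n tau.-1 == a) && (obs M k n tau == o))%:R).
Definition upd_lambda M P0 (P : vparams) n a o i j : R :=
  va P n a o i / vb P n a o i +
  avg M (fun k t => \sum_(1 <= tau < t.+1) \sum_(j.+1 <= m < nZ M n)
     qmarg2 M P0 k n t tau i m *
     ((act M k n tau.-1 == a) && (obs M k n tau == o))%:R).
Definition upd_g M (P : vparams) n : R := he M + (nZ M n)%:R.
Definition upd_h M (P : vparams) n : R :=
  hf M - \sum_(i < nZ M n)
     (digamma (vmu P n i) - digamma (vdelta P n i + vmu P n i)).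
Definition upd_a M (P : vparams) n a o (i : nat) : R := hc M n a o + (nZ M n)%:R.
Definition upd_b M (P : vparams) n a o i : R :=
  hd M n a o - \sum_(j < nZ M n)
     (digamma (vlambda P n a o i j) - digamma (vsigma P n a o i j + vlambda P n a o i j)).

End FSC.

Arguments wf_model {R}.
Arguments vpos {R}.
Arguments ELBO {R}.
Arguments set_u {R}.
Arguments set_V {R}.
Arguments set_rho {R}.
Arguments set_alpha {R}.
Arguments set_pi {R}.
Arguments upd_delta {R}.
Arguments upd_mu {R}.
Arguments upd_phi {R}.
Arguments upd_sigma {R}.
Arguments upd_lambda {R}.
Arguments upd_g {R}.
Arguments upd_h {R}.
Arguments upd_a {R}.
Arguments upd_b {R}.
Arguments NA {R}.
Arguments nA {R}.
Arguments nO {R}.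
Arguments nZ {R}.

(* Main.v *)
(* With all but one factor fixed, the ELBO as a function of that factor [q] is
   E_q[ln q'] - E_q[ln q] + const, where [q'] is again a Beta, Gamma or Dirichlet
   density, with the announced parameters: conjugacy makes the log-joint linear in
   ln u, ln(1-u), rho, ln rho and ln pi.  By Gibbs' inequality this is maximal at
   [q = q'].  Gibbs' inequality only needs normalized densities, so the exponential
   family enters through the Gamma integral, the Beta integral (Tonelli), the Dirichlet
   integral (iterated Beta integrals), and, for the Gamma updates, through
   E[rho] = g/h and E[ln(1-u)] = Psi(mu) - Psi(delta+mu). *)
Require Import Defs.
From HB Require Import structures.
From mathcomp Require Import all_boot all_order all_algebra.
From mathcomp Require Import all_classical all_reals.
From mathcomp Require Import topology normedtype sequences derive exp.
From mathcomp Require Import measure lebesgue_measure lebesgue_integral.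
From mathcomp Require Import ereal realfun numfun measurable_realfun ftc exponential_distribution.
From mathcomp Require Import interval_inference ring lra.
Set Implicit Arguments.
Unset Strict Implicit.
Unset Printing Implicit Defensive.
Import Order.TTheory GRing.Theory Num.Theory.
Import numFieldNormedType.Exports.
Local Open Scope classical_set_scope.
Local Open Scope ring_scope.

(** * Integrals over the real line *)

(** Real-valued integrals take default values on non-integrable functions, and [iint] nests them, so
    even linearity of [Eq] can fail without integrability at every stage. Each expectation is
    therefore established together with its integrability ([HasI], [HasE]), and logarithms of
    products are split only on the support of the variational density ([HasLn]). The distribution of
    the paths is built from [P0] and stays fixed, so the data enter only through expected visit
    counts, which are constants. The ELBO then becomes a constant plus one sum of terms per agent.
    Two factors meet in one term only through [rho * ln (1 - u)] and [alpha * ln (1 - V)]; this is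
    how posterior means enter the Beta updates and digamma differences the Gamma updates. The tail
    sums come from exchanging the order of summation in the logarithm of a stick-breaking product.
    The expectation of [ln (1 - u)] is the slope of the Beta function in its second argument. The
    slope is identified by an affine minorant that touches the function, and the same device gives
    the recurrence of the Gamma function. *)

Definition L1 {R : realType} (f : R -> R) :=
  (@lebesgue_measure R).-integrable setT (EFin \o f).

Definition Int {R : realType} (f : R -> R) : R := \int[@lebesgue_measure R]_x f x.

(** Lebesgue measure is determined by its values on half-open intervals, and the preimage of []a,
    b]] has length [(b - a) / c]. *)
Lemma affine_measure (R : realType) (c d : R) (A : set R) : 0 < c -> measurable A ->
  (c%:E * pushforward (@lebesgue_measure R)
     (fun x : measurableTypeR R => (c * x + d)%R : measurableTypeR R) A)%E =
  lebesgue_measure A.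
Proof.
move=> c0 mA.
have mphi : measurable_fun setT (fun x : measurableTypeR R => c * x + d : measurableTypeR R).
  by apply: measurable_funD => //; apply: measurable_funM.
pose m' := mscale (NngNum (ltW c0)) (pushforward (@lebesgue_measure R)
  (fun x : measurableTypeR R => c * x + d : measurableTypeR R)).
pose m : {measure set (measurableTypeR R) -> \bar R} := m' mphi.
have -> : (c%:E * pushforward lebesgue_measure (fun x => c * x + d)%R A = m A)%E by [].
apply/esym.
apply: (@lebesgue_measure_unique R m) mA => _ [[a b]] _ <-.
have pre : (fun x : R => c * x + d) @^-1` `]a, b] = `](a - d) / c, (b - d) / c]%classic.
  apply/seteqP; split => x /=; rewrite !in_itv/= ltr_pdivrMr// ler_pdivlMr//;
    by rewrite ltrBlDr lerBrDr ![x * c]mulrC.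
have -> : (m `]a, b]%classic = c%:E * lebesgue_measure ((fun x : R => c * x + d)%R @^-1` `]a, b]))%E by [].
rewrite pre.
rewrite !lebesgue_measure_itv/= !lte_fin ltr_pM2r ?invr_gt0// ltrD2r.
case: ifPn => _; last by rewrite mule0.
by rewrite -!EFinD -EFinM -mulrBl mulrC divfK ?gt_eqF// opprB addrA subrK.
Qed.

Lemma affine_integral (R : realType) (c d : R) (f : R -> \bar R) : 0 < c ->
  measurable_fun setT f -> (forall x, 0 <= f x)%E ->
  (\int[@lebesgue_measure R]_x f (c * x + d)%R =
   (c^-1)%:E * \int[@lebesgue_measure R]_x f x)%E.
Proof.
move=> c0 mf f0.
have mphi : measurable_fun setT (fun x : measurableTypeR R => c * x + d : measurableTypeR R).
  by apply: measurable_funD => //; apply: measurable_funM.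
pose m' := mscale (NngNum (ltW c0)) (pushforward (@lebesgue_measure R)
  (fun x : measurableTypeR R => c * x + d : measurableTypeR R)).
pose m : {measure set (measurableTypeR R) -> \bar R} := m' mphi.
have -> : (\int[@lebesgue_measure R]_x f x = \int[m]_x f x)%E.
  apply: eq_measure_integral => A mA _.
  by apply/esym; exact: affine_measure.
rewrite ge0_integral_mscale//= ge0_integral_pushforward//= preimage_setT.
by rewrite muleA -EFinM mulVf ?gt_eqF// mul1e.
Qed.

Section L1.
Context {R : realType}.
Implicit Types f g : R -> R.
Local Notation mu := (@lebesgue_measure R).

Lemma L1_measurable f : L1 f -> measurable_fun setT f.
Proof. by move=> /integrableP[/measurable_EFinP]. Qed.

Lemma L1_ext f g : f =1 g -> L1 f -> L1 g.
Proof. by move=> /funext ->. Qed.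

Lemma Int_ext f g : f =1 g -> Int f = Int g.
Proof. by move=> /funext ->. Qed.

Lemma L1D f g : L1 f -> L1 g -> L1 (fun x => f x + g x).
Proof. exact: integrableD. Qed.

Lemma L1Z c f : L1 f -> L1 (fun x => c * f x).
Proof. exact: integrableZl. Qed.

Lemma L10 : L1 (fun=> 0 : R).
Proof. exact: integrable0. Qed.

Lemma L1_dom f g : measurable_fun setT f -> L1 g ->
  (forall x, `|f x| <= g x) -> L1 f.
Proof.
move=> mf ig fg; apply: le_integrable ig => //; first exact/measurable_EFinP.
by move=> x _ /=; rewrite lee_fin (le_trans (fg x))// ler_norm.
Qed.

Lemma IntD f g : L1 f -> L1 g -> Int (fun x => f x + g x) = Int f + Int g.
Proof. exact: RintegralD. Qed.

Lemma IntZ c f : L1 f -> Int (fun x => c * f x) = c * Int f.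
Proof. exact: RintegralZl. Qed.

Lemma Int0 : Int (fun=> 0 : R) = 0.
Proof. by rewrite /Int Rintegral_cst// mul0r. Qed.

Lemma le_Int f g : L1 f -> L1 g -> (forall x, f x <= g x) -> Int f <= Int g.
Proof. by move=> *; apply: le_Rintegral. Qed.

Lemma L1_EFin f : L1 f -> (\int[mu]_x (f x)%:E = (Int f)%:E)%E.
Proof. by move=> /(integrable_fin_num _) h; rewrite fineK// h. Qed.

(** The way back from the extended reals, where substitution and Tonelli are carried out: a finite
    value yields integrability as well. *)
Lemma ge0_integral_EFin f r : measurable_fun setT f -> (forall x, 0 <= f x) ->
  (\int[mu]_x (f x)%:E = r%:E)%E -> L1 f /\ Int f = r.
Proof.
move=> mf f0 fr; split; last by rewrite /Int /Rintegral fr.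
apply/integrableP; split; first exact/measurable_EFinP.
under eq_integral do rewrite gee0_abs ?lee_fin//.
by rewrite fr ltry.
Qed.

Lemma L1_affine c d f : 0 < c -> L1 f ->
  L1 (fun x => f (c * x + d)) /\ Int (fun x => f (c * x + d)) = c^-1 * Int f.
Proof.
move=> c0 Lf.
have mf := L1_measurable Lf.
have maff : measurable_fun setT (fun x : R => c * x + d).
  by apply: measurable_funD => //; apply: measurable_funM.
(* The substitution is available for nonnegative functions only; [f] is treated through its positive
   and negative parts. *)
have key g : measurable_fun setT g -> (forall x, 0 <= g x) -> L1 g ->
    L1 (fun x => g (c * x + d)) /\ Int (fun x => g (c * x + d)) = c^-1 * Int g.
  move=> mg g0 Lg; apply: ge0_integral_EFin => //.
    exact: measurableT_comp.
  rewrite (@affine_integral _ c d (EFin \o g))//; first by rewrite L1_EFin.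
  exact/measurable_EFinP.
have Lp : L1 (f^\+) by apply: integrable_funrpos.
have Ln : L1 (f^\-) by apply: integrable_funrneg.
have [Lp' Ip] := key _ (measurable_funrpos mf) (funrpos_ge0 f) Lp.
have [Ln' In] := key _ (measurable_funrneg mf) (funrneg_ge0 f) Ln.
have E x : f x = f^\+ x + -1 * f^\- x.
  by rewrite mulN1r -[in LHS](funrposBneg f).
split.
  apply: (@L1_ext (fun x => f^\+ (c * x + d) + -1 * f^\- (c * x + d))).
    by move=> x; rewrite -E.
  by apply: L1D => //; apply: L1Z.
rewrite (Int_ext (fun x => E (c * x + d))) [in RHS](Int_ext E).
rewrite !IntD ?IntZ//; [|exact: L1Z|exact: L1Z].
by rewrite Ip In mulrDr mulrCA.
Qed.

Lemma L1_scale c f : 0 < c -> L1 f ->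
  L1 (fun x => f (c * x)) /\ Int (fun x => f (c * x)) = c^-1 * Int f.
Proof.
move=> c0 Lf; have [L I] := L1_affine 0 c0 Lf.
have E : (fun x => f (c * x + 0)) =1 (fun x => f (c * x)) by move=> x; rewrite addr0.
by rewrite -(Int_ext E); split => //; exact: L1_ext E L.
Qed.

End L1.

(* The affine minorant [F x + h * l] touches [F] at [h = 0]. *)
Lemma derive_minorant (R : realType) (F : R -> R) (x l r : R) : 0 < r ->
  (forall y, `|y - x| < r -> derivable F y 1) ->
  (forall h, `|h| < r -> F x + h * l <= F (x + h)) ->
  derive1 F x = l.
Proof.
move=> r0 dF Fm.
have dF' (y : R) : `|y - x| < r -> is_derive y 1 F (derive1 F y).
  by move=> /dF ?; rewrite derive1E; apply/derivableP.
(* The gap between [F] and its minorant is minimal at [x], so its derivative vanishes there. *)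
pose G := F - (fun y : R => (y - x) * l).
have dG (y : R) : `|y - x| < r -> is_derive y 1 G (derive1 F y - l).
  move=> /dF' H; rewrite /G; apply: is_deriveB.
  by apply: is_derive_eq; rewrite scaler0 add0r subr0 /GRing.scale/= mulr1.
have xx : `|x - x| < r by rewrite subrr normr0.
have : is_derive x 1 G 0.
  apply: (@derive1_at_min _ G (x - r) (x + r)).
  - by rewrite lerD2l; lra.
  - move=> t; rewrite in_itv/= -ltr_distl => tx.
    by have [] := dG _ tx.
  - by rewrite in_itv/= -ltr_distl.
  - move=> t; rewrite in_itv/= -ltr_distl => /Fm.
    rewrite addrCA subrr addr0 /G !fctE subrr mul0r subr0; lra.
by move=> [_ H]; have [_] := dG _ xx; rewrite H => /esym/eqP; rewrite subr_eq0 => /eqP.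
Qed.

(** * The Gamma function *)

Section Gamma.
Context {R : realType}.
Local Notation mu := (@lebesgue_measure R).

(** The Gamma integrand is extended by zero, so that every integral runs over the whole line and
    substitutions need no change of domain. *)
Definition gfun (a x : R) := if 0 < x then x `^ (a - 1) * expR (- x) else 0.

Lemma measurable_gfun a : measurable_fun setT (gfun a).
Proof.
apply: measurable_fun_ifT => //; first exact: measurable_fun_ltr.
apply: measurable_funM; first exact: measurable_powR.
by apply: measurableT_comp => //.
Qed.

Lemma gfun_ge0 a x : 0 <= gfun a x.
Proof. by rewrite /gfun; case: ifP => // _; rewrite mulr_ge0// ?powR_ge0// expR_ge0. Qed.

Lemma GammaRE a : GammaR R a = Int (gfun a).
Proof.
rewrite /GammaR Rintegral_mkcond; apply: Int_ext => x.
rewrite /gfun patchE; case: ifPn => [|/negP xn].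
  by rewrite inE/= in_itv/= andbT => ->.
case: ifPn => // x0; case: xn; by rewrite inE/= in_itv/= andbT.
Qed.

(** This function dominates the tail of the Gamma integrand; up to a factor 2 it is the exponential
    density of rate [1 / 2]. *)
Lemma L1_exp_half : L1 (fun x : R => if 0 < x then expR (- (x / 2)) else 0).
Proof.
have h : 0 < 2^-1 :> R by rewrite invr_gt0.
have Le : L1 (exponential_pdf (2^-1 : R)) by exact: integrable_exponential_pdf.
apply: L1_dom (L1Z 2 Le) _.
  apply: measurable_fun_ifT => //; first exact: measurable_fun_ltr.
  apply: measurableT_comp => //; apply: measurableT_comp => //.
  exact: measurable_funM.
move=> x; case: ifPn => x0.
  rewrite exponential_pdfE; [|exact: ltW]; rewrite mulrA divff// mul1r.
  rewrite ger0_norm ?expR_ge0//.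
  by rewrite ler_expR mulNr mulrC.
by rewrite normr0 mulr_ge0// exponential_pdf_ge0.
Qed.

(** The antiderivative is [x ^ a / a]. The bound does not depend on [c], which allows [c] to tend to
    0 afterwards. *)
Lemma integral_powR_itv (a c : R) : 0 < a -> 0 < c < 1 ->
  (\int[mu]_(x in `[c, 1%R]) (x `^ (a - 1))%:E <= (a^-1)%:E)%E.
Proof.
move=> a0 /andP[c0 c1].
have pos x : x \in `[c, 1]%R -> 0 < x.
  by rewrite in_itv/= => /andP[cx _]; exact: lt_le_trans cx.
have derp (b x : R) : 0 < x -> derivable (fun y : R => y `^ b) x 1.
  by move=> x0; apply: derivable_powR; rewrite in_itv/= andbT.
pose F : R -> R := a^-1 *: (fun x : R => x `^ a).
have isdF (x : R) : 0 < x -> is_derive x 1 F (x `^ (a - 1)).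
  move=> x0; have := is_derive1_powR a x0 => H.
  rewrite (_ : x `^ _ = a^-1 *: (a * x `^ (a - 1))); first exact: is_deriveZ.
  by rewrite /GRing.scale/= mulrA mulVf ?gt_eqF// mul1r.
have dF (x : R) : 0 < x -> derivable F x 1 by move=> /isdF[].
have cF (x : R) : 0 < x -> {for x, continuous F}.
  by move=> x0; apply: differentiable_continuous; apply/derivable1_diffP/dF.
rewrite (@continuous_FTC2 _ _ F)//.
- by rewrite -EFinB lee_fin /F !fctE /GRing.scale/= powR1 mulr1 gerBl mulr_ge0 ?invr_ge0 ?ltW ?powR_gt0.
- by apply: derivable_within_continuous => x /pos; exact: derp.
- split.
  + by move=> x /subset_itv_oo_cc/pos/dF.
  + by apply: cvg_at_right_filter; apply: cF.
  + by apply: cvg_at_left_filter; apply: cF.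
- move=> x /subset_itv_oo_cc/pos x0.
  by rewrite derive1E; have [_] := isdF _ x0.
Qed.

Lemma L1_pow01 (a : R) : 0 < a ->
  L1 (fun x : R => if (0 < x) && (x < 1) then x `^ (a - 1) else 0).
Proof.
move=> a0.
(* The left ends [1 / (n + 2)] lie strictly inside []0, 1[], as [integral_powR_itv] requires; these
   intervals increase to []0, 1]]. *)
pose F n : set R := `[(n.+2%:R)^-1, 1]%classic.
have UF : \bigcup_n F n = `]0, 1]%classic.
  apply/seteqP; split => x /=.
    move=> [n _]; rewrite /F/= !in_itv/= => /andP[nx ->]; rewrite andbT.
    by apply: lt_le_trans nx; rewrite invr_gt0.
  rewrite in_itv/= => /andP[x0 x1]; exists (Num.trunc x^-1) => //.
  rewrite /F/= in_itv/= x1 andbT invf_ple ?posrE//.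
  by rewrite (le_trans (ltW (truncnS_gt _)))// ler_nat.
have mpow : measurable_fun setT (fun x : R => x `^ (a - 1)) by exact: measurable_powR.
have le : (\int[mu]_(x in `]0%R, 1%R]) (x `^ (a - 1))%:E <= (a^-1)%:E)%E.
  rewrite -UF.
  have ndF : nondecreasing_seq F.
    apply/nondecreasing_seqP => n; rewrite subsetEset.
    by apply: subset_itvr; rewrite bnd_simp lef_pV2 ?posrE// ler_nat.
  have mF n : measurable (F n) by exact: measurable_itv.
  have mfF n : measurable_fun (F n) (fun x : R => (x `^ (a - 1))%:E).
    by apply/measurable_EFinP; exact: measurable_funTS.
  have f0 n x : F n x -> (0 <= (x `^ (a - 1))%:E)%E by rewrite lee_fin powR_ge0.
  have cv := @ge0_nondecreasing_set_cvg_integral _ _ R _ _ mu ndF mF mfF f0.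
  move/cvg_lim : (cv) => <- //; apply: lime_le; first by apply/cvg_ex; eexists; exact: cv.
  apply: nearW => n; apply: integral_powR_itv => //.
  by rewrite invr_gt0 ltr0n/= invf_lt1// ltr1n.
have L : mu.-integrable `]0, 1] (EFin \o (fun x : R => x `^ (a - 1))).
  apply/integrableP; split; first by apply/measurable_EFinP; exact: measurable_funTS.
  under eq_integral do rewrite gee0_abs ?lee_fin ?powR_ge0//.
  by apply: le_lt_trans le _; rewrite ltry.
rewrite integrable_mkcond// in L.
have L' : L1 ((fun x : R => x `^ (a - 1)) \_ `]0, 1]) by rewrite /L1 -restrict_EFin.
apply: L1_dom L' _.
  apply: measurable_fun_ifT => //.
  by apply: measurable_and; exact: measurable_fun_ltr.
move=> x; case: ifPn => [/andP[x0 x1]|_].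
  by rewrite patchE ifT ?ger0_norm ?powR_ge0// inE/= in_itv/= x0 ltW.
by rewrite normr0; apply: restrict_ge0 => {}x _; rewrite powR_ge0.
Qed.

(** With [p = |a - 1| + 1], write [p ln x = p ln (x / (2 p)) + p ln (2 p)] and use [ln y < y]: the
    scale [2 p] makes the first term cost exactly [x / 2], half of the exponential decay, and the
    second term becomes the constant. *)
Lemma powR_exp_bound (a : R) : exists2 C, 0 <= C &
  forall x, 1 <= x -> x `^ (a - 1) * expR (- x) <= C * expR (- (x / 2)).
Proof.
pose p := `|a - 1| + 1.
have p0 : 0 < p by rewrite ltr_wpDl.
exists (expR (p * ln (2 * p))); first exact: expR_ge0.
move=> x x1; have x0 : 0 < x by apply: lt_le_trans x1.
rewrite /powR gt_eqF// -!expRD ler_expR.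
have h1 : (a - 1) * ln x <= p * ln x.
  apply: ler_wpM2r; first exact: ln_ge0.
  by rewrite /p (le_trans (ler_norm _))// lerDl.
have h2 : ln x = ln (x / (2 * p)) + ln (2 * p).
  by rewrite -lnM ?posrE ?divr_gt0 ?mulr_gt0// divfK// gt_eqF// mulr_gt0.
have h3 : ln (x / (2 * p)) < x / (2 * p) by apply: ln_sublinear; rewrite divr_gt0 ?mulr_gt0.
have h4 : p * ln x <= p * (x / (2 * p) + ln (2 * p)).
  by apply: ler_wpM2l; [exact: ltW|rewrite {1}h2 lerD2r ltW].
have h5 : p * (x / (2 * p)) = x / 2 by field; rewrite gt_eqF.
lra.
Qed.

Lemma L1_gfun a : 0 < a -> L1 (gfun a).
Proof.
move=> a0; have [C C0 HC] := powR_exp_bound a.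
apply: L1_dom (L1D (L1_pow01 a0) (L1Z C L1_exp_half)) _.
  exact: measurable_gfun.
move=> x; rewrite ger0_norm ?gfun_ge0// /gfun.
case: ifPn => x0; last by rewrite mulr0 addr0.
case: ltP => x1 /=.
  rewrite (@le_trans _ _ (x `^ (a - 1)))//.
    rewrite ler_piMr ?powR_ge0//; rewrite -expR0 ler_expR; lra.
  by rewrite lerDl mulr_ge0// expR_ge0.
by rewrite add0r HC.
Qed.

Lemma GammaR_gt0 (a : R) : 0 < a -> 0 < GammaR R a.
Proof.
move=> a0; rewrite GammaRE.
(* On [[1, 2]] both [ln x] and [x] are at most 2, so [m] bounds the integrand from below there. *)
pose m := expR (- `|a - 1| * 2 - 2).
have m0 : 0 < m := expR_gt0 _.
pose f := fun x : R => m * \1_(`[1, 2]%classic : set R) x.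
have L01 : L1 (\1_(`[1, 2]%classic : set R)).
  exact: (@integrable_indic_itv R 1 2 true false).
apply: (@lt_le_trans _ _ (Int f)).
  rewrite /f IntZ// mulr_gt0//.
  rewrite /Int /Rintegral integral_indic// setIT.
  have E : mu `[1, 2]%classic = (2 - 1)%:E.
    by rewrite lebesgue_measure_itv/= lte_fin ltr1n.
  rewrite [X in fine X](_ : _ = (2 - 1)%:E); last exact: E.
  by rewrite /=; lra.
apply: le_Int; [exact: L1Z|exact: L1_gfun|move=> x].
rewrite /f indicE; case: (boolP (x \in _)) => /=; last by rewrite mulr0 gfun_ge0.
rewrite inE/= in_itv/= => /andP[x1 x2].
have x0 : 0 < x by exact: lt_le_trans x1.
rewrite mulr1 /gfun x0 /powR gt_eqF// -expRD ler_expR.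
have l0 : 0 <= ln x by apply: ln_ge0.
have l2 : ln x <= 2 by apply: ltW; apply: lt_le_trans x2; exact: ln_sublinear.
have h : - (a - 1) * ln x <= `|a - 1| * 2.
  rewrite (le_trans (ler_norm _))// normrM normrN ler_wpM2l//.
  by rewrite ger0_norm.
lra.
Qed.

End Gamma.

Section GammaTheory.
Context {R : realType}.
Local Notation mu := (@lebesgue_measure R).

(** Apply [ln y < y] to [x ^ e] and to [x ^ (- e)]. A logarithmic factor thus costs an arbitrarily
    small shift of the exponent. *)
Lemma normr_ln_le (e x : R) : 0 < e -> 0 < x ->
  `|ln x| <= e^-1 * (x `^ e + x `^ (- e)).
Proof.
move=> e0 x0; rewrite ler_pdivlMl//.
have p0 b : 0 < x `^ b by exact: powR_gt0.
have h1 : e * ln x < x `^ e by rewrite -ln_powR; exact: ln_sublinear.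
have h2 : - e * ln x < x `^ (- e) by rewrite -ln_powR; exact: ln_sublinear.
have pe := p0 e; have pNe := p0 (- e).
rewrite mulNr in h2.
case: (lerP 0 (ln x)) => l0; first by rewrite (ger0_norm l0); lra.
by rewrite (ltr0_norm l0) mulrN; lra.
Qed.

Lemma powRDm1 (x a e : R) : 0 < x -> x `^ (a + e - 1) = x `^ (a - 1) * x `^ e.
Proof. by move=> x0; rewrite -powRD ?(gt_eqF x0) ?implybT// addrAC. Qed.

Lemma L1_gfun_ln (a : R) : 0 < a -> L1 (fun x => gfun a x * ln x).
Proof.
(* This choice keeps the shifted exponent [a - e] positive. *)
move=> a0; pose e := a / 2.
have e0 : 0 < e by rewrite divr_gt0.
have L : L1 (fun x => e^-1 * (gfun (a + e) x + gfun (a + - e) x)).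
  by apply: L1Z; apply: L1D; apply: L1_gfun; rewrite /e; lra.
apply: L1_dom L _; first by apply: measurable_funM; [exact: measurable_gfun|exact: measurable_ln].
move=> x; rewrite normrM ger0_norm ?gfun_ge0// /gfun.
case: ifPn => x0; last by rewrite mul0r addr0 mulr0.
rewrite !powRDm1// (mulrAC _ (x `^ e)) (mulrAC _ (x `^ (- e))) -mulrDr mulrCA.
by rewrite ler_wpM2l ?mulr_ge0 ?powR_ge0 ?expR_ge0// normr_ln_le.
Qed.

Lemma is_derive_gfun (b x : R) : is_derive b 1 (fun c : R => gfun c x) (gfun b x * ln x).
Proof.
rewrite /gfun; case: ifPn => x0; last by rewrite mul0r; exact: is_derive_cst.
have E c : x `^ (c - 1) * expR (- x) = expR ((c - 1) * ln x - x).
  by rewrite /powR gt_eqF// expRD.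
under eq_fun do rewrite E.
rewrite E.
apply: is_derive_eq.
by rewrite scaler0 !add0r !subr0 /GRing.scale/= mulr1.
Qed.

(** Below 1 the smaller exponent gives the larger power, above 1 the larger one does. The sum is a
    majorant uniform in [b], as differentiation under the integral sign requires. *)
Lemma gfun_le (u b v x : R) : u <= b <= v -> gfun b x <= gfun u x + gfun v x.
Proof.
move=> /andP[ub bv]; rewrite /gfun; case: ifPn => x0; last by rewrite addr0.
rewrite -mulrDl ler_wpM2r ?expR_ge0//.
case: (lerP x 1) => x1.
  apply: (@le_trans _ _ (x `^ (u - 1))); last by rewrite lerDl powR_ge0.
  by apply: ger_powR; [rewrite x0|rewrite lerD2r].
apply: (@le_trans _ _ (x `^ (v - 1))); last by rewrite lerDr powR_ge0.
by apply: ler_powR; [exact: ltW|rewrite lerD2r].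
Qed.

Lemma derivable_GammaR (a : R) : 0 < a -> derivable (GammaR R) a 1.
Proof.
move=> a0.
have -> : GammaR R = (fun b : R => Int (fun x => gfun b x)).
  by apply/funext => b; exact: GammaRE.
(* An integrable majorant of the derivative in the parameter, valid for all parameters in []a / 2, a
   + a[], a neighbourhood of [a] that stays away from 0. *)
pose G x := (gfun (a / 2) x + gfun (a + a) x) * `|ln x| : R.
have LG : L1 G.
  have L1n b : 0 < b -> L1 (fun x : R => gfun b x * `|ln x|).
    move=> b0; have := integrable_norm (L1_gfun_ln b0).
    apply: L1_ext => x; rewrite /= normrM ger0_norm//; exact: gfun_ge0.
  apply: (@L1_ext _ (fun x => gfun (a / 2) x * `|ln x| + gfun (a + a) x * `|ln x|)).
    by move=> x; rewrite /G mulrDl.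
  by apply: L1D; apply: L1n; lra.
have dE (b y : R) : partial1of2 (@gfun R) b y = gfun b y * ln y.
  by rewrite /partial1of2 derive1E; have [_] := is_derive_gfun b y.
apply: (@derivable_under_integral R _ _ mu (@gfun R) setT _ a (a / 2) (a + a) _ _ _ G) => //.
- by rewrite /= in_itv/=; lra.
- move=> x; rewrite /= in_itv/= => /andP[ax _]; apply: L1_gfun; lra.
- by move=> x y _ _; have [] := is_derive_gfun x y.
- by move=> y; rewrite mulr_ge0// addr_ge0// gfun_ge0.
- move=> x y; rewrite /= in_itv/= => /andP[ax xa] _; rewrite dE normrM ler_wpM2r//.
  by rewrite ger0_norm ?gfun_ge0// gfun_le// !ltW.
Qed.

(* [e^(-yx) >= e^(-x) (1 - (y - 1) x)] makes [GammaR a - (y - 1) GammaR (a + 1)]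
   a minorant of [y ^ (-a) GammaR a] that touches it at [y = 1]. *)
Lemma GammaRS (a : R) : 0 < a -> GammaR R (a + 1) = a * GammaR R a.
Proof.
move=> a0.
pose F : R -> R := GammaR R a *: (fun y : R => y `^ (- a)).
have dF (y : R) : 0 < y -> is_derive y 1 F (GammaR R a *: (- a * y `^ (- a - 1))).
  by move=> y0; have H := is_derive1_powR (- a) y0; exact: is_deriveZ.
have a10 : 0 < a + 1 by rewrite addr_gt0.
have H1 y : `|y - 1| < 1 -> derivable F y 1.
  rewrite ltr_distl subrr => /andP[y0 _]; by have [] := dF y y0.
have H2 h : `|h| < 1 -> F 1 + h * - GammaR R (a + 1) <= F (1 + h).
  rewrite ltr_norml => /andP[h1 _].
  have y0 : 0 < 1 + h by lra.
  have [Ls Is] := L1_scale y0 (L1_gfun a0).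
  (* For [x > 0] the integrand is [x ^ (a - 1) * expR (- ((1 + h) * x))]: the prefactor cancels the
     power of [1 + h] produced by rescaling. *)
  have E : F (1 + h) = Int (fun x => (1 + h) `^ (1 - a) * gfun a ((1 + h) * x)).
    rewrite (IntZ _ Ls) Is /F fctE /GRing.scale/= -GammaRE mulrA mulrC; congr (_ * _).
    rewrite -powR_inv1 ?(ltW y0)// -powRD ?(gt_eqF y0) ?implybT//; congr (_ `^ _); lra.
  have -> : F 1 + h * - GammaR R (a + 1) = Int (fun x => gfun a x + - h * gfun (a + 1) x).
    rewrite IntD ?IntZ//; [|exact: L1_gfun|exact: L1_gfun|by apply: L1Z; exact: L1_gfun].
    by rewrite /F fctE /GRing.scale/= powR1 mulr1 !GammaRE mulrN mulNr.
  rewrite E; apply: le_Int.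
  - by apply: L1D; [exact: L1_gfun|by apply: L1Z; exact: L1_gfun].
  - exact: L1Z.
  - move=> x; rewrite /gfun pmulr_rgt0//; case: ifPn => x0; last by rewrite !mulr0 addr0.
    rewrite powRDm1// powRr1 ?(ltW x0)// [((1 + h) * x) `^ _]powRM ?(ltW x0) ?(ltW y0)//.
    rewrite !mulrA -powRD ?(gt_eqF y0) ?implybT//.
    rewrite (_ : 1 - a + (a - 1) = 0); last lra.
    rewrite powRr0 mul1r mulrDl mul1r opprD expRD.
    have := expR_ge1Dx (- (h * x)).
    have : 0 <= x `^ (a - 1) * expR (- x) by rewrite mulr_ge0 ?powR_ge0 ?expR_ge0.
    by nra.
have := derive_minorant ltr01 H1 H2.
have [_] := dF _ ltr01; rewrite derive1E => ->.
by rewrite powR1 /GRing.scale/= mulr1 mulrN => /oppr_inj <-; rewrite mulrC.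
Qed.

End GammaTheory.

(** * Beta integrals and the digamma function *)

Section BetaTheory.
Context {R : realType}.
Local Notation mu := (@lebesgue_measure R).

Definition bfun (a b x : R) :=
  if (0 < x) && (x < 1) then x `^ (a - 1) * (1 - x) `^ (b - 1) else 0.

(** The Beta function is defined by its Gamma quotient, which makes it easy to differentiate;
    [L1_Int_bfun] identifies it with the Beta integral. *)
Definition BetaR (a b : R) := GammaR R a * GammaR R b / GammaR R (a + b).

Lemma measurable_bfun a b : measurable_fun setT (bfun a b).
Proof.
apply: measurable_fun_ifT => //.
  by apply: measurable_and; exact: measurable_fun_ltr.
apply: measurable_funM; first exact: measurable_powR.
apply: (measurableT_comp (measurable_powR _)).
exact: measurable_funB.
Qed.

Lemma bfun_ge0 a b x : 0 <= bfun a b x.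
Proof. by rewrite /bfun; case: ifP => // _; rewrite mulr_ge0// powR_ge0. Qed.

Lemma BetaR_gt0 a b : 0 < a -> 0 < b -> 0 < BetaR a b.
Proof.
by move=> a0 b0; rewrite divr_gt0 ?mulr_gt0 ?GammaR_gt0// addr_gt0.
Qed.

(* the substitution [s = v x] in the convolution of two Gamma integrands *)
Lemma gfun_conv a b s v : gfun a s * gfun b (v - s) =
  v^-1 * gfun (a + b) v * bfun a b (v^-1 * s).
Proof.
rewrite /gfun /bfun subr_gt0.
case: (ltP 0 s) => s0; last first.
  rewrite mul0r; case: ltP => v0; last by rewrite mulr0 mul0r.
  rewrite ifF ?mulr0// pmulr_rgt0 ?invr_gt0//.
  by apply/negbTE; rewrite negb_and -leNgt s0.
case: (ltP s v) => sv; last first.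
  rewrite mulr0; case: ltP => v0; last by rewrite mulr0 mul0r.
  rewrite ifF ?mulr0//; apply/negbTE; rewrite negb_and -!leNgt orbC.
  by rewrite mulrC ler_pdivlMr// mul1r sv.
have v0 : 0 < v by exact: lt_trans sv.
have vi0 : 0 < v^-1 by rewrite invr_gt0.
have vs0 : 0 < v - s by rewrite subr_gt0.
rewrite v0 ![v^-1 * s]mulrC divr_gt0// ltr_pdivrMr// mul1r sv/=.
rewrite (_ : 1 - s / v = v^-1 * (v - s)); last by field; rewrite gt_eqF.
rewrite powRM ?(ltW s0) ?(ltW vi0)// powRM ?(ltW vi0) ?(ltW vs0)//.
rewrite -powR_inv1 ?(ltW v0)// -!powRrM !mulN1r.
rewrite (_ : expR (- v) = expR (- s) * expR (- (v - s))); last first.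
  by rewrite -expRD; congr expR; lra.
have -> : v `^ (a + b - 1) = v `^ 1 * v `^ (a - 1) * v `^ (b - 1).
  by rewrite -!powRD ?(gt_eqF v0) ?implybT//; congr (_ `^ _); lra.
rewrite !powRN.
have p c : v `^ c != 0 by rewrite gt_eqF// powR_gt0.
by field; rewrite !p.
Qed.

Lemma gfun_conv_measurable a b :
  measurable_fun setT (fun z : R * R => gfun a z.1 * gfun b (z.2 - z.1)).
Proof.
apply: measurable_funM.
  by apply: measurableT_comp => //; exact: measurable_gfun.
apply: (measurableT_comp (measurable_gfun b)).
by apply: measurable_funB.
Qed.

(** Stated in the extended reals because the Beta integral is not yet known to be finite. *)
Lemma integral_gfun_conv a b v : 0 < a -> 0 < b ->
  (\int[mu]_s (gfun a s * gfun b (v - s))%:E =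
   (gfun (a + b) v)%:E * \int[mu]_x (bfun a b x)%:E)%E.
Proof.
move=> a0 b0.
under eq_integral do rewrite gfun_conv.
case: (ltP 0 v) => v0; last first.
  under eq_integral do rewrite {1}/gfun ltNge v0 mulr0 mul0r.
  by rewrite integral0 /gfun ltNge v0 mul0e.
have vi0 : 0 < v^-1 by rewrite invr_gt0.
under eq_integral do rewrite EFinM.
rewrite ge0_integralZl; last 4 first.
- exact: measurableT.
- apply/measurable_EFinP; apply: (measurableT_comp (measurable_bfun a b)).
  exact: measurable_funM.
- by move=> x _; rewrite lee_fin bfun_ge0.
- by rewrite lee_fin mulr_ge0 ?gfun_ge0// (ltW vi0).
have -> : (\int[mu]_x (bfun a b (v^-1 * x))%:E =
    \int[mu]_x (EFin \o bfun a b) (v^-1 * x + 0)%R)%E.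
  by apply: eq_integral => x _; rewrite /= addr0.
rewrite affine_integral//; last 2 first.
- by apply/measurable_EFinP; exact: measurable_bfun.
- by move=> x; rewrite lee_fin bfun_ge0.
rewrite invrK.
by rewrite muleA -EFinM mulrAC mulVf ?gt_eqF// mul1r.
Qed.

(** Integrate [gfun a s * gfun b (v - s)] over the plane in both orders: over [v] first this gives
    [GammaR a * GammaR b], over [s] first it gives [GammaR (a + b)] times the Beta integral. *)
Lemma L1_Int_bfun a b : 0 < a -> 0 < b -> L1 (bfun a b) /\ Int (bfun a b) = BetaR a b.
Proof.
move=> a0 b0; apply: ge0_integral_EFin; [exact: measurable_bfun|exact: bfun_ge0|].
have ab0 : 0 < a + b by rewrite addr_gt0.
have mH : measurable_fun setT (fun z : R * R => (gfun a z.1 * gfun b (z.2 - z.1))%:E).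
  by apply/measurable_EFinP; exact: gfun_conv_measurable.
have H0 (z : R * R) : (0 <= (gfun a z.1 * gfun b (z.2 - z.1))%:E)%E.
  by rewrite lee_fin mulr_ge0// gfun_ge0.
have := @fubini_tonelli _ _ _ _ R mu mu _ mH H0.
under eq_integral => s _.
  have [L I] := L1_affine (- s) ltr01 (L1_gfun b0).
  have E : (fun v : R => gfun b (1 * v - s)) = (fun v => gfun b (v - s)).
    by apply/funext => v; rewrite mul1r.
  rewrite E in L; rewrite E invr1 mul1r -GammaRE in I.
  have -> : (\int[mu]_y (gfun a (s, y).1 * gfun b ((s, y).2 - (s, y).1))%:E =
     (GammaR R b * gfun a s)%:E)%E.
    by rewrite (L1_EFin (L1Z (gfun a s) L)) IntZ// I mulrC.
  over.
rewrite (L1_EFin (L1Z (GammaR R b) (L1_gfun a0))) IntZ; last exact: L1_gfun.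
rewrite -GammaRE => H.
have : (\int[mu]_y \int[mu]_x (gfun a (x, y).1 * gfun b ((x, y).2 - (x, y).1))%:E =
   \int[mu]_v ((gfun (a + b) v)%:E * \int[mu]_x (bfun a b x)%:E))%E.
  by apply: eq_integral => v _; exact: integral_gfun_conv.
rewrite -H => {}H.
have B0 : (0 <= \int[mu]_x (bfun a b x)%:E)%E.
  by apply: integral_ge0 => x _; rewrite lee_fin bfun_ge0.
rewrite ge0_integralZr// in H; last 2 first.
- by apply/measurable_EFinP; exact: measurable_gfun.
- by move=> x _; rewrite lee_fin gfun_ge0.
rewrite L1_EFin in H; last exact: L1_gfun.
rewrite -GammaRE in H.
have G0 := GammaR_gt0 ab0.
(* Finiteness also comes from the Tonelli equation: an infinite Beta integral, multiplied by the
   positive [GammaR (a + b)], would not equal a real number. *)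
case: (\int[mu]_x (bfun a b x)%:E)%E H B0 => [r||]//=.
- by rewrite -EFinM => -[] H _; congr EFin; rewrite /BetaR [_ * GammaR R b]mulrC H mulrAC divff ?mul1r// gt_eqF.
- by rewrite gt0_muley ?lte_fin.
Qed.

Lemma L1_bfun a b : 0 < a -> 0 < b -> L1 (bfun a b).
Proof. by move=> a0 b0; have [] := L1_Int_bfun a0 b0. Qed.

Lemma Int_bfun a b : 0 < a -> 0 < b -> Int (bfun a b) = BetaR a b.
Proof. by move=> a0 b0; have [] := L1_Int_bfun a0 b0. Qed.

(** On []0, 1[] the negative power suffices, so the majorant of a Beta integrand times a logarithm
    is again a single Beta integrand. *)
Lemma normr_ln01_le (e x : R) : 0 < e -> 0 < x < 1 -> `|ln x| <= e^-1 * x `^ (- e).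
Proof.
move=> e0 /andP[x0 x1]; rewrite ler_pdivlMl//.
have h2 : - e * ln x < x `^ (- e) by rewrite -ln_powR; apply: ln_sublinear; exact: powR_gt0.
rewrite ltr0_norm; last by apply: ln_lt0; rewrite x0.
by rewrite mulrN -mulNr; exact: ltW.
Qed.

Lemma L1_bfun_ln a b : 0 < a -> 0 < b -> L1 (fun x => bfun a b x * ln x).
Proof.
move=> a0 b0; have e0 : 0 < a / 2 by rewrite divr_gt0.
have L : L1 (fun x => (a / 2)^-1 * bfun (a + - (a / 2)) b x).
  by apply: L1Z; apply: L1_bfun => //; lra.
apply: L1_dom L _.
  by apply: measurable_funM; [exact: measurable_bfun|exact: measurable_ln].
move=> x; rewrite normrM ger0_norm ?bfun_ge0// /bfun.
case: ifPn => x01; last by rewrite mul0r mulr0.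
have /andP[x0 _] := x01.
rewrite powRDm1// (mulrAC _ (x `^ (- _))) mulrCA.
by rewrite ler_wpM2l ?mulr_ge0 ?powR_ge0// normr_ln01_le.
Qed.

Lemma L1_bfun_ln1 a b : 0 < a -> 0 < b -> L1 (fun x => bfun a b x * ln (1 - x)).
Proof.
move=> a0 b0; have e0 : 0 < b / 2 by rewrite divr_gt0.
have L : L1 (fun x => (b / 2)^-1 * bfun a (b + - (b / 2)) x).
  by apply: L1Z; apply: L1_bfun => //; lra.
apply: L1_dom L _.
  apply: measurable_funM; first exact: measurable_bfun.
  by apply: (measurableT_comp (@measurable_ln R)); exact: measurable_funB.
move=> x; rewrite normrM ger0_norm ?bfun_ge0// /bfun.
case: ifPn => x01; last by rewrite mul0r mulr0.
have /andP[x0 x1] := x01; have x10 : 0 < 1 - x by rewrite subr_gt0.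
rewrite powRDm1// mulrA mulrCA [leRHS]mulrC mulrA -mulrA [leRHS]mulrC.
by rewrite ler_wpM2l ?mulr_ge0 ?powR_ge0// normr_ln01_le// x10/= gtrBl.
Qed.

End BetaTheory.

(** * Derivatives of Gamma and Beta, and expectations under the Gamma and Beta densities *)

Section DigammaTheory.
Context {R : realType}.
Local Notation mu := (@lebesgue_measure R).
Local Notation Gamma := (GammaR R).

Lemma is_derive_GammaR (x : R) : 0 < x -> is_derive x 1 Gamma (derive1 Gamma x).
Proof. by move=> x0; rewrite derive1E; apply/derivableP/derivable_GammaR. Qed.

Lemma digammaE (x : R) : 0 < x -> digamma R x = derive1 Gamma x / Gamma x.
Proof.
move=> x0; rewrite /digamma derive1E.
have G0 := GammaR_gt0 x0.
have H1 := is_derive_GammaR x0.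
have H2 := is_derive1_ln G0.
have [_] : is_derive x 1 (@ln R \o Gamma) ((Gamma x)^-1 * derive1 Gamma x).
  exact: is_derive1_comp.
by rewrite mulrC.
Qed.

Lemma is_derive_BetaR (a b : R) : 0 < a -> 0 < b ->
  is_derive b 1 (BetaR a) (BetaR a b * (digamma R b - digamma R (a + b))).
Proof.
move=> a0 b0.
have ab0 : 0 < a + b by rewrite addr_gt0.
have Gb := is_derive_GammaR b0.
have Gab : is_derive b 1 (fun y => Gamma (a + y)) (derive1 Gamma (a + b)).
  have H := is_derive_GammaR ab0.
  have -> : (fun y => Gamma (a + y)) = Gamma \o (fun y => a + y) by [].
  apply: is_derive_eq.
  by rewrite add0r !mulr1.
have nz : Gamma (a + b) != 0 by rewrite gt_eqF// GammaR_gt0.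
have nb : Gamma b != 0 by rewrite gt_eqF// GammaR_gt0.
have Gi : is_derive b 1 (fun y => (Gamma (a + y))^-1) (- (Gamma (a + b)) ^- 2 *: derive1 Gamma (a + b)).
  exact: is_deriveV.
have -> : BetaR a = (fun y => Gamma a) * Gamma * (fun y => (Gamma (a + y))^-1) by [].
apply: is_derive_eq.
rewrite !digammaE// /BetaR /GRing.scale/= !fctE.
move: nz nb; move: (Gamma a) (Gamma b) (Gamma (a + b)) (derive1 Gamma b) (derive1 Gamma (a + b)).
move=> u v w dv dw w0 v0.
by field; rewrite w0 v0.
Qed.

(* [y^h >= 1 + h ln y] makes the integral the slope of an affine minorant of [BetaR a]. *)
Lemma Int_bfun_ln1 (a b : R) : 0 < a -> 0 < b ->
  Int (fun x => bfun a b x * ln (1 - x)) =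
  BetaR a b * (digamma R b - digamma R (a + b)).
Proof.
move=> a0 b0.
have dB (y : R) : 0 < y -> derivable (BetaR a) y 1.
  by move=> y0; have [] := is_derive_BetaR a0 y0.
have H1 (y : R) : `|y - b| < b -> derivable (BetaR a) y 1.
  by rewrite ltr_distl subrr => /andP[y0 _]; exact: dB.
pose l := Int (fun x => bfun a b x * ln (1 - x)).
have H2 h : `|h| < b -> BetaR a b + h * l <= BetaR a (b + h).
  rewrite ltr_norml => /andP[bh _].
  have bh0 : 0 < b + h by lra.
  have Lb := L1_bfun a0 b0; have Ll := L1_bfun_ln1 a0 b0; have Lbh := L1_bfun a0 bh0.
  rewrite -!Int_bfun// /l -IntZ// -IntD//; last exact: L1Z.
  apply: le_Int => //; first by apply: L1D => //; exact: L1Z.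
  move=> x; rewrite /bfun; case: ifPn => [/andP[x0 x1]|_]; last by rewrite !mul0r mulr0 addr0.
  have x10 : 0 < 1 - x by rewrite subr_gt0.
  rewrite powRDm1// [leRHS]mulrA (mulrCA h) -[X in X + _]mulr1 -mulrDr.
  rewrite ler_wpM2l ?mulr_ge0 ?powR_ge0//.
  by rewrite /powR (gt_eqF x10) expR_ge1Dx.
rewrite -/l -(derive_minorant b0 H1 H2) derive1E.
by have [_] := is_derive_BetaR a0 b0.
Qed.

Lemma beta_densE (a b x : R) : 0 < a -> 0 < b -> beta_dens R a b x = (BetaR a b)^-1 * bfun a b x.
Proof.
move=> a0 b0; rewrite /beta_dens /bfun; case: ifP => _; last by rewrite mulr0.
have := GammaR_gt0 a0; have := GammaR_gt0 b0; have := GammaR_gt0 (addr_gt0 a0 b0).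
move=> /gt_eqF G1 /gt_eqF G2 /gt_eqF G3.
rewrite /BetaR; move: (Gamma a) (Gamma b) (Gamma (a + b)) G1 G2 G3 => u v w G1 G2 G3.
by field; rewrite G1 G2 G3.
Qed.

(** The rate acts as a rescaling, so integrals against the density reduce to those of [gfun] by
    [L1_scale]. *)
Lemma gamma_densE (a b x : R) : 0 < a -> 0 < b ->
  gamma_dens R a b x = (b / GammaR R a) * gfun a (b * x).
Proof.
move=> a0 b0; rewrite /gamma_dens /gfun pmulr_rgt0//; case: ifPn => x0; last by rewrite mulr0.
rewrite powRM ?(ltW b0) ?(ltW x0)//.
rewrite -{1}(subrK 1 a) [b `^ _]powRD ?(gt_eqF b0) ?implybT// powRr1 ?(ltW b0)//.
rewrite -!mulrA; ring.
Qed.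

Section gamma.
Variables (a b : R).
Hypotheses (a0 : 0 < a) (b0 : 0 < b).

Lemma L1_gamma_dens : L1 (gamma_dens R a b).
Proof.
have [L _] := L1_scale b0 (L1_gfun a0).
by apply: L1_ext (L1Z (b / Gamma a) L) => x; rewrite gamma_densE.
Qed.

Lemma Int_gamma_dens : Int (gamma_dens R a b) = 1.
Proof.
have [L I] := L1_scale b0 (L1_gfun a0).
rewrite (Int_ext (g := fun x => b / Gamma a * gfun a (b * x))); last first.
  by move=> x; rewrite gamma_densE.
rewrite (IntZ _ L) I -GammaRE; have /gt_eqF G := GammaR_gt0 a0.
by field; rewrite G gt_eqF.
Qed.

Lemma gamma_densM (x : R) : gamma_dens R a b x * x = (Gamma a)^-1 * gfun (a + 1) (b * x).
Proof.
rewrite gamma_densE// /gfun pmulr_rgt0//; case: ifPn => x0; last by rewrite !mulr0 mul0r.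
have bx0 : 0 < b * x by rewrite mulr_gt0.
by rewrite powRDm1// powRr1 ?(ltW bx0)//; ring.
Qed.

Lemma L1_gamma_dens_id : L1 (fun x => gamma_dens R a b x * x).
Proof.
have a10 : 0 < a + 1 by rewrite addr_gt0.
have [L _] := L1_scale b0 (L1_gfun a10).
by apply: L1_ext (L1Z (Gamma a)^-1 L) => x; rewrite gamma_densM.
Qed.

(** Multiplication by [x] raises the shape by one ([gamma_densM]), and the recurrence [GammaRS]
    gives the quotient of the two Gamma values. *)
Lemma Int_gamma_dens_id : Int (fun x => gamma_dens R a b x * x) = a / b.
Proof.
have a10 : 0 < a + 1 by rewrite addr_gt0.
have [L I] := L1_scale b0 (L1_gfun a10).
rewrite (Int_ext gamma_densM) (IntZ _ L) I -GammaRE (GammaRS a0).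
have /gt_eqF G := GammaR_gt0 a0.
by field; rewrite G gt_eqF.
Qed.

Lemma L1_gamma_dens_ln : L1 (fun x => gamma_dens R a b x * ln x).
Proof.
have [L _] := L1_scale b0 (L1_gfun_ln a0).
have [L' _] := L1_scale b0 (L1_gfun a0).
apply: L1_ext (L1D (L1Z (b / Gamma a) L) (L1Z (- (b / Gamma a) * ln b) L')) => x.
rewrite gamma_densE//; case: (ltP 0 x) => x0.
  by rewrite lnM ?posrE//; ring.
have g0 : gfun a (b * x) = 0 by rewrite /gfun pmulr_rgt0// ltNge x0.
by rewrite g0 !(mulr0, mul0r, addr0).
Qed.
End gamma.

Section beta.
Variables (a b : R).
Hypotheses (a0 : 0 < a) (b0 : 0 < b).

Let dE (f : R -> R) x : (BetaR a b)^-1 * (bfun a b x * f x) = beta_dens R a b x * f x.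
Proof. by rewrite beta_densE// mulrA. Qed.

Lemma L1_beta_dens : L1 (beta_dens R a b).
Proof.
by apply: L1_ext (L1Z (BetaR a b)^-1 (L1_bfun a0 b0)) => x; rewrite beta_densE.
Qed.

Lemma Int_beta_dens : Int (beta_dens R a b) = 1.
Proof.
rewrite (Int_ext (g := fun x => (BetaR a b)^-1 * bfun a b x)); last first.
  by move=> x; rewrite beta_densE.
rewrite IntZ; last exact: L1_bfun.
by rewrite Int_bfun// mulVf// gt_eqF// BetaR_gt0.
Qed.

Lemma L1_beta_dens_ln : L1 (fun x => beta_dens R a b x * ln x).
Proof. exact: L1_ext (dE _) (L1Z _ (L1_bfun_ln a0 b0)). Qed.

Lemma L1_beta_dens_ln1 : L1 (fun x => beta_dens R a b x * ln (1 - x)).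
Proof. exact: L1_ext (dE (fun x => ln (1 - x))) (L1Z _ (L1_bfun_ln1 a0 b0)). Qed.

Lemma Int_beta_dens_ln1 :
  Int (fun x => beta_dens R a b x * ln (1 - x)) = digamma R b - digamma R (a + b).
Proof.
rewrite -(Int_ext (dE (fun x => ln (1 - x)))) IntZ; last exact: L1_bfun_ln1.
by rewrite Int_bfun_ln1// mulrA mulVf ?mul1r// gt_eqF// BetaR_gt0.
Qed.
End beta.

(* One coordinate of a Dirichlet density with remaining mass [c] is integrated out. *)
Lemma Int_bfun_stick (a b c al be ga : R) : 0 < a -> 0 < b ->
  let F x := if (0 < x) && (x < c) then
      x `^ (a - 1) * (c - x) `^ (b - 1) * (al + be * ln x + ga * ln (c - x)) else 0 in
  L1 F /\
  Int F = if 0 < c then c `^ (a + b - 1) *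
     (BetaR a b * (al + (be + ga) * ln c) + be * Int (fun x => bfun a b x * ln x)
       + ga * Int (fun x => bfun a b x * ln (1 - x))) else 0.
Proof.
move=> a0 b0 F; case: ltP => c0; last first.
  have F0 : (fun=> 0) =1 F.
    move=> x; rewrite /F ifF//; apply/negbTE; rewrite negb_and -!leNgt.
    by case: (lerP x 0) => //= x0; apply: le_trans c0 _; exact: ltW.
  by rewrite -(Int_ext F0) Int0; split => //; exact: L1_ext F0 L10.
have ci0 : 0 < c^-1 by rewrite invr_gt0.
have Lb := L1_bfun a0 b0.
have L1b := L1_bfun_ln a0 b0.
have L2b := L1_bfun_ln1 a0 b0.
(* In the variable [y = x / c] one has [ln x = ln c + ln y] and [ln (c - x) = ln c + ln (1 - y)];
   both copies of [ln c] join the constant coefficient. *)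
pose H x := (al + (be + ga) * ln c) * bfun a b x
   + (be * (bfun a b x * ln x) + ga * (bfun a b x * ln (1 - x))).
have LH : L1 H by apply: L1D; [exact: L1Z|apply: L1D; exact: L1Z].
have IH : Int H = (al + (be + ga) * ln c) * BetaR a b +
    (be * Int (fun x => bfun a b x * ln x) + ga * Int (fun x => bfun a b x * ln (1 - x))).
  by rewrite /H !IntD ?IntZ ?Int_bfun//; do ?[exact: L1Z|apply: L1D].
have [LHc IHc] := L1_scale ci0 LH.
(* The exponent collects [a - 1] and [b - 1]; the substitution contributes one more factor [c],
   whence [a + b - 1] in the result. *)
have E x : c `^ (a + b - 1 - 1) * H (c^-1 * x) = F x.
  rewrite /F /H /bfun pmulr_rgt0//; case: (ltP 0 x) => x0 /=; last by rewrite !mul0r !mulr0 !addr0 mulr0.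
  rewrite [c^-1 * x]mulrC ltr_pdivrMr// mul1r.
  case: ltP => xc; last by rewrite !mul0r !mulr0 !addr0 mulr0.
  have cx0 : 0 < c - x by rewrite subr_gt0.
  rewrite (_ : 1 - x / c = c^-1 * (c - x)); last by field; rewrite gt_eqF.
  rewrite [x / c]mulrC !lnM ?posrE// lnV ?posrE//.
  rewrite powRM ?(ltW x0) ?(ltW ci0)// powRM ?(ltW ci0) ?(ltW cx0)//.
  rewrite -powR_inv1 ?(ltW c0)// -!powRrM !mulN1r.
  have -> : c `^ (a + b - 1 - 1) = c `^ (a - 1) * c `^ (b - 1).
    by rewrite -!powRD ?(gt_eqF c0) ?implybT//; congr (_ `^ _); lra.
  rewrite !powRN.
  have p d : c `^ d != 0 by rewrite gt_eqF// powR_gt0.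
  by field; rewrite !p.
split; first exact: L1_ext E (L1Z _ LHc).
rewrite -(Int_ext E) (IntZ _ LHc) IHc invrK IH mulrA.
rewrite [_ * c](_ : _ = c `^ (a + b - 1)); last first.
  by rewrite -[X in _ * X]powRr1 ?(ltW c0)// -powRD ?(gt_eqF c0) ?implybT// subrK.
by congr (_ * _); ring.
Qed.

End DigammaTheory.

(** * Iterated integrals *)

Section IteratedIntegral.
Context {R : realType}.
Implicit Types (l ks : seq key) (F G c : assign R -> R) (x : assign R).
Local Notation iint := (@iint R).
Local Notation upd := (@upd R).

(* [iint] has junk values on non-integrable slices; [iok] excludes them at every stage. *)
Fixpoint iok l F x : Prop :=
  match l with
  | [::] => True
  | k :: l' => (forall y, iok l' F (upd x k y)) /\ L1 (fun y => iint l' F (upd x k y))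
  end.

Definition dep ks F := forall x x', {in ks, x =1 x'} -> F x = F x'.

Lemma iint_cons k l F x : iint (k :: l) F x = Int (fun y => iint l F (upd x k y)).
Proof. by []. Qed.

Lemma iokD l F G x : iok l F x -> iok l G x ->
  iok l (fun x => F x + G x) x /\ iint l (fun x => F x + G x) x = iint l F x + iint l G x.
Proof.
elim: l x => [//|k l IH] x /= [oF LF] [oG LG].
have E y : iint l (fun x => F x + G x) (upd x k y) =
  iint l F (upd x k y) + iint l G (upd x k y) by apply: (IH _ _ _).2.
split.
  split=> [y|]; first by apply: (IH _ _ _).1.
  by apply: L1_ext (L1D LF LG) => y; rewrite E.
by rewrite [LHS](Int_ext E) IntD.
Qed.

(** The factor [c] may vary with coordinates outside [l]; this is what separates the blocks of a
    product density. *)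
Lemma iokZl l c F x : (forall x k y, k \in l -> c (upd x k y) = c x) -> iok l F x ->
  iok l (fun x => c x * F x) x /\ iint l (fun x => c x * F x) x = c x * iint l F x.
Proof.
elim: l x => [//|k l IH] x cl /= [oF LF].
have cl' x' k' y : k' \in l -> c (upd x' k' y) = c x'.
  by move=> kl; rewrite cl// inE kl orbT.
have E y : iint l (fun x => c x * F x) (upd x k y) = c x * iint l F (upd x k y).
  by rewrite (IH _ cl' (oF y)).2 cl// inE eqxx.
split.
  split=> [y|]; first exact: (IH _ cl' (oF y)).1.
  by apply: L1_ext (L1Z (c x) LF) => y; rewrite E.
by rewrite [LHS](Int_ext E) IntZ.
Qed.

Lemma iok0 l x : iok l (fun=> 0) x /\ iint l (fun=> 0) x = 0.
Proof.
elim: l x => [//|k l IH] x /=.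
have E y : 0 = iint l (fun=> 0) (upd x k y) by rewrite (IH _).2.
split; last by rewrite -[LHS](Int_ext E) Int0.
by split=> [y|]; [exact: (IH _).1|exact: L1_ext E L10].
Qed.

Lemma le_iint l F G x : iok l F x -> iok l G x -> (forall x, F x <= G x) ->
  iint l F x <= iint l G x.
Proof.
elim: l x => [|k l IH] x /=; first by move=> _ _; apply.
by move=> [oF LF] [oG LG] FG; apply: le_Int => // y; exact: IH.
Qed.

Lemma iint_cat l1 l2 F x : iint (l1 ++ l2) F x = iint l1 (iint l2 F) x.
Proof. by elim: l1 x => [//|k l1 IH] x /=; apply: Int_ext => y; rewrite -/iint IH. Qed.

Lemma iok_cat l1 l2 F x : iok l1 (iint l2 F) x -> (forall x', iok l2 F x') ->
  iok (l1 ++ l2) F x.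
Proof.
move=> + o2; elim: l1 x => [x _|k l1 IH x /= [o1 L]]; first exact: o2.
split=> [y|]; first exact: IH.
by apply: L1_ext L => y; rewrite iint_cat.
Qed.

Lemma iint_dep l ks F x x' : dep ks F ->
  (forall k, k \in ks -> k \notin l -> x k = x' k) -> iint l F x = iint l F x'.
Proof.
move=> dF; elim: l x x' => [|k l IH] x x' xx'.
  by apply: dF => k kks; exact: xx'.
rewrite !iint_cons; apply: Int_ext => y; apply: IH => k' k'ks k'l.
by rewrite /upd; case: eqVneq => // kk'; apply: xx' => //; rewrite inE negb_or kk'.
Qed.

Lemma iint_cst l F x x' : dep l F -> iint l F x = iint l F x'.
Proof. by move=> dF; apply: (iint_dep dF) => k ->. Qed.

Lemma dep_upd ks F x k y : dep ks F -> k \notin ks -> F (upd x k y) = F x.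
Proof.
move=> dF kks; apply: dF => k' k'ks; rewrite /upd.
by case: eqVneq => // kk'; rewrite kk' (negbTE kks) in k'ks.
Qed.

(** No exchange of integrals occurs: the blocks are nested consecutively, so the integral over the
    later blocks is a number that factors out of the head block. Each block integral is independent
    of the base assignment, which is why [x0] is arbitrary. *)
Lemma iint_prod (B : eqType) (keys : B -> seq key) (bs : seq B) (g : B -> assign R -> R) x x0 :
  uniq (flatten [seq keys b | b <- bs]) ->
  (forall b, b \in bs -> dep (keys b) (g b)) ->
  (forall b x, b \in bs -> iok (keys b) (g b) x) ->
  [/\ dep (flatten [seq keys b | b <- bs]) (fun x => \prod_(b <- bs) g b x),
      iok (flatten [seq keys b | b <- bs]) (fun x => \prod_(b <- bs) g b x) x &
      iint (flatten [seq keys b | b <- bs]) (fun x => \prod_(b <- bs) g b x) x =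
      \prod_(b <- bs) iint (keys b) (g b) x0].
Proof.
elim: bs x => [|b bs IH] x.
  by move=> _ _ _; split; rewrite /= ?big_nil//; move=> ? ? _; rewrite !big_nil.
rewrite [flatten _]/=; set L := flatten _ => ub dg og.
have [_ /hasPn disj uL] : [/\ uniq (keys b), ~~ has (mem (keys b)) L & uniq L].
  by move: ub; rewrite cat_uniq => /and3P[].
have dgb := dg b (mem_head _ _).
have ogb x' := og b x' (mem_head _ _).
have IH' x' : [/\ dep L (fun x => \prod_(b <- bs) g b x), iok L (fun x => \prod_(b <- bs) g b x) x' &
    iint L (fun x => \prod_(b <- bs) g b x) x' = \prod_(b <- bs) iint (keys b) (g b) x0].
  by apply: IH => // b' => [|x''] b'bs; [apply: dg|apply: og]; rewrite inE b'bs orbT.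
pose G := fun x : assign R => \prod_(b <- bs) g b x.
have E : (fun x => \prod_(b' <- b :: bs) g b' x) = (fun x => g b x * G x).
  by apply/funext => x'; rewrite big_cons.
have dG : dep L G by have [] := IH' x.
have inL x' : iok L (fun x => g b x * G x) x' /\
    iint L (fun x => g b x * G x) x' = iint L G x0 * g b x'.
  have [_ oG _] := IH' x'.
  have [|o ->] := @iokZl L (g b) G x' _ oG.
    by move=> x1 k y kL; apply: dep_upd dgb _; exact: disj.
  by split=> //; rewrite mulrC (iint_cst x' x0 dG).
have inL' : iint L (fun x => g b x * G x) = (fun x => iint L G x0 * g b x).
  by apply/funext => x'; exact: (inL x').2.
have [//|o1 i1] := @iokZl (keys b) (fun=> iint L G x0) (g b) x _ (ogb x).
rewrite E; split.
- move=> x1 x2 x12; congr (_ * _).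
    by apply: dgb => k kb; apply: x12; rewrite mem_cat kb.
  by apply: dG => k kb; apply: x12; rewrite mem_cat kb orbT.
- apply: iok_cat => [|x']; last exact: (inL x').1.
  by rewrite inL'.
- rewrite iint_cat inL' i1 big_cons (iint_cst x x0 dgb) mulrC; congr (_ * _).
  by have [_ _] := IH' x0.
Qed.

(* Gibbs' inequality, from [q (ln q' - ln q) <= q' - q] *)
Lemma iint_gibbs l (q q' : assign R -> R) x :
  (forall x, 0 <= q x) -> (forall x, 0 <= q' x) -> (forall x, 0 < q x -> 0 < q' x) ->
  iok l q x -> iok l q' x -> iint l q x = iint l q' x ->
  iok l (fun x => q x * ln (q x)) x -> iok l (fun x => q x * ln (q' x)) x ->
  iint l (fun x => q x * ln (q' x)) x <= iint l (fun x => q x * ln (q x)) x.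
Proof.
move=> q0 q'0 qq' oq oq' iqq' h h'.
have [a1 a2] := iokD h' oq.
have [b1 b2] := iokD h oq'.
(* Equal total masses are added on the two sides, which leaves the pointwise inequality
   [q * ln q' + q <= q * ln q + q']. *)
rewrite -(lerD2r (iint l q x)) -a2 iqq' -b2.
apply: le_iint => // y.
have := q0 y; rewrite le_eqVlt => /predU1P[<-|qy]; first by rewrite !mul0r !add0r.
have q'y := qq' _ qy.
have r0 : 0 < q' y / q y by rewrite divr_gt0.
have : ln (q' y / q y) <= q' y / q y - 1.
  have := @le_ln1Dx R (q' y / q y - 1).
  by rewrite (addrC 1) subrK; apply; lra.
rewrite ln_div ?posrE// -(ler_pM2l qy) mulrBr mulrBr mulr1 mulrCA divff ?gt_eqF// mulr1.
lra.
Qed.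

End IteratedIntegral.

(** * Optimality of Beta, Gamma and Dirichlet densities *)

Section Gibbs1D.
Context {R : realType}.

Lemma Int_gibbs (q q' : R -> R) :
  (forall x, 0 <= q x) -> (forall x, 0 <= q' x) -> (forall x, 0 < q x -> 0 < q' x) ->
  L1 q -> L1 q' -> Int q = Int q' ->
  L1 (fun x => q x * ln (q x)) -> L1 (fun x => q x * ln (q' x)) ->
  Int (fun x => q x * ln (q' x)) <= Int (fun x => q x * ln (q x)).
Proof.
move=> q0 q'0 qq' Lq Lq' I L L'.
(* A single coordinate, named by the empty key, makes [iint] a plain integral over the line. *)
exact: (@iint_gibbs R [:: [::]] (fun x => q (x [::])) (fun x => q' (x [::])) (fun=> 0)
  (fun x => q0 (x [::])) (fun x => q'0 (x [::])) (fun x => qq' (x [::]))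
  (conj (fun=> Logic.I) Lq) (conj (fun=> Logic.I) Lq') I
  (conj (fun=> Logic.I) L) (conj (fun=> Logic.I) L')).
Qed.

Definition Eln_beta (a b : R) := Int (fun x => beta_dens R a b x * ln x).
Definition Eln1_beta (a b : R) := Int (fun x => beta_dens R a b x * ln (1 - x)).
(** Negative differential entropy: it enters the objective with a minus sign. *)
Definition ent_beta (a b : R) := Int (fun x => beta_dens R a b x * ln (beta_dens R a b x)).
Definition Eln_gamma (a b : R) := Int (fun x => gamma_dens R a b x * ln x).
Definition ent_gamma (a b : R) := Int (fun x => gamma_dens R a b x * ln (gamma_dens R a b x)).

Lemma beta_dens_gt0 (a b x : R) : 0 < a -> 0 < b ->
  (0 < beta_dens R a b x) = (0 < x < 1).
Proof.
move=> a0 b0; rewrite beta_densE// /bfun; case: ifPn => [/andP[x0 x1]|_]; last by rewrite mulr0 ltxx.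
by rewrite mulr_gt0 ?invr_gt0 ?BetaR_gt0// mulr_gt0 ?powR_gt0// subr_gt0.
Qed.

Lemma beta_dens_ge0 (a b x : R) : 0 < a -> 0 < b -> 0 <= beta_dens R a b x.
Proof.
move=> a0 b0; rewrite beta_densE// mulr_ge0 ?bfun_ge0// invr_ge0 ltW//.
exact: BetaR_gt0.
Qed.

Lemma beta_dens_eq0 (a b x : R) : 0 < a -> 0 < b -> ~~ (0 < x < 1) -> beta_dens R a b x = 0.
Proof. by move=> _ _ /negbTE h; rewrite /beta_dens h. Qed.

Lemma ln_beta_dens (a b x : R) : 0 < a -> 0 < b -> 0 < x < 1 ->
  ln (beta_dens R a b x) = (a - 1) * ln x + (b - 1) * ln (1 - x) - ln (BetaR a b).
Proof.
move=> a0 b0 x01; rewrite beta_densE// /bfun x01; have /andP[x0 x1] := x01.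
have B0 := BetaR_gt0 a0 b0.
have x10 : 0 < 1 - x by rewrite subr_gt0.
have p1 := powR_gt0 (a - 1) x0; have p2 := powR_gt0 (b - 1) x10.
rewrite lnM ?posrE ?invr_gt0 ?(mulr_gt0 p1 p2)// lnM ?posrE// lnV ?posrE// !ln_powR; ring.
Qed.

Lemma beta_dens_ln_beta (a b a' b' x : R) : 0 < a -> 0 < b -> 0 < a' -> 0 < b' ->
  (a' - 1) * (beta_dens R a b x * ln x) + ((b' - 1) * (beta_dens R a b x * ln (1 - x))
    + - ln (BetaR a' b') * beta_dens R a b x) =
  beta_dens R a b x * ln (beta_dens R a' b' x).
Proof.
move=> a0 b0 a'0 b'0; case: (boolP (0 < x < 1)) => x01; last first.
  by rewrite (@beta_dens_eq0 a b)// !mul0r !mulr0 !addr0.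
by rewrite ln_beta_dens//; ring.
Qed.

Lemma L1_Int_beta_ln_beta (a b a' b' : R) : 0 < a -> 0 < b -> 0 < a' -> 0 < b' ->
  L1 (fun x => beta_dens R a b x * ln (beta_dens R a' b' x)) /\
  Int (fun x => beta_dens R a b x * ln (beta_dens R a' b' x)) =
    (a' - 1) * Eln_beta a b + (b' - 1) * Eln1_beta a b - ln (BetaR a' b').
Proof.
move=> a0 b0 a'0 b'0.
have E x := @beta_dens_ln_beta a b a' b' x a0 b0 a'0 b'0.
have L0 := L1_beta_dens a0 b0; have L2 := L1_beta_dens_ln a0 b0; have L3 := L1_beta_dens_ln1 a0 b0.
split; first by apply: L1_ext E _; do !apply: L1D; exact: L1Z.
rewrite -(Int_ext E) !IntD ?IntZ//; do ?[exact: L1Z]; last by apply: L1D; exact: L1Z.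
by rewrite Int_beta_dens// mulr1 addrA.
Qed.

(** Gibbs' inequality against Beta(a, b), whose normalizing constant [ln (BetaR a b)] occurs on both
    sides and cancels. What remains is an objective whose coefficients of [ln u] and [ln (1 - u)]
    are [a - 1] and [b - 1]. *)
Lemma beta_opt (s l a b : R) : 0 < s -> 0 < l -> 0 < a -> 0 < b ->
  (a - 1) * Eln_beta s l + (b - 1) * Eln1_beta s l - ent_beta s l <=
  (a - 1) * Eln_beta a b + (b - 1) * Eln1_beta a b - ent_beta a b.
Proof.
move=> s0 l0 a0 b0.
have [_ Ea] := L1_Int_beta_ln_beta a0 b0 a0 b0.
have [L Es] := L1_Int_beta_ln_beta s0 l0 a0 b0.
have [L' _] := L1_Int_beta_ln_beta s0 l0 s0 l0.
have : Int (fun x => beta_dens R s l x * ln (beta_dens R a b x)) <= ent_beta s l.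
  apply: (@Int_gibbs (beta_dens R s l) (beta_dens R a b)) L' L.
  - by move=> x; exact: beta_dens_ge0.
  - by move=> x; exact: beta_dens_ge0.
  - by move=> x; rewrite (beta_dens_gt0 x s0 l0) (beta_dens_gt0 x a0 b0).
  - exact: L1_beta_dens.
  - exact: L1_beta_dens.
  - exact: etrans (Int_beta_dens s0 l0) (esym (Int_beta_dens a0 b0)).
rewrite [X in X <= _]Es [ent_beta a b](Ea : _ = _).
move: (Eln_beta s l) (Eln1_beta s l) (ent_beta s l) (Eln_beta a b) (Eln1_beta a b) (ln _).
by move=> u v w u' v' k; clear; lra.
Qed.

Lemma gamma_dens_gt0 (a b x : R) : 0 < a -> 0 < b ->
  (0 < gamma_dens R a b x) = (0 < x).
Proof.
move=> a0 b0; rewrite /gamma_dens; case: ifPn => x0; last by rewrite ltxx.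
by rewrite divr_gt0 ?GammaR_gt0// !mulr_gt0 ?powR_gt0 ?expR_gt0.
Qed.

Lemma gamma_dens_ge0 (a b x : R) : 0 < a -> 0 < b -> 0 <= gamma_dens R a b x.
Proof.
move=> a0 b0; case: (ltP 0 x) => x0; first by rewrite ltW// gamma_dens_gt0.
by rewrite /gamma_dens ltNge x0.
Qed.

Lemma ln_gamma_dens (a b x : R) : 0 < a -> 0 < b -> 0 < x ->
  ln (gamma_dens R a b x) = (a - 1) * ln x - b * x + (a * ln b - ln (GammaR R a)).
Proof.
move=> a0 b0 x0; rewrite /gamma_dens x0; have G0 := GammaR_gt0 a0.
have p1 := powR_gt0 a b0; have p2 := powR_gt0 (a - 1) x0; have p3 := expR_gt0 (- (b * x)).
have p12 := mulr_gt0 p1 p2.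
by rewrite ln_div ?posrE ?(mulr_gt0 p12 p3)// lnM ?posrE// lnM ?posrE// !ln_powR expRK; ring.
Qed.

Lemma L1_Int_gamma_ln_gamma (a b a' b' : R) : 0 < a -> 0 < b -> 0 < a' -> 0 < b' ->
  L1 (fun x => gamma_dens R a b x * ln (gamma_dens R a' b' x)) /\
  Int (fun x => gamma_dens R a b x * ln (gamma_dens R a' b' x)) =
    (a' - 1) * Eln_gamma a b - b' * (a / b) + (a' * ln b' - ln (GammaR R a')).
Proof.
move=> a0 b0 a'0 b'0.
have E x : (a' - 1) * (gamma_dens R a b x * ln x) + (- b' * (gamma_dens R a b x * x) +
    (a' * ln b' - ln (GammaR R a')) * gamma_dens R a b x) =
    gamma_dens R a b x * ln (gamma_dens R a' b' x).
  case: (ltP 0 x) => x0; first by rewrite (@ln_gamma_dens a')//; ring.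
  by rewrite {1 2 3 4}/gamma_dens ltNge x0 /= !mul0r !mulr0 !addr0.
have L0 := L1_gamma_dens a0 b0; have L2 := L1_gamma_dens_ln a0 b0; have L3 := L1_gamma_dens_id a0 b0.
split; first by apply: L1_ext E _; do !apply: L1D; exact: L1Z.
rewrite -(Int_ext E) !IntD ?IntZ//; do ?[exact: L1Z]; last by apply: L1D; exact: L1Z.
by rewrite Int_gamma_dens// mulr1 Int_gamma_dens_id// addrA mulNr.
Qed.

Lemma gamma_opt (s l a b : R) : 0 < s -> 0 < l -> 0 < a -> 0 < b ->
  (a - 1) * Eln_gamma s l - b * (s / l) - ent_gamma s l <=
  (a - 1) * Eln_gamma a b - b * (a / b) - ent_gamma a b.
Proof.
move=> s0 l0 a0 b0.
have [_ Ea] := L1_Int_gamma_ln_gamma a0 b0 a0 b0.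
have [L Es] := L1_Int_gamma_ln_gamma s0 l0 a0 b0.
have [L' _] := L1_Int_gamma_ln_gamma s0 l0 s0 l0.
have : Int (fun x => gamma_dens R s l x * ln (gamma_dens R a b x)) <= ent_gamma s l.
  apply: (@Int_gibbs (gamma_dens R s l) (gamma_dens R a b)) L' L.
  - by move=> x; exact: gamma_dens_ge0.
  - by move=> x; exact: gamma_dens_ge0.
  - by move=> x; rewrite (gamma_dens_gt0 x s0 l0) (gamma_dens_gt0 x a0 b0).
  - exact: L1_gamma_dens.
  - exact: L1_gamma_dens.
  - exact: etrans (Int_gamma_dens s0 l0) (esym (Int_gamma_dens a0 b0)).
rewrite [X in X <= _]Es [ent_gamma a b](Ea : _ = _).
move: (Eln_gamma s l) (s / l) (ent_gamma s l) (Eln_gamma a b) (a / b) (a * ln b - _).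
by move=> u v w u' v' k; clear; lra.
Qed.

Lemma Eln1_beta_digamma (a b : R) : 0 < a -> 0 < b ->
  Eln1_beta a b = digamma R b - digamma R (a + b).
Proof. exact: Int_beta_dens_ln1. Qed.

(** The logarithm of [1 - x] is nonpositive on the support. This sign keeps the updated Gamma rates
    positive. *)
Lemma Eln1_beta_le0 (a b : R) : 0 < a -> 0 < b -> Eln1_beta a b <= 0.
Proof.
move=> a0 b0; rewrite -(@Int0 R); apply: le_Int.
- exact: L1_beta_dens_ln1.
- exact: L10.
- move=> x; case: (boolP (0 < x < 1)) => x01; last by rewrite beta_dens_eq0// mul0r.
  rewrite mulr_ge0_le0 ?beta_dens_ge0// ln_le0// gerBl ltW//.
  by have /andP[] := x01.
Qed.

(** By the recurrence, [BetaR 1 1] equals [GammaR 1], and its integrand is the indicator of the unit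
    interval. *)
Lemma GammaR1 : GammaR R 1 = 1.
Proof.
have G0 := GammaR_gt0 (@ltr01 R).
have := @Int_bfun R 1 1 ltr01 ltr01.
rewrite /BetaR GammaRS// mul1r mulfK ?gt_eqF// => <-.
have -> : Int (bfun 1 1) = Int (\1_(`]0, 1[%classic : set R)).
  apply: Int_ext => x; rewrite /bfun subrr !powRr0 mulr1 indicE mem_setE in_itv/=.
  by case: ifP.
rewrite /Int /Rintegral integral_indic// setIT.
have E : @lebesgue_measure R `]0, 1[%classic = (1 - 0)%:E.
  by rewrite lebesgue_measure_itv/= lte_fin ltr01 EFinB.
rewrite [X in fine X](_ : _ = (1 - 0)%:E); last exact: E.
by rewrite subr0.
Qed.

(** Here [BetaR 1 b = 1 / b]. With [b] the concentration, the summand [ln b] occurs once per stick,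
    which is the origin of the number of nodes in the updated Gamma shape. *)
Lemma ln_beta_dens1 (b x : R) : 0 < b -> 0 < x < 1 ->
  ln (beta_dens R 1 b x) = ln b + (b - 1) * ln (1 - x).
Proof.
move=> b0 x01; rewrite ln_beta_dens// /BetaR GammaR1 (addrC 1 b) GammaRS//.
have /gt_eqF G := GammaR_gt0 b0.
rewrite (_ : 1 * GammaR R b / (b * GammaR R b) = b^-1); last by field; rewrite G gt_eqF.
rewrite lnV ?posrE//; ring.
Qed.

End Gibbs1D.

(** * Dirichlet integrals as iterated Beta integrals *)

Section Dirichlet.
Context {R : realType}.
Variables (M : model R) (n i : nat) (m' : nat).
Hypothesis nAE : nA M n = m'.+1.
Local Notation ks := (keyPi n i).
Local Notation p x := (piX R M x n i).
Local Notation iint := (@iint R).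
Local Notation upd := (@upd R).
Implicit Types (phi bet : nat -> R) (al ga : R) (x : assign R).

Lemma forall_ord_recr (P : nat -> bool) k :
  [forall a : 'I_k.+1, P a] = [forall a : 'I_k, P a] && P k.
Proof.
apply/forallP/andP => [H|[/forallP H Pk] a].
  by split; [apply/forallP => a; exact: (H (widen_ord (leqnSn k) a))|exact: (H ord_max)].
by case: (unliftP ord_max a) => [b ->|->//]; rewrite lift_max.
Qed.

Definition pi_keys : seq key := [seq ks a | a <- iota 0 (nA M n).-1].

(** The unnormalized density times an affine combination of the logarithms: one computation covers
    the total mass ([bet = 0]) and each expected logarithm ([bet] an indicator). *)
Definition dirF phi bet al x : R :=
  if [forall a : 'I_(nA M n), 0 < p x a] then
    (\prod_(a < nA M n) p x a `^ (phi a - 1)) * (al + \sum_(a < nA M n) bet a * ln (p x a))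
  else 0.

(** The mass left for the coordinates from [j] on. *)
Definition stick j x : R := 1 - \sum_(b < j) x (ks b).

Definition dir_mass phi j : R := \sum_(j <= a < m'.+1) phi a.

(* what remains of [dirF] once the coordinates [j, ..., m' - 1] are integrated out *)
Definition dirG phi bet j al ga x : R :=
  if [forall a : 'I_j, 0 < x (ks a)] && (0 < stick j x) then
    (\prod_(a < j) x (ks a) `^ (phi a - 1)) * stick j x `^ (dir_mass phi j - 1) *
    (al + \sum_(a < j) bet a * ln (x (ks a)) + ga * ln (stick j x))
  else 0.

(** The multivariate Beta function of the parameters from index [j] on. *)
Definition dir_cst phi j : R :=
  (\prod_(j <= a < m'.+1) GammaR R (phi a)) / GammaR R (dir_mass phi j).

Lemma piX_last x : p x m' = stick m' x.
Proof. by rewrite /piX nAE eqxx. Qed.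

Lemma piX_lt x a : (a < m')%N -> p x a = x (ks a).
Proof. by move=> am; rewrite /piX nAE /= ltn_eqF. Qed.

Lemma upd_keyPi x j y a : upd x (ks j) y (ks a) = if a == j then y else x (ks a).
Proof. by rewrite /upd /keyPi !eqseq_cons !eqxx /= andbT. Qed.

(** The last probability is not a free coordinate but the remaining stick, so its logarithm carries
    the coefficient [bet m']. *)
Lemma dirFE phi bet al x : dirF phi bet al x = dirG phi bet m' al (bet m') x.
Proof.
rewrite /dirF /dirG nAE (forall_ord_recr (fun a => 0 < p x a)) piX_last.
have -> : [forall a : 'I_m', 0 < p x a] = [forall a : 'I_m', 0 < x (ks a)].
  by apply: eq_forallb => a; rewrite piX_lt.
case: ifP => // _; rewrite !big_ord_recr /= piX_last /dir_mass big_nat1 addrA.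
congr (_ * _ * (_ + _ + _)).
  by apply: eq_bigr => a _; rewrite piX_lt.
by apply: eq_bigr => a _; rewrite piX_lt.
Qed.

Lemma stick_upd x j y : stick j.+1 (upd x (ks j) y) = stick j x - y.
Proof.
rewrite /stick big_ord_recr /= upd_keyPi eqxx opprD addrA; congr (_ - _ - _).
by apply: eq_bigr => a _; rewrite upd_keyPi ltn_eqF.
Qed.

Lemma dir_mass_gt0 phi j : (forall a, (a <= m')%N -> 0 < phi a) -> (j <= m')%N ->
  0 < dir_mass phi j.
Proof.
move=> phi0 jm; rewrite /dir_mass big_ltn ?ltnS// ltr_pwDl ?phi0//.
by rewrite big_nat_cond sumr_ge0// => a /andP[/andP[_ am] _]; apply/ltW/phi0.
Qed.

(** This is [Int_bfun_stick] on the remaining stick. The logarithms of coordinate [j] and of the new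
    stick each leave one [ln (stick j x)], so their coefficients add, and their Beta expectations go
    into [al']. The coefficients stay existential: explicit values are recorded only when no
    logarithm is present. *)
Lemma dirG_step phi bet j al ga : (forall a, (a <= m')%N -> 0 < phi a) -> (j < m')%N ->
  exists al' ga', [/\ (forall a, bet a = 0) -> ga = 0 -> al' = al /\ ga' = 0 &
  forall x, L1 (fun y => dirG phi bet j.+1 al ga (upd x (ks j) y)) /\
    Int (fun y => dirG phi bet j.+1 al ga (upd x (ks j) y)) =
    BetaR (phi j) (dir_mass phi j.+1) * dirG phi bet j al' ga' x].
Proof.
move=> phi0 jm.
have pj : 0 < phi j by apply: phi0; exact: ltnW.
have Pj := dir_mass_gt0 phi0 jm.
set b := dir_mass phi j.+1 in Pj *.
have B0 := BetaR_gt0 pj Pj.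
pose l1 := Int (fun y => bfun (phi j) b y * ln y).
pose l2 := Int (fun y => bfun (phi j) b y * ln (1 - y)).
exists (al + (bet j * l1 + ga * l2) / BetaR (phi j) b), (bet j + ga).
split=> [bet0 ->|x]; first by rewrite !bet0 !mul0r !addr0 mul0r addr0.
pose pr := \prod_(a < j) x (ks a) `^ (phi a - 1).
pose su := \sum_(a < j) bet a * ln (x (ks a)).
pose c := stick j x.
have [] := @Int_bfun_stick R (phi j) b c (al + su) (bet j) ga pj Pj.
set F := fun y : R => if _ then _ else _ => LF IF.
have E y : (if [forall a : 'I_j, 0 < x (ks a)] then pr else 0) * F y =
    dirG phi bet j.+1 al ga (upd x (ks j) y).
  rewrite /dirG (forall_ord_recr (fun a => 0 < upd x (ks j) y (ks a))) stick_upd.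
  rewrite upd_keyPi eqxx /F -/c subr_gt0 -andbA.
  have -> : [forall a : 'I_j, 0 < upd x (ks j) y (ks a)] = [forall a : 'I_j, 0 < x (ks a)].
    by apply: eq_forallb => a; rewrite upd_keyPi ltn_eqF.
  case: ifP => _ /=; last by rewrite mul0r.
  case: ifP => _; last by rewrite mulr0.
  rewrite !big_ord_recr /= !upd_keyPi eqxx -/b.
  have -> : \prod_(a < j) upd x (ks j) y (ks a) `^ (phi a - 1) = pr.
    by apply: eq_bigr => a _; rewrite upd_keyPi ltn_eqF.
  have -> : \sum_(a < j) bet a * ln (upd x (ks j) y (ks a)) = su.
    by apply: eq_bigr => a _; rewrite upd_keyPi ltn_eqF.
  by rewrite !addrA !mulrA.
split; first exact: L1_ext E (L1Z _ LF).
rewrite -(Int_ext E) (IntZ _ LF) IF /dirG -/c -/pr -/su.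
have -> : dir_mass phi j = phi j + b by rewrite /dir_mass big_ltn// ltnS ltnW.
case: ifP => _ /=; last by rewrite mul0r mulr0.
case: ifP => _; last by rewrite !mulr0.
rewrite -/l1 -/l2.
have BZ : BetaR (phi j) b != 0 by rewrite gt_eqF.
move: (c `^ _) (ln c) (BetaR _ _) BZ l1 l2 => u v w w0 l1 l2.
by clear -w0; field.
Qed.

Lemma dir_cst_step phi j : (forall a, (a <= m')%N -> 0 < phi a) -> (j < m')%N ->
  dir_cst phi j.+1 * BetaR (phi j) (dir_mass phi j.+1) = dir_cst phi j.
Proof.
move=> phi0 jm; have Pj := dir_mass_gt0 phi0 jm.
have /gt_eqF G1 := GammaR_gt0 Pj.
have Pj' := dir_mass_gt0 phi0 (ltnW jm).
rewrite /dir_cst /BetaR.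
have E : dir_mass phi j = phi j + dir_mass phi j.+1.
  by rewrite /dir_mass big_ltn// ltnS ltnW.
have /gt_eqF G2 := GammaR_gt0 Pj'.
rewrite [X in _ = X / _]big_ltn ?ltnS 1?ltnW// -E.
move: (\prod_(_ <= _ < _) _) (GammaR _ (phi j)) (GammaR _ _) (GammaR _ _) G1 G2 => u v w z.
by move=> w0 z0; clear -w0 z0; field; rewrite w0 z0.
Qed.

Lemma dirF_iint phi bet al d j : (forall a, (a <= m')%N -> 0 < phi a) -> (j + d = m')%N ->
  exists al' ga', [/\ (forall a, bet a = 0) -> al' = al /\ ga' = 0 &
  forall x, iok [seq ks a | a <- iota j d] (dirF phi bet al) x /\
    iint [seq ks a | a <- iota j d] (dirF phi bet al) x =
    dir_cst phi j * dirG phi bet j al' ga' x].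
Proof.
move=> phi0; elim: d j => [|d IH] j jd.
  rewrite addn0 in jd; subst j; exists al, (bet m'); split=> [b0|x]; first by rewrite b0.
  split=> //=; rewrite dirFE /dir_cst /dir_mass !big_nat1 divff ?mul1r//.
  by rewrite gt_eqF// GammaR_gt0// phi0.
rewrite addnS -addSn in jd.
have jm : (j < m')%N by rewrite -jd leq_addr.
have [al1 [ga1 [h1 H1]]] := IH _ jd.
have [al2 [ga2 [h2 H2]]] := dirG_step bet al1 ga1 phi0 jm.
exists al2, ga2; split=> [b0|x].
  by have [e1 e2] := h1 b0; have [-> ->] := h2 b0 e2.
have E y : dir_cst phi j.+1 * dirG phi bet j.+1 al1 ga1 (upd x (ks j) y) =
    iint [seq ks a | a <- iota j.+1 d] (dirF phi bet al) (upd x (ks j) y).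
  by rewrite (H1 _).2.
have [L I] := H2 x.
rewrite [iota _ _]/= [map _ _]/=; split.
  split=> [y|]; first by have [] := H1 (upd x (ks j) y).
  exact: L1_ext E (L1Z _ L).
by rewrite iint_cons -(Int_ext E) (IntZ _ L) I mulrA (dir_cst_step phi0 jm).
Qed.

Lemma dirF_total phi bet al : (forall a, (a <= m')%N -> 0 < phi a) ->
  exists2 v, (forall a, bet a = 0) -> v = dir_cst phi 0 * al &
  forall x, iok pi_keys (dirF phi bet al) x /\ iint pi_keys (dirF phi bet al) x = v.
Proof.
move=> phi0; rewrite /pi_keys nAE.
have [al' [ga' [h H]]] := dirF_iint bet al phi0 (add0n m').
exists (dir_cst phi 0 * al') => [b0|x]; first by have [->] := h b0.
have [? ->] := H x; split => //; congr (_ * _).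
(* At [j = 0] the whole stick remains; its power is 1 and its logarithm 0, so [ga'] and the
   assignment disappear from the value. *)
have st : stick 0 x = 1 by rewrite /stick big_ord0 subr0.
rewrite /dirG st ltr01 andbT ifT; last by apply/forallP => -[].
by rewrite !big_ord0 powR1 !mul1r addr0 ln1 mulr0 addr0.
Qed.

Definition ddens phi x := dir_dens R (nA M n) phi (p x).

Lemma dir_cst0 phi : dir_cst phi 0 =
  (\prod_(a < nA M n) GammaR R (phi a)) / GammaR R (\sum_(a < nA M n) phi a).
Proof. by rewrite nAE /dir_cst /dir_mass !big_mkord. Qed.

Lemma dir_cst_gt0 phi : (forall a, (a <= m')%N -> 0 < phi a) -> 0 < dir_cst phi 0.
Proof.
move=> phi0; rewrite divr_gt0//; last exact/GammaR_gt0/dir_mass_gt0.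
by rewrite big_mkord prodr_gt0// => a _; apply/GammaR_gt0/phi0; rewrite -ltnS.
Qed.

Lemma ddens_dirF phi bet al x : (forall a, (a <= m')%N -> 0 < phi a) ->
  (dir_cst phi 0)^-1 * dirF phi bet al x =
  ddens phi x * (al + \sum_(a < nA M n) bet a * ln (p x a)).
Proof.
move=> phi0; rewrite /ddens /dir_dens /dirF; case: ifP => _; last by rewrite mulr0 mul0r.
by rewrite dir_cst0 invf_div mulrA.
Qed.

Lemma ddens_total phi bet al : (forall a, (a <= m')%N -> 0 < phi a) ->
  exists2 v, (forall a, bet a = 0) -> v = al &
  forall x, iok pi_keys (fun x => ddens phi x * (al + \sum_(a < nA M n) bet a * ln (p x a))) x /\
  iint pi_keys (fun x => ddens phi x * (al + \sum_(a < nA M n) bet a * ln (p x a))) x = v.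
Proof.
move=> phi0; have [v h H] := dirF_total bet al phi0.
have C0 := dir_cst_gt0 phi0.
exists ((dir_cst phi 0)^-1 * v) => [/h ->|x]; first by rewrite mulrA mulVf ?mul1r// gt_eqF.
have [o <-] := H x.
have := @iokZl R pi_keys (fun=> (dir_cst phi 0)^-1) (dirF phi bet al) x (fun _ _ _ _ => erefl) o.
suff -> : (fun x => (dir_cst phi 0)^-1 * dirF phi bet al x) =
  (fun x => ddens phi x * (al + \sum_(a < nA M n) bet a * ln (p x a))) by [].
by apply/funext => x'; exact: ddens_dirF.
Qed.

End Dirichlet.

Section HasI.
Context {R : realType}.
Implicit Types (l : seq key) (F G : assign R -> R) (x : assign R).

(** Bundling the value with integrability at every stage gives linearity rules free of side
    conditions. *)
Definition HasI l F x (v : R) := iok l F x /\ iint R l F x = v.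

Lemma HasI_D l F G x u v : HasI l F x u -> HasI l G x v ->
  HasI l (fun x => F x + G x) x (u + v).
Proof. by move=> [oF <-] [oG <-]; exact: iokD. Qed.

Lemma HasI_Z l F x u c : HasI l F x u -> HasI l (fun x => c * F x) x (c * u).
Proof. by move=> [oF <-]; exact: (@iokZl R l (fun=> c)). Qed.

Lemma HasI_0 l x : HasI l (fun=> 0) x 0.
Proof. exact: iok0. Qed.

Lemma HasI_sum l x (I : Type) (r : seq I) (P : pred I) (F : I -> assign R -> R) (u : I -> R) :
  (forall j, P j -> HasI l (F j) x (u j)) ->
  HasI l (fun x => \sum_(j <- r | P j) F j x) x (\sum_(j <- r | P j) u j).
Proof.
move=> H; elim: r => [|j r IH].
  rewrite big_nil (_ : (fun _ => _) = fun=> 0); first exact: HasI_0.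
  by apply/funext => y; rewrite big_nil.
rewrite big_cons; case: ifPn => Pj.
  rewrite (_ : (fun _ => _) = fun y => F j y + \sum_(j <- r | P j) F j y).
    by apply: HasI_D => //; exact: H.
  by apply/funext => y; rewrite big_cons Pj.
rewrite (_ : (fun _ => _) = fun y => \sum_(j <- r | P j) F j y)//.
by apply/funext => y; rewrite big_cons (negbTE Pj).
Qed.

Lemma HasI_ext l F G x v : F =1 G -> HasI l F x v -> HasI l G x v.
Proof. by move=> /funext ->. Qed.

End HasI.

Section DirichletOpt.
Context {R : realType}.
Variables (M : model R) (n i : nat).
Hypothesis nA0 : (0 < nA M n)%N.
Local Notation p x := (piX R M x n i).
Local Notation keys := (pi_keys M n i).
Local Notation dens := (ddens M n i).
Implicit Types (phi : nat -> R) (x : assign R).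

Definition pos_on phi := forall a, (a < nA M n)%N -> 0 < phi a.

Definition Eln_dir phi a := iint R keys (fun x => dens phi x * ln (p x a)) (fun=> 0).
Definition ent_dir phi := iint R keys (fun x => dens phi x * ln (dens phi x)) (fun=> 0).

Let nAE : nA M n = (nA M n).-1.+1.
Proof. by rewrite prednK. Qed.

Let pos_le phi : pos_on phi -> forall a, (a <= (nA M n).-1)%N -> 0 < phi a.
Proof. by move=> phi0 a; rewrite -ltnS -nAE; exact: phi0. Qed.

Lemma HasI_ddens phi x : pos_on phi -> HasI keys (dens phi) x 1.
Proof.
move=> /pos_le phi0; have [v /(_ (fun=> erefl)) -> H] := ddens_total i nAE (fun=> 0) 1 phi0.
apply: HasI_ext (H x) => y; rewrite big1 ?addr0 ?mulr1// => a _.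
by rewrite mul0r.
Qed.

Lemma HasI_ddens_ln phi x a : pos_on phi -> (a < nA M n)%N ->
  HasI keys (fun x => dens phi x * ln (p x a)) x (Eln_dir phi a).
Proof.
move=> /pos_le phi0 an.
(* Indicator coefficients select the logarithm of the single coordinate [a]. *)
have [v _ H] := ddens_total i nAE (fun b => (b == a)%:R) 0 phi0.
have E y : dens phi y * (0 + \sum_(b < nA M n) (b == a :> nat)%:R * ln (p y b)) =
    dens phi y * ln (p y a).
  rewrite add0r (bigD1 (Ordinal an))//= eqxx mul1r big1 ?addr0// => b.
  by rewrite -val_eqE /= => /negbTE ->; rewrite mul0r.
have Hx y : HasI keys (fun x => dens phi x * ln (p x a)) y v := HasI_ext E (H y).
by split; [case: (Hx x)|rewrite /Eln_dir (Hx _).2 (Hx _).2].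
Qed.

Lemma ddens_gt0 phi x : pos_on phi -> (0 < dens phi x) = [forall a : 'I_(nA M n), 0 < p x a].
Proof.
move=> phi0; rewrite /ddens /dir_dens; case: ifP => [/forallP h|]; last by rewrite ltxx.
rewrite mulr_gt0//; last by rewrite prodr_gt0// => a _; exact/powR_gt0/h.
rewrite -invf_div invr_gt0 -(dir_cst0 nAE).
exact: dir_cst_gt0 (pos_le phi0).
Qed.

Lemma ddens_ge0 phi x : pos_on phi -> 0 <= dens phi x.
Proof.
move=> phi0; case: (boolP [forall a : 'I_(nA M n), 0 < p x a]) => h.
  by rewrite ltW// ddens_gt0.
by rewrite /ddens /dir_dens (negbTE h).
Qed.

Lemma ln_prod (I : Type) (r : seq I) (P : pred I) (F : I -> R) :
  (forall j, P j -> 0 < F j) ->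
  ln (\prod_(j <- r | P j) F j) = \sum_(j <- r | P j) ln (F j).
Proof.
move=> F0; elim: r => [|j r IH]; first by rewrite !big_nil ln1.
rewrite !big_cons; case: ifPn => // Pj.
by rewrite lnM ?posrE ?IH// ?prodr_gt0//; exact: F0.
Qed.

Lemma ln_ddens phi x : pos_on phi -> 0 < dens phi x ->
  ln (dens phi x) = - ln (dir_cst (nA M n).-1 phi 0) + \sum_(a < nA M n) (phi a - 1) * ln (p x a).
Proof.
move=> phi0; rewrite ddens_gt0// => h; have C0 := dir_cst_gt0 (pos_le phi0).
rewrite /ddens /dir_dens h; move/forallP in h.
rewrite -invf_div -(dir_cst0 nAE) lnM ?posrE ?invr_gt0//; last first.
  by rewrite prodr_gt0// => a _; exact/powR_gt0/h.
rewrite lnV ?posrE// ln_prod => [|a _]; last exact/powR_gt0/h.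
by congr (_ + _); apply: eq_bigr => a _; rewrite ln_powR.
Qed.

Lemma HasI_ddens_ln_ddens phi phi' x : pos_on phi -> pos_on phi' ->
  HasI keys (fun x => dens phi x * ln (dens phi' x)) x
   (- ln (dir_cst (nA M n).-1 phi' 0) + \sum_(a < nA M n) (phi' a - 1) * Eln_dir phi a).
Proof.
move=> phi0 phi'0.
have := HasI_D (HasI_Z (- ln (dir_cst (nA M n).-1 phi' 0)) (HasI_ddens x phi0))
  (@HasI_sum _ keys x _ (index_enum 'I_(nA M n)) predT _ _
  (fun a _ => HasI_Z (phi' a - 1) (HasI_ddens_ln x phi0 (ltn_ord a)))).
rewrite mulr1; apply: HasI_ext => y.
have := ddens_ge0 y phi0; rewrite le_eqVlt => /predU1P[<-|d0].
  by rewrite mul0r mulr0 add0r big1// => a _; rewrite mul0r mulr0.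
rewrite ln_ddens//; last by move: d0; rewrite !ddens_gt0.
rewrite mulrDr mulrC mulr_sumr; congr (_ + _).
by apply: eq_bigr => a _; rewrite mulrCA.
Qed.

Lemma dir_opt phi psi : pos_on phi -> pos_on psi ->
  \sum_(a < nA M n) (psi a - 1) * Eln_dir phi a - ent_dir phi <=
  \sum_(a < nA M n) (psi a - 1) * Eln_dir psi a - ent_dir psi.
Proof.
move=> phi0 psi0.
have [o1 e1] := HasI_ddens_ln_ddens (fun=> 0) phi0 psi0.
have [o2 e2] := HasI_ddens_ln_ddens (fun=> 0) psi0 psi0.
have [o3 _] := HasI_ddens_ln_ddens (fun=> 0) phi0 phi0.
have [o4 e4] := HasI_ddens (fun=> 0) phi0.
have [o5 e5] := HasI_ddens (fun=> 0) psi0.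
have supp x : 0 < dens phi x -> 0 < dens psi x by rewrite !ddens_gt0.
have := @iint_gibbs R keys (dens phi) (dens psi) (fun=> 0) (fun x => ddens_ge0 x phi0)
  (fun x => ddens_ge0 x psi0) supp o4 o5 (etrans e4 (esym e5)) o3 o1.
rewrite e1 -/(ent_dir phi) [ent_dir psi](e2 : _ = _).
move: (\sum_(a < nA M n) (psi a - 1) * Eln_dir phi a) (\sum_(a < nA M n) (psi a - 1) * Eln_dir psi a)
  (ent_dir phi) (ln _) => u v w z {e1 e2 e4 e5}; lra.
Qed.

End DirichletOpt.

(** * Factorization of the variational density *)

Section Blocks.
Context {R : realType}.
Variable M : model R.
Implicit Types (b k : key) (x : assign R).

(* [pi_{n,i}] is one block: its coordinates are dependent *)
Definition keyPis (n i : nat) : key := [:: 4; n; i]%N.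

Definition blocks : seq key :=
  [seq keyU n i | n <- iota 0 (NA M), i <- iota 0 (nZ M n)] ++
  flatten [seq flatten [seq flatten [seq
     [seq keyV n a o i j | i <- iota 0 (nZ M n), j <- iota 0 (nZ M n)]
       | o <- iota 0 (nO M n)] | a <- iota 0 (nA M n)] | n <- iota 0 (NA M)] ++
  [seq keyRho n | n <- iota 0 (NA M)] ++
  flatten [seq flatten [seq
     [seq keyAl n a o i | o <- iota 0 (nO M n), i <- iota 0 (nZ M n)]
       | a <- iota 0 (nA M n)] | n <- iota 0 (NA M)] ++
  [seq keyPis n i | n <- iota 0 (NA M), i <- iota 0 (nZ M n)].

Definition bkeys b : seq key :=
  if b is [:: 4; n; i]%N then pi_keys M n i else [:: b].

Variant block_spec : key -> Prop :=
| BlockU n i of (n < NA M)%N & (i < nZ M n)%N : block_spec (keyU n i)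
| BlockV n a o i j of (n < NA M)%N & (a < nA M n)%N & (o < nO M n)%N &
    (i < nZ M n)%N & (j < nZ M n)%N : block_spec (keyV n a o i j)
| BlockRho n of (n < NA M)%N : block_spec (keyRho n)
| BlockAl n a o i of (n < NA M)%N & (a < nA M n)%N & (o < nO M n)%N & (i < nZ M n)%N :
    block_spec (keyAl n a o i)
| BlockPi n i of (n < NA M)%N & (i < nZ M n)%N : block_spec (keyPis n i).

Let iotaP (m a : nat) : a \in iota 0 m -> (a < m)%N. Proof. by rewrite mem_iota. Qed.
Let iotaI (m a : nat) : (a < m)%N -> a \in iota 0 m. Proof. by rewrite mem_iota. Qed.

Lemma blocksP b : b \in blocks <-> block_spec b.
Proof.
rewrite /blocks !mem_cat; split.
  case/orP; first by case/allpairsPdep => n [i [/iotaP ? /iotaP ? ->]]; exact: BlockU.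
  case/orP.
    case/flatten_mapP => n /iotaP nn /flatten_mapP[a /iotaP aa /flatten_mapP[o /iotaP oo]].
    by case/allpairsPdep => i [j [/iotaP ? /iotaP ? ->]]; exact: BlockV.
  case/orP; first by case/mapP => n /iotaP nn ->; exact: BlockRho.
  case/orP.
    case/flatten_mapP => n /iotaP nn /flatten_mapP[a /iotaP aa].
    by case/allpairsPdep => o [i [/iotaP ? /iotaP ? ->]]; exact: BlockAl.
  by case/allpairsPdep => n [i [/iotaP ? /iotaP ? ->]]; exact: BlockPi.
case=> [n i /iotaI nn /iotaI ii|n a o i j /iotaI nn /iotaI aa /iotaI oo /iotaI ii /iotaI jj
  |n /iotaI nn|n a o i /iotaI nn /iotaI aa /iotaI oo /iotaI ii|n i /iotaI nn /iotaI ii].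
- by apply/orP; left; apply/allpairsPdep; exists n, i.
- apply/orP; right; apply/orP; left; apply/flatten_mapP; exists n => //.
  apply/flatten_mapP; exists a => //; apply/flatten_mapP; exists o => //.
  by apply/allpairsPdep; exists i, j.
- by do 2 (apply/orP; right); apply/orP; left; apply/mapP; exists n.
- do 3 (apply/orP; right); apply/orP; left; apply/flatten_mapP; exists n => //.
  by apply/flatten_mapP; exists a => //; apply/allpairsPdep; exists o, i.
- by do 4 (apply/orP; right); apply/allpairsPdep; exists n, i.
Qed.

(** An equality of lists, order included: the iterated integral over [vars] is literally one over
    consecutive blocks. *)
Lemma vars_blocks : vars R M = flatten [seq bkeys b | b <- blocks].
Proof.
have single (s : seq key) : (forall k, k \in s -> bkeys k = [:: k]) ->
    flatten [seq bkeys k | k <- s] = s.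
  elim: s => [//|k s IH] H /=; rewrite H ?mem_head// IH// => k' k's.
  by apply: H; rewrite inE k's orbT.
rewrite /vars /blocks !map_cat !flatten_cat; congr (_ ++ (_ ++ (_ ++ (_ ++ _)))).
- by rewrite single// => k /allpairsPdep[n [i [_ _ ->]]].
- rewrite single// => k /flatten_mapP[n _ /flatten_mapP[a _ /flatten_mapP[o _]]].
  by case/allpairsPdep => i [j [_ _ ->]].
- by rewrite single// => k /mapP[n _ ->].
- rewrite single// => k /flatten_mapP[n _ /flatten_mapP[a _]].
  by case/allpairsPdep => o [i [_ _ ->]].
- elim: (iota 0 (NA M)) => [//|n s IH] /=.
  by rewrite IH map_cat flatten_cat -map_comp.
Qed.

(** Entry [r] of a key recovers the index [a], so lists with different indices are disjoint. *)
Lemma uniq_flatten_nth (s : seq nat) (f : nat -> seq key) (r : nat) : uniq s ->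
  (forall a, a \in s -> uniq (f a)) -> (forall a z, z \in f a -> nth 0%N z r = a) ->
  uniq (flatten [seq f a | a <- s]).
Proof.
elim: s => [//|a s IH] /= /andP[as_ us] uf nf.
rewrite cat_uniq uf ?mem_head// IH// ?andbT/=; last first.
  by move=> c cs; apply: uf; rewrite inE cs orbT.
apply/hasPn => z /flatten_mapP[c cs zc]; apply/negP => za.
by move: as_; rewrite -(nf _ _ za) (nf _ _ zc) cs.
Qed.

Lemma uniq_map_nth (s : seq nat) (f : nat -> key) (r : nat) : uniq s ->
  (forall a, nth 0%N (f a) r = a) -> uniq [seq f a | a <- s].
Proof. by move=> us nf; rewrite map_inj_uniq// => a c e; rewrite -(nf a) e nf. Qed.

Lemma uniq_cat_nth (s1 s2 : seq key) : uniq s1 -> uniq s2 ->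
  (forall z1 z2, z1 \in s1 -> z2 \in s2 -> nth 0%N z1 0 != nth 0%N z2 0) -> uniq (s1 ++ s2).
Proof.
move=> u1 u2 H; rewrite cat_uniq u1 u2 andbT; apply/hasPn => z z2; apply/negP => z1.
by have := H _ _ z1 z2; rewrite eqxx.
Qed.

(** [L] stands for the action probabilities, where [vars] lists coordinates and [blocks] has one key
    per simplex. The leading tag separates the five families. *)
Lemma uniq_with (L : seq key) : uniq L -> (forall z, z \in L -> nth 0%N z 0 = 4%N) ->
  uniq ([seq keyU n i | n <- iota 0 (NA M), i <- iota 0 (nZ M n)] ++
  flatten [seq flatten [seq flatten [seq
     [seq keyV n a o i j | i <- iota 0 (nZ M n), j <- iota 0 (nZ M n)]
       | o <- iota 0 (nO M n)] | a <- iota 0 (nA M n)] | n <- iota 0 (NA M)] ++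
  [seq keyRho n | n <- iota 0 (NA M)] ++
  flatten [seq flatten [seq
     [seq keyAl n a o i | o <- iota 0 (nO M n), i <- iota 0 (nZ M n)]
       | a <- iota 0 (nA M n)] | n <- iota 0 (NA M)] ++ L).
Proof.
move=> uL hL.
have hA z : z \in flatten [seq flatten [seq
     [seq keyAl n a o i | o <- iota 0 (nO M n), i <- iota 0 (nZ M n)]
       | a <- iota 0 (nA M n)] | n <- iota 0 (NA M)] -> nth 0%N z 0 = 3%N.
  by case/flatten_mapP => n _ /flatten_mapP[a _ /allpairsPdep[o [i [_ _ ->]]]].
have hR z : z \in [seq keyRho n | n <- iota 0 (NA M)] -> nth 0%N z 0 = 2%N.
  by case/mapP => n _ ->.
have hV z : z \in flatten [seq flatten [seq flatten [seq
     [seq keyV n a o i j | i <- iota 0 (nZ M n), j <- iota 0 (nZ M n)]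
       | o <- iota 0 (nO M n)] | a <- iota 0 (nA M n)] | n <- iota 0 (NA M)] ->
     nth 0%N z 0 = 1%N.
  by case/flatten_mapP => n _ /flatten_mapP[a _ /flatten_mapP[o _ /allpairsPdep[i [j [_ _ ->]]]]].
have hU z : z \in [seq keyU n i | n <- iota 0 (NA M), i <- iota 0 (nZ M n)] -> nth 0%N z 0 = 0%N.
  by case/allpairsPdep => n [i [_ _ ->]].
apply: uniq_cat_nth; last 1 first.
- move=> z1 z2 /hU ->; rewrite !mem_cat.
  by case/orP => [/hV -> //|/orP[/hR -> //|/orP[/hA -> //|/hL -> //]]].
- apply: (@uniq_flatten_nth _ _ 1); first exact: iota_uniq.
    by move=> n _; apply: (@uniq_map_nth _ _ 2) => //; exact: iota_uniq.
  by move=> n z /mapP[i _ ->].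
apply: uniq_cat_nth; last 1 first.
- move=> z1 z2 /hV ->; rewrite !mem_cat.
  by case/orP => [/hR -> //|/orP[/hA -> //|/hL -> //]].
- apply: (@uniq_flatten_nth _ _ 1); first exact: iota_uniq; last first.
    by move=> n z /flatten_mapP[a _ /flatten_mapP[o _ /allpairsPdep[i [j [_ _ ->]]]]].
  move=> n _; apply: (@uniq_flatten_nth _ _ 2); first exact: iota_uniq; last first.
    by move=> a z /flatten_mapP[o _ /allpairsPdep[i [j [_ _ ->]]]].
  move=> a _; apply: (@uniq_flatten_nth _ _ 3); first exact: iota_uniq; last first.
    by move=> o z /allpairsPdep[i [j [_ _ ->]]].
  move=> o _; apply: (@uniq_flatten_nth _ _ 4); first exact: iota_uniq; last first.
    by move=> i z /mapP[j _ ->].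
  by move=> i _; apply: (@uniq_map_nth _ _ 5) => //; exact: iota_uniq.
apply: uniq_cat_nth; last 1 first.
- move=> z1 z2 /hR ->; rewrite !mem_cat.
  by case/orP => [/hA -> //|/hL -> //].
- by apply: (@uniq_map_nth _ _ 1) => //; exact: iota_uniq.
apply: uniq_cat_nth => //; last first.
  by move=> z1 z2 /hA -> /hL ->.
apply: (@uniq_flatten_nth _ _ 1); first exact: iota_uniq; last first.
  by move=> n z /flatten_mapP[a _ /allpairsPdep[o [i [_ _ ->]]]].
move=> n _; apply: (@uniq_flatten_nth _ _ 2); first exact: iota_uniq; last first.
  by move=> a z /allpairsPdep[o [i [_ _ ->]]].
move=> a _; apply: (@uniq_flatten_nth _ _ 3); first exact: iota_uniq; last first.
  by move=> o z /mapP[i _ ->].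
by move=> o _; apply: (@uniq_map_nth _ _ 4) => //; exact: iota_uniq.
Qed.

Lemma uniq_blocks : uniq blocks.
Proof.
apply: uniq_with; last by move=> z /allpairsPdep[n [i [_ _ ->]]].
apply: (@uniq_flatten_nth _ _ 1); first exact: iota_uniq.
  by move=> n _; apply: (@uniq_map_nth _ _ 2) => //; exact: iota_uniq.
by move=> n z /mapP[i _ ->].
Qed.

Lemma uniq_vars : uniq (vars R M).
Proof.
apply: uniq_with; last first.
  by move=> z /flatten_mapP[n _ /allpairsPdep[i [a [_ _ ->]]]].
apply: (@uniq_flatten_nth _ _ 1); first exact: iota_uniq; last first.
  by move=> n z /allpairsPdep[i [a [_ _ ->]]].
move=> n _; apply: (@uniq_flatten_nth _ _ 2); first exact: iota_uniq; last first.
  by move=> i z /mapP[a _ ->].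
by move=> i _; apply: (@uniq_map_nth _ _ 3) => //; exact: iota_uniq.
Qed.

End Blocks.

(** * Expectations under the variational density *)

Section Expectation.
Context {R : realType}.
Variables (M : model R) (P : vparams R).
Hypotheses (wM : wf_model M) (pP : vpos M P).
Implicit Types (b k : key) (x : assign R) (F G : assign R -> R).
Local Notation bkeys := (bkeys M).
Local Notation blocks := (blocks M).

Definition bdens b x : R :=
  match b with
  | [:: 0; n; i]%N => beta_dens R (vdelta R P n i) (vmu R P n i) (x b)
  | [:: 1; n; a; o; i; j]%N =>
      beta_dens R (vsigma R P n a o i j) (vlambda R P n a o i j) (x b)
  | [:: 2; n]%N => gamma_dens R (vg R P n) (vh R P n) (x b)
  | [:: 3; n; a; o; i]%N => gamma_dens R (va R P n a o i) (vb R P n a o i) (x b)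
  | [:: 4; n; i]%N => ddens M n i (vphi R P n i) x
  | _ => 1
  end.

Lemma big_allpairs_iota (m : nat) (l : nat -> nat) (f : nat -> nat -> key) (g : key -> R) :
  \prod_(b <- [seq f n i | n <- iota 0 m, i <- iota 0 (l n)]) g b =
  \prod_(n < m) \prod_(i < l n) g (f n i).
Proof.
rewrite big_flatten big_map -[m]subn0 -/(index_iota 0 m) big_mkord subn0.
apply: eq_bigr => n _; rewrite big_map -[l n]subn0 -/(index_iota 0 (l n)) big_mkord subn0//.
Qed.

Lemma big_flatten_iota (m : nat) (f : nat -> seq key) (g : key -> R) :
  \prod_(b <- flatten [seq f n | n <- iota 0 m]) g b = \prod_(n < m) \prod_(b <- f n) g b.
Proof. by rewrite big_flatten big_map -[m]subn0 -/(index_iota 0 m) big_mkord subn0. Qed.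

Lemma qdensE x : qdens R M P x = \prod_(b <- blocks) bdens b x.
Proof.
rewrite /qdens /blocks !big_cat /= big_allpairs_iota big_flatten_iota !mulrA.
congr (_ * _ * _ * _ * _).
- apply: eq_bigr => n _; rewrite big_flatten_iota; apply: eq_bigr => a _.
  by rewrite big_flatten_iota; apply: eq_bigr => o _; rewrite big_allpairs_iota.
- by rewrite big_map -[NA M]subn0 -/(index_iota 0 (NA M)) big_mkord subn0.
- rewrite big_flatten_iota; apply: eq_bigr => n _; rewrite big_flatten_iota.
  by apply: eq_bigr => a _; rewrite big_allpairs_iota.
- by rewrite big_allpairs_iota.
Qed.

(* [F] is integrable for [q] at every stage and [v] is its expectation *)
Definition HasE F v := HasI (vars R M) (fun x => qdens R M P x * F x) (fun=> 0) v.

Lemma HasE_Eq F v : HasE F v -> Eq R M P F = v.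
Proof. by case. Qed.

(** Where the density vanishes the integrand is zero whatever [F] is. Identities such as
    [ln (F * G) = ln F + ln G], valid only for positive factors, may thus be used on the support
    alone. *)
Lemma HasE_supp F G v : (forall x, qdens R M P x != 0 -> F x = G x) -> HasE F v -> HasE G v.
Proof.
move=> FG; apply: HasI_ext => x.
by have [->|/FG ->//] := eqVneq (qdens R M P x) 0; rewrite !mul0r.
Qed.

Lemma HasE_D F G u v : HasE F u -> HasE G v -> HasE (fun x => F x + G x) (u + v).
Proof.
move=> HF HG; apply: HasI_ext (HasI_D HF HG) => x.
by rewrite mulrDr.
Qed.

Lemma HasE_Z F u c : HasE F u -> HasE (fun x => c * F x) (c * u).
Proof. by move=> HF; apply: HasI_ext (HasI_Z c HF) => x; rewrite mulrCA. Qed.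

Lemma HasE_sum (I : Type) (r : seq I) (Q : pred I) (F : I -> assign R -> R) (u : I -> R) :
  (forall j, Q j -> HasE (F j) (u j)) ->
  HasE (fun x => \sum_(j <- r | Q j) F j x) (\sum_(j <- r | Q j) u j).
Proof.
move=> H; apply: HasI_ext (HasI_sum r H) => x.
by rewrite mulr_sumr.
Qed.

Lemma nA_gt0 n : (n < NA M)%N -> (0 < nA M n)%N.
Proof. by case: wM => _ h _ _ _ /h[]. Qed.

Lemma pos_on_phi n i : (n < NA M)%N -> (i < nZ M n)%N -> pos_on M n (vphi R P n i).
Proof. by move=> nn ii a aa; have [_ _ h _ _] := pP nn; exact: h. Qed.

Lemma HasI_single k (h : R -> R) x : L1 h -> HasI [:: k] (fun x => h (x k)) x (Int h).
Proof.
move=> Lh; have E y : h y = iint R [::] (fun x => h (x k)) (upd R x k y).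
  by rewrite /= /upd eqxx.
by split; [split=> //; exact: L1_ext E Lh|rewrite iint_cons -(Int_ext E)].
Qed.

Lemma HasI_bdens b x : b \in blocks -> HasI (bkeys b) (bdens b) x 1.
Proof.
move=> /blocksP[n i nn ii|n a o i j nn aa oo ii jj|n nn|n a o i nn aa oo ii|n i nn ii];
  have [[g0 h0] hU hP hA hV] := pP nn.
- have [d0 m0] := hU i ii; rewrite -(Int_beta_dens d0 m0).
  exact/HasI_single/L1_beta_dens.
- have [d0 m0] := hV a o i j aa oo ii jj; rewrite -(Int_beta_dens d0 m0).
  exact/HasI_single/L1_beta_dens.
- by rewrite -(Int_gamma_dens g0 h0); exact/HasI_single/L1_gamma_dens.
- have [d0 m0] := hA a o i aa oo ii; rewrite -(Int_gamma_dens d0 m0).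
  exact/HasI_single/L1_gamma_dens.
- by apply: HasI_ddens; [exact: nA_gt0|exact: pos_on_phi].
Qed.

Lemma dep_piX n i a : (a < nA M n)%N -> dep (pi_keys M n i) (fun x => piX R M x n i a).
Proof.
move=> an x x' xx'; rewrite /piX.
have E c : (c < (nA M n).-1)%N -> x (keyPi n i c) = x' (keyPi n i c).
  by move=> cn; apply/xx'/mapP; exists c => //; rewrite mem_iota.
case: eqVneq => an'; first by congr (_ - _); apply: eq_bigr => c _; exact: E.
apply: E; rewrite ltn_neqAle an' /= -ltnS prednK//; exact: leq_ltn_trans an.
Qed.

Lemma dep_ddens n i phi : dep (pi_keys M n i) (ddens M n i phi).
Proof.
move=> x x' xx'; rewrite /ddens /dir_dens.
have E (a : 'I_(nA M n)) : piX R M x n i a = piX R M x' n i a by exact: dep_piX xx'.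
under eq_forallb do rewrite E.
by congr (if _ then _ * _ else _); apply: eq_bigr => a _; rewrite E.
Qed.

Lemma dep_bdens b : b \in blocks -> dep (bkeys b) (bdens b).
Proof.
by move=> /blocksP[n i nn ii|n a o i j nn aa oo ii jj|n nn|n a o i nn aa oo ii|n i nn ii];
  [| | | |exact: dep_ddens] => x x' xx' /=; rewrite xx'// mem_head.
Qed.

(** The independence of the blocks under the mean-field density. *)
Lemma HasE_prod (w : key -> assign R -> R) (v : key -> R) :
  (forall b, b \in blocks -> dep (bkeys b) (w b)) ->
  (forall b x, b \in blocks -> HasI (bkeys b) (fun x => bdens b x * w b x) x (v b)) ->
  HasE (fun x => \prod_(b <- blocks) w b x) (\prod_(b <- blocks) v b).
Proof.
move=> dw Hw; rewrite /HasE.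
have uv : uniq (flatten [seq bkeys b | b <- blocks]) by rewrite -vars_blocks; exact: uniq_vars.
have [] := @iint_prod R _ bkeys blocks (fun b x => bdens b x * w b x) (fun=> 0) (fun=> 0) uv.
- move=> b bb x x' xx'; congr (_ * _); [exact: dep_bdens xx'|exact: dw xx'].
- by move=> b x bb; have [] := Hw b x bb.
rewrite -vars_blocks => _ o1 e1.
apply: (@HasI_ext _ _ (fun x => \prod_(b <- blocks) (bdens b x * w b x))).
  by move=> x; rewrite big_split /= -qdensE.
split => //; rewrite e1; apply: eq_big_seq => b bb.
by have [] := Hw b (fun=> 0) bb.
Qed.

Lemma big_prod_at (f : key -> R) b0 : b0 \in blocks -> (forall b, b != b0 -> f b = 1) ->
  \prod_(b <- blocks) f b = f b0.
Proof.
move=> bb h; rewrite (bigD1_seq b0) ?uniq_blocks//= big1_seq ?mulr1// => b /andP[bb0 _].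
exact: h.
Qed.

Lemma HasE_cst c : HasE (fun=> c) c.
Proof.
have := @HasE_prod (fun _ _ => 1) (fun=> 1).
rewrite big1// => H.
have {}H : HasE (fun=> 1) 1.
  apply: H => // b x bb.
  by apply: HasI_ext (HasI_bdens x bb) => y; rewrite mulr1.
by have := HasE_Z c H; rewrite mulr1.
Qed.

Lemma HasE_block b0 f v : b0 \in blocks -> dep (bkeys b0) f ->
  (forall x, HasI (bkeys b0) (fun x => bdens b0 x * f x) x v) -> HasE f v.
Proof.
move=> bb df Hf.
have := @HasE_prod (fun b => if b == b0 then f else fun=> 1) (fun b => if b == b0 then v else 1).
rewrite (@big_prod_at _ b0)//; last by move=> b /negbTE ->.
rewrite eqxx => H; apply: HasI_ext (H _ _) => [x|b bb'|b x bb'].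
- congr (_ * _); rewrite (@big_prod_at _ b0)//; first by rewrite eqxx.
  by move=> b /negbTE ->.
- by case: eqVneq => [->|].
- case: eqVneq => [->|_]; first exact: Hf.
  by apply: HasI_ext (HasI_bdens x bb') => y; rewrite mulr1.
Qed.

(** Meant for the products of a concentration with [ln (1 - u)] or [ln (1 - V)], through which the
    stick-breaking priors couple two factors. *)
Lemma HasE_block2 b1 b2 f1 f2 v1 v2 : b1 \in blocks -> b2 \in blocks -> b1 != b2 ->
  dep (bkeys b1) f1 -> dep (bkeys b2) f2 ->
  (forall x, HasI (bkeys b1) (fun x => bdens b1 x * f1 x) x v1) ->
  (forall x, HasI (bkeys b2) (fun x => bdens b2 x * f2 x) x v2) ->
  HasE (fun x => f1 x * f2 x) (v1 * v2).
Proof.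
move=> bb1 bb2 b12 df1 df2 H1 H2.
have two (u1 u2 : R) : \prod_(b <- blocks) (if b == b1 then u1 else if b == b2 then u2 else 1) = u1 * u2.
  rewrite (bigD1_seq b1) ?uniq_blocks//= eqxx; congr (_ * _).
  rewrite big_mkcond (@big_prod_at _ b2)//; first by rewrite (eq_sym b2) (negbTE b12) eqxx.
  by move=> b /negbTE ->; case: ifP => // /negbTE ->.
have := @HasE_prod (fun b => if b == b1 then f1 else if b == b2 then f2 else fun=> 1)
  (fun b => if b == b1 then v1 else if b == b2 then v2 else 1).
rewrite two => H; apply: HasI_ext (H _ _) => [x|b bb|b x bb].
- congr (_ * _); rewrite -(two (f1 x)); apply: eq_bigr => b _; by case: ifP => // _; case: ifP.
- by case: eqVneq => [->//|_]; case: eqVneq => [->|].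
- case: eqVneq => [->//|_]; case: eqVneq => [->//|_].
  by apply: HasI_ext (HasI_bdens x bb) => y; rewrite mulr1.
Qed.

Section Atoms.
Variable n : nat.
Hypothesis nn : (n < NA M)%N.

Let blkU i (ii : (i < nZ M n)%N) : keyU n i \in blocks.
Proof. exact/blocksP/BlockU. Qed.

Let dep1 k (h : R -> R) : dep [:: k] (fun x : assign R => h (x k)).
Proof. by move=> x x' xx'; rewrite xx'// mem_head. Qed.

Lemma HasE_U i (f : R -> R) : (i < nZ M n)%N ->
  L1 (fun y => beta_dens R (vdelta R P n i) (vmu R P n i) y * f y) ->
  HasE (fun x => f (uX R x n i))
    (Int (fun y => beta_dens R (vdelta R P n i) (vmu R P n i) y * f y)).
Proof.
move=> ii L; apply: (@HasE_block (keyU n i)) => //; first exact: blkU.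
  exact: dep1.
by move=> x; exact: HasI_single L.
Qed.

Lemma HasE_V a o i j (f : R -> R) : (a < nA M n)%N -> (o < nO M n)%N ->
  (i < nZ M n)%N -> (j < nZ M n)%N ->
  L1 (fun y => beta_dens R (vsigma R P n a o i j) (vlambda R P n a o i j) y * f y) ->
  HasE (fun x => f (VX R x n a o i j))
    (Int (fun y => beta_dens R (vsigma R P n a o i j) (vlambda R P n a o i j) y * f y)).
Proof.
move=> aa oo ii jj L; apply: (@HasE_block (keyV n a o i j)) => //.
- exact/blocksP/BlockV.
- exact: dep1.
- by move=> x; exact: HasI_single L.
Qed.

Lemma HasE_rho (f : R -> R) :
  L1 (fun y => gamma_dens R (vg R P n) (vh R P n) y * f y) ->
  HasE (fun x => f (rhoX R x n)) (Int (fun y => gamma_dens R (vg R P n) (vh R P n) y * f y)).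
Proof.
move=> L; apply: (@HasE_block (keyRho n)) => //.
- exact/blocksP/BlockRho.
- exact: dep1.
- by move=> x; exact: HasI_single L.
Qed.

Lemma HasE_alpha a o i (f : R -> R) : (a < nA M n)%N -> (o < nO M n)%N -> (i < nZ M n)%N ->
  L1 (fun y => gamma_dens R (va R P n a o i) (vb R P n a o i) y * f y) ->
  HasE (fun x => f (alX R x n a o i))
    (Int (fun y => gamma_dens R (va R P n a o i) (vb R P n a o i) y * f y)).
Proof.
move=> aa oo ii L; apply: (@HasE_block (keyAl n a o i)) => //.
- exact/blocksP/BlockAl.
- exact: dep1.
- by move=> x; exact: HasI_single L.
Qed.

Lemma HasE_rho_U i (f1 f2 : R -> R) : (i < nZ M n)%N ->
  L1 (fun y => gamma_dens R (vg R P n) (vh R P n) y * f1 y) ->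
  L1 (fun y => beta_dens R (vdelta R P n i) (vmu R P n i) y * f2 y) ->
  HasE (fun x => f1 (rhoX R x n) * f2 (uX R x n i))
   (Int (fun y => gamma_dens R (vg R P n) (vh R P n) y * f1 y) *
    Int (fun y => beta_dens R (vdelta R P n i) (vmu R P n i) y * f2 y)).
Proof.
move=> ii L1' L2'; apply: (@HasE_block2 (keyRho n) (keyU n i)) => //.
- exact/blocksP/BlockRho.
- exact: blkU.
- exact: dep1.
- exact: dep1.
- by move=> x; exact: HasI_single L1'.
- by move=> x; exact: HasI_single L2'.
Qed.

Lemma HasE_alpha_V a o i j (f1 f2 : R -> R) : (a < nA M n)%N -> (o < nO M n)%N ->
  (i < nZ M n)%N -> (j < nZ M n)%N ->
  L1 (fun y => gamma_dens R (va R P n a o i) (vb R P n a o i) y * f1 y) ->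
  L1 (fun y => beta_dens R (vsigma R P n a o i j) (vlambda R P n a o i j) y * f2 y) ->
  HasE (fun x => f1 (alX R x n a o i) * f2 (VX R x n a o i j))
   (Int (fun y => gamma_dens R (va R P n a o i) (vb R P n a o i) y * f1 y) *
    Int (fun y => beta_dens R (vsigma R P n a o i j) (vlambda R P n a o i j) y * f2 y)).
Proof.
move=> aa oo ii jj L1' L2'; apply: (@HasE_block2 (keyAl n a o i) (keyV n a o i j)) => //.
- exact/blocksP/BlockAl.
- exact/blocksP/BlockV.
- exact: dep1.
- exact: dep1.
- by move=> x; exact: HasI_single L1'.
- by move=> x; exact: HasI_single L2'.
Qed.

Lemma HasE_ln_pi i a : (i < nZ M n)%N -> (a < nA M n)%N ->
  HasE (fun x => ln (piX R M x n i a)) (Eln_dir M n i (vphi R P n i) a).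
Proof.
move=> ii aa; apply: (@HasE_block (keyPis n i)).
- exact/blocksP/BlockPi.
- by move=> x x' xx'; congr ln; exact: dep_piX xx'.
- by move=> x; apply: HasI_ddens_ln => //; [exact: nA_gt0|exact: pos_on_phi].
Qed.

Lemma HasE_ln_ddens i : (i < nZ M n)%N ->
  HasE (fun x => ln (ddens M n i (vphi R P n i) x)) (ent_dir M n i (vphi R P n i)).
Proof.
move=> ii; apply: (@HasE_block (keyPis n i)).
- exact/blocksP/BlockPi.
- by move=> x x' xx'; congr ln; exact: dep_ddens xx'.
- have A := nA_gt0 nn; have p0 := pos_on_phi nn ii.
  move=> x; have H y := HasI_ddens_ln_ddens i A y p0 p0.
  by split; [case: (H x)|rewrite /ent_dir (H _).2 (H _).2].
Qed.

End Atoms.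

Lemma bdens_gt0 x b : qdens R M P x != 0 -> b \in blocks -> 0 < bdens b x.
Proof.
move=> q0 bb.
have : bdens b x != 0.
  by apply: contraNneq q0 => h; rewrite qdensE (bigD1_seq b) ?uniq_blocks//= h mul0r.
rewrite lt_neqAle eq_sym => ->/=.
move: bb => /blocksP[n i nn ii|n a o i j nn aa oo ii jj|n nn|n a o i nn aa oo ii|n i nn ii];
  have [[g0 h0] hU hP hA hV] := pP nn.
- by have [d0 m0] := hU i ii; exact: beta_dens_ge0.
- by have [d0 m0] := hV a o i j aa oo ii jj; exact: beta_dens_ge0.
- exact: gamma_dens_ge0.
- by have [d0 m0] := hA a o i aa oo ii; exact: gamma_dens_ge0.
- by apply: ddens_ge0; [exact: nA_gt0|exact: pos_on_phi].
Qed.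

Section Support.
Variables (x : assign R).
Hypothesis q0 : qdens R M P x != 0.
Variable n : nat.
Hypothesis nn : (n < NA M)%N.

Lemma supp_U i : (i < nZ M n)%N -> 0 < uX R x n i < 1.
Proof.
move=> ii; have [_ hU _ _ _] := pP nn; have [d0 m0] := hU i ii.
have : 0 < bdens (keyU n i) x by apply/bdens_gt0 => //; exact/blocksP/BlockU.
by rewrite /= beta_dens_gt0.
Qed.

Lemma supp_V a o i j : (a < nA M n)%N -> (o < nO M n)%N -> (i < nZ M n)%N ->
  (j < nZ M n)%N -> 0 < VX R x n a o i j < 1.
Proof.
move=> aa oo ii jj; have [_ _ _ _ hV] := pP nn; have [d0 m0] := hV a o i j aa oo ii jj.
have : 0 < bdens (keyV n a o i j) x by apply/bdens_gt0 => //; exact/blocksP/BlockV.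
by rewrite /= beta_dens_gt0.
Qed.

Lemma supp_rho : 0 < rhoX R x n.
Proof.
have [[g0 h0] _ _ _ _] := pP nn.
have : 0 < bdens (keyRho n) x by apply/bdens_gt0 => //; exact/blocksP/BlockRho.
by rewrite /= gamma_dens_gt0.
Qed.

Lemma supp_alpha a o i : (a < nA M n)%N -> (o < nO M n)%N -> (i < nZ M n)%N ->
  0 < alX R x n a o i.
Proof.
move=> aa oo ii; have [_ _ _ hA _] := pP nn; have [d0 m0] := hA a o i aa oo ii.
have : 0 < bdens (keyAl n a o i) x by apply/bdens_gt0 => //; exact/blocksP/BlockAl.
by rewrite /= gamma_dens_gt0.
Qed.

Lemma supp_ddens i phi : (i < nZ M n)%N -> pos_on M n phi -> 0 < ddens M n i phi x.
Proof.
move=> ii phi0; rewrite ddens_gt0//; last exact: nA_gt0.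
have : 0 < bdens (keyPis n i) x by apply/bdens_gt0 => //; exact/blocksP/BlockPi.
by rewrite /= ddens_gt0//; [exact: nA_gt0|exact: pos_on_phi].
Qed.

Lemma supp_pi i a : (i < nZ M n)%N -> (a < nA M n)%N -> 0 < piX R M x n i a.
Proof.
move=> ii aa; have := supp_ddens ii (pos_on_phi nn ii).
by rewrite ddens_gt0 ?nA_gt0//; [move=> /forallP/(_ (Ordinal aa))|exact: pos_on_phi].
Qed.

End Support.

End Expectation.

(** * Expected visit counts *)

Section FiniteSums.
Context {R : realType}.

(** The distributive law used here needs one common index type, so the families go through the
    tagged union of the [T i] and come back along the bijection [dffun_of_fprod]. *)
Lemma sum_dffun_prod (I : finType) (T : I -> finType) (F : forall i, T i -> R) :
  \sum_(zz : {dffun forall i : I, T i}) \prod_(i : I) F i (zz i) =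
  \prod_(i : I) \sum_(z : T i) F i z.
Proof.
transitivity (\prod_(i : I) \sum_(z : T i) [ffun z => F i z] z); last first.
  by apply: eq_bigr => i _; apply: eq_bigr => z _; rewrite ffunE.
under [RHS]eq_bigr => i _.
  rewrite (big_tag (fun i => [ffun z => F i z]) i).
  over.
rewrite (bigA_distr_big_dep (fun i => tagged_with T i)) /=.
rewrite -(@big_fprod R 0 1 *%R +%R I T (fun i => [ffun z : T i => F i z])).
rewrite (reindex (@dffun_of_fprod I T)) /=; last exact/onW_bij/dffun_of_fprod_bij.
by apply: eq_bigr => t _; apply: eq_bigr => i _; rewrite !ffunE.
Qed.

(** The factor [g] joins the factor at [i0], so the product form is kept and every other factor sums
    to 1. *)
Lemma sum_dffun_marginal (I : finType) (T : I -> finType) (f g : forall i, T i -> R) (i0 : I) :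
  (forall i, \sum_(z : T i) f i z = 1) ->
  \sum_(zz : {dffun forall i : I, T i}) (\prod_(i : I) f i (zz i)) * g i0 (zz i0) =
  \sum_(z : T i0) f i0 z * g i0 z.
Proof.
move=> f1.
pose F i z := f i z * (if i == i0 then g i z else 1).
transitivity (\sum_(zz : {dffun forall i : I, T i}) \prod_(i : I) F i (zz i)).
  apply: eq_bigr => zz _; rewrite /F big_split /=; congr (_ * _).
  rewrite (bigD1 i0)//= eqxx big1 ?mulr1// => i /negbTE -> //.
rewrite sum_dffun_prod (bigD1 i0)//= [X in _ * X]big1 ?mulr1.
  by apply: eq_bigr => z _; rewrite /F eqxx.
move=> i /negbTE ii0; rewrite -[RHS](f1 i); apply: eq_bigr => z _.
by rewrite /F ii0 mulr1.
Qed.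

(** The logarithm of a stick-breaking weight is [A i] plus the sum of [B r] over [r < i]. Exchanging
    the sums gives [B i] the total weight of the later indices: this is the source of the tail sums
    in the updates of [mu] and [lambda]. *)
Lemma sum_triangle (m : nat) (q A B : nat -> R) :
  \sum_(i < m) q i * (A i + \sum_(r < i) B r) =
  \sum_(i < m) (q i * A i + (\sum_(i.+1 <= r < m) q r) * B i).
Proof.
under eq_bigr do rewrite mulrDr.
rewrite !big_split /=; congr (_ + _).
under eq_bigr do rewrite mulr_sumr.
under [RHS]eq_bigr do rewrite mulr_suml.
elim: m => [|m IH]; first by rewrite !big_ord0.
rewrite big_ord_recr /= IH [RHS]big_ord_recr /= [X in _ = _ + X]big_geq// addr0.
rewrite -big_split /=; apply: eq_bigr => i _.
by rewrite big_nat_recr //= mulrC.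
Qed.

Lemma sum_pick (m : nat) (f : nat -> R) (c : nat) : (c < m)%N ->
  f c = \sum_(a < m) (c == a)%:R * f a.
Proof.
move=> cm; rewrite (bigD1 (Ordinal cm))//= eqxx mul1r big1 ?addr0// => a.
by rewrite -val_eqE /= eq_sym => /negbTE ->; rewrite mul0r.
Qed.

Lemma sum_partition_ord (T : finType) (m : nat) (pr : T -> 'I_m) (w : T -> R) (f : nat -> R) :
  \sum_(z : T) w z * f (pr z) =
  \sum_(i < m) (\sum_(z : T | (pr z : nat) == i) w z) * f i.
Proof.
rewrite (partition_big pr predT)//=; apply: eq_bigr => i _.
rewrite mulr_suml; apply: eq_big => [z|z /eqP -> //].
by rewrite val_eqE.
Qed.

End FiniteSums.

Section Counts.
Context {R : realType}.
Variables (M : model R) (P0 : vparams R).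
Hypotheses (wM : wf_model M).
Local Notation th := (Theta_tilde R M P0).
Local Notation qmarg1 := (qmarg1 R M P0).
Local Notation qmarg2 := (qmarg2 R M P0).
Local Notation nut := (nutilde R M P0).

(** The additive counterpart of [pjoint]: with expected logarithms as arguments, it is the expected
    log-probability of a path. *)
Definition pathsum (fe : nat -> nat -> R) (fo : nat -> nat -> nat -> nat -> nat -> R)
    (fp : nat -> nat -> nat -> R) k n t (z : zpath R M n t) : R :=
  fe n (z ord0) + fp n (z ord0) (act R M k n 0) +
  \sum_(tau < t)
     (fo n (act R M k n tau) (obs R M k n tau.+1) (z (inord tau)) (z (inord tau.+1)) +
      fp n (z (inord tau.+1)) (act R M k n tau.+1)).

(** All entries of [Theta_tilde] are exponentials, so the division by [pact] that normalizes path
    weights is sound. *)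
Lemma pjoint_tilde_gt0 k n t (z : zpath R M n t) : 0 < pjoint R M th k n t z.
Proof.
by rewrite /pjoint !mulr_gt0 ?expR_gt0// prodr_gt0// => tau _; rewrite mulr_gt0 ?expR_gt0.
Qed.

Lemma pact_tilde_gt0 k n t : (n < NA M)%N -> 0 < pact R M th k n t.
Proof.
move=> nn; have [_ h _ _ _] := wM; have [_ _ z0] := h n nn.
rewrite /pact (bigD1 [ffun=> Ordinal z0])//=.
by rewrite ltr_wpDr ?pjoint_tilde_gt0// sumr_ge0// => z _; rewrite ltW ?pjoint_tilde_gt0.
Qed.

Lemma pjoint_norm k n t : (n < NA M)%N ->
  \sum_(z : zpath R M n t) pjoint R M th k n t z / pact R M th k n t = 1.
Proof. by move=> nn; rewrite -mulr_suml divff// gt_eqF// pact_tilde_gt0. Qed.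

(** Regrouped to the index ranges of the updates: actions at times [0..t], transitions at times
    [1..t]. *)
Lemma pathsumE fe fo fp k n t (z : zpath R M n t) :
  pathsum fe fo fp k z =
  fe n (z (inord 0)) +
  (\sum_(0 <= tau < t.+1) fp n (z (inord tau)) (act R M k n tau)) +
  \sum_(1 <= tau < t.+1) fo n (act R M k n tau.-1) (obs R M k n tau)
     (z (inord tau.-1)) (z (inord tau)).
Proof.
rewrite /pathsum big_split /= [X in _ = _ + X + _]big_nat_recl//= big_mkord.
rewrite (_ : inord 0 = ord0 :> 'I_t.+1); last by apply/val_inj; rewrite /= inordK.
rewrite big_add1 /= big_mkord.
by rewrite -!addrA; congr (_ + (_ + _)); rewrite addrC.
Qed.

(** These counts are the data parts of the updates. The suffix [1] marks the tail counts, which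
    multiply the expected [ln (1 - u)] and [ln (1 - V)]. *)
Definition cU n i := avg R M (fun k t => qmarg1 k n t 0 i).
Definition cU1 n i := avg R M (fun k t => \sum_(i.+1 <= m < nZ M n) qmarg1 k n t 0 m).
Definition cPi n i (a : nat) := avg R M (fun k t => \sum_(0 <= tau < t.+1)
     qmarg1 k n t tau i * (act R M k n tau == a)%:R).
Definition cV n (a o : nat) i j := avg R M (fun k t => \sum_(1 <= tau < t.+1)
     qmarg2 k n t tau i j * ((act R M k n tau.-1 == a) && (obs R M k n tau == o))%:R).
Definition cV1 n (a o : nat) i j := avg R M (fun k t => \sum_(1 <= tau < t.+1)
     \sum_(j.+1 <= m < nZ M n)
     qmarg2 k n t tau i m * ((act R M k n tau.-1 == a) && (obs R M k n tau == o))%:R).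

Lemma avgZr (F : nat -> nat -> R) c : avg R M F * c = avg R M (fun k t => F k t * c).
Proof.
rewrite /avg mulr_suml; apply: eq_bigr => k _; rewrite -mulrA; congr (_ * _).
by rewrite mulr_suml.
Qed.

Lemma avgD (F G : nat -> nat -> R) :
  avg R M F + avg R M G = avg R M (fun k t => F k t + G k t).
Proof.
rewrite /avg -big_split /=; apply: eq_bigr => k _; rewrite -mulrDr; congr (_ * _).
by rewrite -big_split.
Qed.

Lemma avg_sum (I : finType) (F : I -> nat -> nat -> R) :
  \sum_i avg R M (F i) = avg R M (fun k t => \sum_i F i k t).
Proof.
rewrite /avg exchange_big /=; apply: eq_bigr => k _; rewrite -mulr_sumr; congr (_ * _).
by rewrite exchange_big.
Qed.

Lemma eq_avg (F G : nat -> nat -> R) :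
  (forall k t, (k < KK R M)%N -> (t <= TT R M k)%N -> F k t = G k t) -> avg R M F = avg R M G.
Proof.
move=> FG; apply: eq_bigr => k _; congr (_ * _); apply: eq_bigr => t _.
by apply: FG => //; rewrite -ltnS.
Qed.

Variables (A B : nat -> nat -> R) (C D : nat -> nat -> nat -> nat -> nat -> R)
  (E : nat -> nat -> nat -> R).
Let fe n i := A n i + \sum_(m < i) B n m.
Let fo n a o i j := C n a o i j + \sum_(m < j) D n a o i m.

(** Each summand of [pathsum] sees one node or two consecutive nodes of the path. Partitioning the
    paths by these nodes leaves the marginals [qmarg1] and [qmarg2]. *)
Lemma sum_path_marginals k n t : (n < NA M)%N ->
  nut k t * (\sum_(z : zpath R M n t) pjoint R M th k n t z / pact R M th k n t *
     pathsum fe fo E k z) =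
  \sum_(i < nZ M n) qmarg1 k n t 0 i * fe n i +
  (\sum_(0 <= tau < t.+1) \sum_(i < nZ M n) qmarg1 k n t tau i * E n i (act R M k n tau)) +
  \sum_(1 <= tau < t.+1) \sum_(i < nZ M n) \sum_(j < nZ M n)
     qmarg2 k n t tau i j * fo n (act R M k n tau.-1) (obs R M k n tau) i j.
Proof.
move=> nn; set w := fun z => pjoint R M th k n t z / pact R M th k n t.
have q1 tau (f : nat -> R) : nut k t * (\sum_(z : zpath R M n t) w z * f (z (inord tau))) =
    \sum_(i < nZ M n) qmarg1 k n t tau i * f i.
  rewrite (@sum_partition_ord _ _ _ (fun z : zpath R M n t => z (inord tau)) w f) mulr_sumr.
  by apply: eq_bigr => i _; rewrite mulrA; congr (_ * _ * _); rewrite mulr_suml.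
have q2 tau (f : nat -> nat -> R) :
    nut k t * (\sum_(z : zpath R M n t) w z * f (z (inord tau.-1)) (z (inord tau))) =
    \sum_(i < nZ M n) \sum_(j < nZ M n) qmarg2 k n t tau i j * f i j.
  rewrite (partition_big (fun z : zpath R M n t => z (inord tau.-1)) predT)//= mulr_sumr.
  apply: eq_bigr => i _.
  rewrite (partition_big (fun z : zpath R M n t => z (inord tau)) predT)//= mulr_sumr.
  apply: eq_bigr => j _; rewrite /qmarg2 -[RHS]mulrA; congr (_ * _).
  rewrite !mulr_suml; apply: eq_big => [z|z /andP[/eqP -> /eqP -> //]].
  by rewrite !val_eqE.
under eq_bigr do rewrite pathsumE 2!mulrDr.
rewrite 2!big_split /= 2!mulrDr; congr (_ + _ + _).
- exact: q1.
- under eq_bigr do rewrite mulr_sumr.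
  rewrite exchange_big /= mulr_sumr; apply: eq_bigr => tau _.
  by rewrite (q1 tau (fun i => E n i (act R M k n tau))).
- under eq_bigr do rewrite mulr_sumr.
  rewrite exchange_big /= mulr_sumr; apply: eq_bigr => tau _.
  by rewrite (q2 tau (fun i j => fo n (act R M k n tau.-1) (obs R M k n tau) i j)).
Qed.

Lemma sum_counts n : (n < NA M)%N ->
  avg R M (fun k t => nut k t * (\sum_(z : zpath R M n t)
     pjoint R M th k n t z / pact R M th k n t * pathsum fe fo E k z)) =
  \sum_(i < nZ M n) (cU n i * A n i + cU1 n i * B n i) +
  \sum_(i < nZ M n) \sum_(a < nA M n) cPi n i a * E n i a +
  \sum_(a < nA M n) \sum_(o < nO M n) \sum_(i < nZ M n) \sum_(j < nZ M n)
    (cV n a o i j * C n a o i j + cV1 n a o i j * D n a o i j).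
Proof.
move=> nn; have [_ _ hao _ _] := wM.
rewrite (eq_avg (fun k t _ _ => sum_path_marginals k t nn)).
have -> : \sum_(i < nZ M n) (cU n i * A n i + cU1 n i * B n i) =
    avg R M (fun k t => \sum_(i < nZ M n) qmarg1 k n t 0 i * fe n i).
  under eq_bigr do rewrite /cU /cU1 !avgZr avgD.
  rewrite avg_sum; apply: eq_avg => k t _ _; apply/esym.
  exact: (sum_triangle (nZ M n) (qmarg1 k n t 0) (A n) (B n)).
have -> : \sum_(i < nZ M n) \sum_(a < nA M n) cPi n i a * E n i a =
    avg R M (fun k t => \sum_(0 <= tau < t.+1) \sum_(i < nZ M n)
      qmarg1 k n t tau i * E n i (act R M k n tau)).
  under eq_bigr => i _.
    under eq_bigr do rewrite /cPi avgZr.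
    rewrite avg_sum.
    over.
  rewrite avg_sum.
  apply: eq_avg => k t kk tt; rewrite [RHS]exchange_big /=; apply: eq_bigr => i _.
  under eq_bigr do rewrite mulr_suml.
  rewrite exchange_big /=; apply: eq_big_nat => tau /andP[_ taut].
  (* Recorded actions lie in range, so the indicator sum over all actions picks out exactly the
     recorded one. *)
  rewrite ltnS in taut; have [aa _] := hao k n tau kk nn (leq_trans taut tt).
  rewrite (sum_pick (E n i) aa) mulr_sumr; apply: eq_bigr => a _.
  by rewrite mulrA.
have -> : \sum_(a < nA M n) \sum_(o < nO M n) \sum_(i < nZ M n) \sum_(j < nZ M n)
    (cV n a o i j * C n a o i j + cV1 n a o i j * D n a o i j) =
  avg R M (fun k t => \sum_(1 <= tau < t.+1) \sum_(i < nZ M n) \sum_(j < nZ M n)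
     qmarg2 k n t tau i j * fo n (act R M k n tau.-1) (obs R M k n tau) i j).
  pose ind k tau (a o : nat) : R := ((act R M k n tau.-1 == a) && (obs R M k n tau == o))%:R.
  (* The counts [cV] and [cV1] are first recombined over [j] by [sum_triangle]; the sums over [i],
     [o] and [a] then enter the average one at a time. *)
  transitivity (\sum_(a < nA M n) \sum_(o < nO M n) \sum_(i < nZ M n) avg R M (fun k t =>
      \sum_(1 <= tau < t.+1) ind k tau a o * \sum_(j < nZ M n) qmarg2 k n t tau i j * fo n a o i j)).
    apply: eq_bigr => a _; apply: eq_bigr => o _; apply: eq_bigr => i _.
    under eq_bigr do rewrite /cV /cV1 !avgZr avgD.
    rewrite avg_sum; apply: eq_avg => k t _ _.
    under [RHS]eq_bigr => tau _.
      rewrite (sum_triangle (nZ M n) (qmarg2 k n t tau i) (C n a o i) (D n a o i)) mulr_sumr.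
      over.
    rewrite [RHS]exchange_big /=; apply: eq_bigr => j _.
    rewrite !mulr_suml -big_split /=; apply: eq_bigr => tau _.
    rewrite -mulr_suml -/(ind k tau a o).
    ring.
  transitivity (\sum_(a < nA M n) \sum_(o < nO M n) avg R M (fun k t =>
      \sum_(i < nZ M n) \sum_(1 <= tau < t.+1) ind k tau a o *
        \sum_(j < nZ M n) qmarg2 k n t tau i j * fo n a o i j)).
    by apply: eq_bigr => a _; apply: eq_bigr => o _; rewrite avg_sum.
  transitivity (\sum_(a < nA M n) avg R M (fun k t => \sum_(o < nO M n)
      \sum_(i < nZ M n) \sum_(1 <= tau < t.+1) ind k tau a o *
        \sum_(j < nZ M n) qmarg2 k n t tau i j * fo n a o i j)).
    by apply: eq_bigr => a _; rewrite avg_sum.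
  rewrite avg_sum; apply: eq_avg => k t kk tt.
  under eq_bigr => a _.
    under eq_bigr do rewrite exchange_big /=.
    rewrite exchange_big /=.
    over.
  rewrite exchange_big /=; apply: eq_big_nat => tau /andP[tau1 taut].
  have t1 : (tau.-1 <= TT R M k)%N.
    by rewrite (leq_trans (leq_pred _)) ?(leq_trans _ tt)// -ltnS.
  have tT : (tau <= TT R M k)%N by rewrite (leq_trans _ tt)// -ltnS.
  have [aa _] := hao k n tau.-1 kk nn t1.
  have [_ /(_ tau1) oo] := hao k n tau kk nn tT.
  (* At a fixed time only the recorded pair of action and observation survives, with contribution
     [S]. *)
  pose S (a o : nat) := \sum_(i < nZ M n) \sum_(j < nZ M n) qmarg2 k n t tau i j * fo n a o i j.
  rewrite [RHS](sum_pick (fun a => S a (obs R M k n tau)) aa); apply: eq_bigr => a _.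
  rewrite [in RHS](sum_pick (S a) oo) mulr_sumr; apply: eq_bigr => o _.
  rewrite -mulr_sumr -/(S a o) mulrA; congr (_ * _).
  by rewrite /ind -natrM mulnb.
by rewrite !avgD.
Qed.

(** The path weights factor over agents up to the common factor [nutilde], so a function of one
    agent's path sees only that agent's normalized weights. *)
Lemma sum_zvec_path k t (g : forall n, zpath R M n t -> R) :
  \sum_(zz : zvec R M t) qz R M P0 k t zz * (\sum_(n < NA M) g n (zz n)) =
  \sum_(n < NA M) nut k t * (\sum_(z : zpath R M n t)
     pjoint R M th k n t z / pact R M th k n t * g n z).
Proof.
under eq_bigr do rewrite mulr_sumr.
rewrite exchange_big /=; apply: eq_bigr => n _.
rewrite -(@sum_dffun_marginal R 'I_(NA M) (fun n => zpath R M n t)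
  (fun n z => pjoint R M th k n t z / pact R M th k n t) (fun n z => g n z) n); last first.
  by move=> n'; exact: pjoint_norm.
by rewrite mulr_sumr; apply: eq_bigr => zz _; rewrite mulrA.
Qed.

End Counts.

(** * The ELBO as a sum of terms of the factors *)

Section ElboFormula.
Context {R : realType}.
Variables (M : model R) (P0 : vparams R).
Hypotheses (wM : wf_model M).
Local Notation EU P n i := (Eln_beta (vdelta R P n i) (vmu R P n i)).
Local Notation EU1 P n i := (Eln1_beta (vdelta R P n i) (vmu R P n i)).
Local Notation EV P n a o i j := (Eln_beta (vsigma R P n a o i j) (vlambda R P n a o i j)).
Local Notation EV1 P n a o i j := (Eln1_beta (vsigma R P n a o i j) (vlambda R P n a o i j)).
Local Notation ER P n := (Eln_gamma (vg R P n) (vh R P n)).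
Local Notation EA P n a o i := (Eln_gamma (va R P n a o i) (vb R P n a o i)).
Local Notation mR P n := (vg R P n / vh R P n).
Local Notation mA P n a o i := (va R P n a o i / vb R P n a o i).
Local Notation EPi P n i a := (Eln_dir M n i (vphi R P n i) a).

Section Values.
Variable P : vparams R.
Hypothesis pP : vpos M P.
Local Notation HasE := (HasE M P).

(** Positivity on the support travels along with the expected logarithm, because the logarithm of a
    product splits only for positive factors. *)
Definition HasLn (F : assign R -> R) (v : R) :=
  (forall x, qdens R M P x != 0 -> 0 < F x) /\ HasE (fun x => ln (F x)) v.

Lemma HasLn_mul F G u v : HasLn F u -> HasLn G v -> HasLn (fun x => F x * G x) (u + v).
Proof.
move=> [F0 HF] [G0 HG]; split=> [x q0|]; first by rewrite mulr_gt0 ?F0 ?G0.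
by apply: HasE_supp (HasE_D HF HG) => x q0; rewrite lnM ?posrE ?F0 ?G0.
Qed.

Lemma HasLn_prod (I : finType) (F : I -> assign R -> R) v :
  (forall i, HasLn (F i) (v i)) -> HasLn (fun x => \prod_i F i x) (\sum_i v i).
Proof.
move=> H; split=> [x q0|]; first by apply: prodr_gt0 => i _; have [F0 _] := H i; exact: F0.
apply: (HasE_supp _ (HasE_sum (index_enum I) (fun i _ => (H i).2))) => x q0.
by rewrite ln_prod// => i _; exact: (H i).1.
Qed.

Lemma HasLn_cst c : 0 < c -> HasLn (fun=> c) (ln c).
Proof. by move=> c0; split => //; exact: HasE_cst. Qed.

Section Agent.
Variable n : nat.
Hypothesis nn : (n < NA M)%N.

Lemma HasLn_U i : (i < nZ M n)%N -> HasLn (fun x => uX R x n i) (EU P n i).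
Proof.
move=> ii; have [_ hU _ _ _] := pP nn; have [d0 m0] := hU i ii.
split=> [x q0|]; first by have /andP[] := supp_U wM pP q0 nn ii.
by apply: (HasE_U wM pP nn ii); exact: L1_beta_dens_ln.
Qed.

Lemma HasLn_U1 i : (i < nZ M n)%N -> HasLn (fun x => 1 - uX R x n i) (EU1 P n i).
Proof.
move=> ii; have [_ hU _ _ _] := pP nn; have [d0 m0] := hU i ii.
split=> [x q0|]; first by have /andP[_] := supp_U wM pP q0 nn ii; rewrite subr_gt0.
by apply: (HasE_U wM pP nn ii (f := fun y => ln (1 - y))); exact: L1_beta_dens_ln1.
Qed.

Lemma HasLn_V a o i j : (a < nA M n)%N -> (o < nO M n)%N -> (i < nZ M n)%N ->
  (j < nZ M n)%N -> HasLn (fun x => VX R x n a o i j) (EV P n a o i j).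
Proof.
move=> aa oo ii jj; have [_ _ _ _ hV] := pP nn; have [d0 m0] := hV a o i j aa oo ii jj.
split=> [x q0|]; first by have /andP[] := supp_V wM pP q0 nn aa oo ii jj.
by apply: (HasE_V wM pP nn aa oo ii jj); exact: L1_beta_dens_ln.
Qed.

Lemma HasLn_V1 a o i j : (a < nA M n)%N -> (o < nO M n)%N -> (i < nZ M n)%N ->
  (j < nZ M n)%N -> HasLn (fun x => 1 - VX R x n a o i j) (EV1 P n a o i j).
Proof.
move=> aa oo ii jj; have [_ _ _ _ hV] := pP nn; have [d0 m0] := hV a o i j aa oo ii jj.
split=> [x q0|]; first by have /andP[_] := supp_V wM pP q0 nn aa oo ii jj; rewrite subr_gt0.
by apply: (HasE_V wM pP nn aa oo ii jj (f := fun y => ln (1 - y))); exact: L1_beta_dens_ln1.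
Qed.

Lemma HasLn_pi i a : (i < nZ M n)%N -> (a < nA M n)%N ->
  HasLn (fun x => piX R M x n i a) (EPi P n i a).
Proof.
move=> ii aa; split=> [x q0|]; first exact: (supp_pi wM pP q0 nn ii aa).
exact: HasE_ln_pi.
Qed.

Lemma HasLn_prior_U i : (i < nZ M n)%N ->
  HasLn (fun x => beta_dens R 1 (rhoX R x n) (uX R x n i))
    (ER P n + (mR P n - 1) * EU1 P n i).
Proof.
move=> ii; have [[g0 h0] hU _ _ _] := pP nn; have [d0 m0] := hU i ii.
split=> [x q0|].
  by rewrite beta_dens_gt0 ?(supp_U wM pP q0)// (supp_rho wM pP q0).
have H1 : HasE (fun x => ln (rhoX R x n)) (ER P n).
  by apply: (HasE_rho wM pP nn); exact: L1_gamma_dens_ln.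
have H2 : HasE (fun x => rhoX R x n * ln (1 - uX R x n i)) (mR P n * EU1 P n i).
  rewrite -(Int_gamma_dens_id g0 h0).
  by apply: (HasE_rho_U wM pP nn (f1 := id) (f2 := fun y => ln (1 - y)) ii);
    [exact: L1_gamma_dens_id|exact: L1_beta_dens_ln1].
have H3 := HasE_Z (-1) (HasLn_U1 ii).2.
rewrite mulN1r in H3; rewrite mulrBl mul1r.
apply: HasE_supp (HasE_D H1 (HasE_D H2 H3)) => x q0.
rewrite ln_beta_dens1 ?(supp_U wM pP q0) ?(supp_rho wM pP q0)//.
by rewrite mulrBl mul1r mulN1r.
Qed.

Lemma HasLn_prior_V a o i j : (a < nA M n)%N -> (o < nO M n)%N -> (i < nZ M n)%N ->
  (j < nZ M n)%N ->
  HasLn (fun x => beta_dens R 1 (alX R x n a o i) (VX R x n a o i j))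
    (EA P n a o i + (mA P n a o i - 1) * EV1 P n a o i j).
Proof.
move=> aa oo ii jj; have [_ _ _ hA hV] := pP nn.
have [g0 h0] := hA a o i aa oo ii; have [d0 m0] := hV a o i j aa oo ii jj.
split=> [x q0|].
  by rewrite beta_dens_gt0 ?(supp_V wM pP q0)// (supp_alpha wM pP q0).
have H1 : HasE (fun x => ln (alX R x n a o i)) (EA P n a o i).
  by apply: (HasE_alpha wM pP nn aa oo ii); exact: L1_gamma_dens_ln.
have H2 : HasE (fun x => alX R x n a o i * ln (1 - VX R x n a o i j))
    (mA P n a o i * EV1 P n a o i j).
  rewrite -(Int_gamma_dens_id g0 h0).
  by apply: (HasE_alpha_V wM pP nn (f1 := id) (f2 := fun y => ln (1 - y)) aa oo ii jj);
    [exact: L1_gamma_dens_id|exact: L1_beta_dens_ln1].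
have H3 := HasE_Z (-1) (HasLn_V1 aa oo ii jj).2.
rewrite mulN1r in H3; rewrite mulrBl mul1r.
apply: HasE_supp (HasE_D H1 (HasE_D H2 H3)) => x q0.
rewrite ln_beta_dens1 ?(supp_V wM pP q0) ?(supp_alpha wM pP q0)//.
by rewrite mulrBl mul1r mulN1r.
Qed.

Definition gamma_lncst (e f : R) := e * ln f - ln (GammaR R e).

Lemma HasLn_prior_rho : HasLn (fun x => gamma_dens R (he R M) (hf R M) (rhoX R x n))
  ((he R M - 1) * ER P n - hf R M * mR P n + gamma_lncst (he R M) (hf R M)).
Proof.
have [_ _ _ _ [_ e0 f0 _ _]] := wM; have [[g0 h0] _ _ _ _] := pP nn.
split=> [x q0|]; first by rewrite gamma_dens_gt0// (supp_rho wM pP q0).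
have [L I] := L1_Int_gamma_ln_gamma g0 h0 e0 f0.
by rewrite -I; exact: (HasE_rho wM pP nn (f := fun y => ln (gamma_dens R (he R M) (hf R M) y)) L).
Qed.

Lemma HasLn_prior_alpha a o i : (a < nA M n)%N -> (o < nO M n)%N -> (i < nZ M n)%N ->
  HasLn (fun x => gamma_dens R (hc R M n a o) (hd R M n a o) (alX R x n a o i))
  ((hc R M n a o - 1) * EA P n a o i - hd R M n a o * mA P n a o i +
   gamma_lncst (hc R M n a o) (hd R M n a o)).
Proof.
move=> aa oo ii; have [_ _ _ _ [_ _ _ hcd _]] := wM; have [c0 d0] := hcd n a o nn aa oo.
have [_ _ _ hA _] := pP nn; have [g0 h0] := hA a o i aa oo ii.
split=> [x q0|]; first by rewrite gamma_dens_gt0// (supp_alpha wM pP q0).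
have [L I] := L1_Int_gamma_ln_gamma g0 h0 c0 d0.
rewrite -I.
exact: (HasE_alpha wM pP nn (f := fun y => ln (gamma_dens R (hc R M n a o) (hd R M n a o) y)) aa oo ii L).
Qed.

Lemma HasLn_dir i phi : (i < nZ M n)%N -> pos_on M n phi ->
  HasLn (fun x => dir_dens R (nA M n) phi (piX R M x n i))
  (- ln (dir_cst (nA M n).-1 phi 0) + \sum_(a < nA M n) (phi a - 1) * EPi P n i a).
Proof.
move=> ii phi0; have A0 := nA_gt0 wM nn.
split=> [x q0|]; first exact: (supp_ddens wM pP q0 nn ii phi0).
apply: HasE_supp (HasE_D (HasE_cst wM pP _)
  (HasE_sum (index_enum 'I_(nA M n)) (fun a (_ : predT a) =>
     HasE_Z (phi a - 1) (HasE_ln_pi wM pP nn ii (ltn_ord a))))) => x q0.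
by rewrite -(ln_ddens A0 phi0 (supp_ddens wM pP q0 nn ii phi0)).
Qed.

Lemma HasLn_ent_U i : (i < nZ M n)%N ->
  HasLn (fun x => beta_dens R (vdelta R P n i) (vmu R P n i) (uX R x n i))
    (ent_beta (vdelta R P n i) (vmu R P n i)).
Proof.
move=> ii; have [_ hU _ _ _] := pP nn; have [d0 m0] := hU i ii.
split=> [x q0|]; first by rewrite beta_dens_gt0// (supp_U wM pP q0).
have [L _] := L1_Int_beta_ln_beta d0 m0 d0 m0.
exact: (HasE_U wM pP nn ii (f := fun y => ln (beta_dens R (vdelta R P n i) (vmu R P n i) y)) L).
Qed.

Lemma HasLn_ent_V a o i j : (a < nA M n)%N -> (o < nO M n)%N -> (i < nZ M n)%N ->
  (j < nZ M n)%N ->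
  HasLn (fun x => beta_dens R (vsigma R P n a o i j) (vlambda R P n a o i j) (VX R x n a o i j))
    (ent_beta (vsigma R P n a o i j) (vlambda R P n a o i j)).
Proof.
move=> aa oo ii jj; have [_ _ _ _ hV] := pP nn; have [d0 m0] := hV a o i j aa oo ii jj.
split=> [x q0|]; first by rewrite beta_dens_gt0// (supp_V wM pP q0).
have [L _] := L1_Int_beta_ln_beta d0 m0 d0 m0.
exact: (HasE_V wM pP nn aa oo ii jj
  (f := fun y => ln (beta_dens R (vsigma R P n a o i j) (vlambda R P n a o i j) y)) L).
Qed.

Lemma HasLn_ent_rho : HasLn (fun x => gamma_dens R (vg R P n) (vh R P n) (rhoX R x n))
  (ent_gamma (vg R P n) (vh R P n)).
Proof.
have [[g0 h0] _ _ _ _] := pP nn.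
split=> [x q0|]; first by rewrite gamma_dens_gt0// (supp_rho wM pP q0).
have [L _] := L1_Int_gamma_ln_gamma g0 h0 g0 h0.
exact: (HasE_rho wM pP nn (f := fun y => ln (gamma_dens R (vg R P n) (vh R P n) y)) L).
Qed.

Lemma HasLn_ent_alpha a o i : (a < nA M n)%N -> (o < nO M n)%N -> (i < nZ M n)%N ->
  HasLn (fun x => gamma_dens R (va R P n a o i) (vb R P n a o i) (alX R x n a o i))
  (ent_gamma (va R P n a o i) (vb R P n a o i)).
Proof.
move=> aa oo ii; have [_ _ _ hA _] := pP nn; have [g0 h0] := hA a o i aa oo ii.
split=> [x q0|]; first by rewrite gamma_dens_gt0// (supp_alpha wM pP q0).
have [L _] := L1_Int_gamma_ln_gamma g0 h0 g0 h0.
exact: (HasE_alpha wM pP nn (f := fun y => ln (gamma_dens R (va R P n a o i) (vb R P n a o i) y)) aa oo ii L).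
Qed.

Lemma HasLn_ent_dir i : (i < nZ M n)%N ->
  HasLn (fun x => dir_dens R (nA M n) (vphi R P n i) (piX R M x n i))
    (ent_dir M n i (vphi R P n i)).
Proof.
move=> ii; have p0 := pos_on_phi pP nn ii.
split=> [x q0|]; first exact: (supp_ddens wM pP q0 nn ii p0).
exact: (HasE_ln_ddens wM pP nn ii).
Qed.

Let fe n i := EU P n i + \sum_(m < i) EU1 P n m.
Let fo n a o i j := EV P n a o i j + \sum_(m < j) EV1 P n a o i m.
Let fp n i a := EPi P n i a.

Lemma HasLn_pjoint k t (z : zpath R M n t) : (k < KK R M)%N -> (t <= TT R M k)%N ->
  HasLn (fun x => pjoint R M (ThetaX R M x) k n t z) (pathsum fe fo fp k z).
Proof.
move=> kk tt; have [_ _ hao _ _] := wM.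
have lz (s : 'I_t.+1) : (z s < nZ M n)%N by [].
have He (i : 'I_(nZ M n)) : HasLn (fun x => feta R (ThetaX R M x) n i) (fe n i).
  apply: HasLn_mul; first exact: HasLn_U.
  by apply: HasLn_prod => m; apply: HasLn_U1; exact: ltn_trans (ltn_ord m) (ltn_ord i).
have Ho a o (i j : 'I_(nZ M n)) : (a < nA M n)%N -> (o < nO M n)%N ->
    HasLn (fun x => fom R (ThetaX R M x) n a o i j) (fo n a o i j).
  move=> aa oo; apply: HasLn_mul; first exact: HasLn_V.
  by apply: HasLn_prod => m; apply: HasLn_V1 => //; exact: ltn_trans (ltn_ord m) (ltn_ord j).
have Hp (i : 'I_(nZ M n)) a : (a < nA M n)%N ->
    HasLn (fun x => fpi R (ThetaX R M x) n i a) (fp n i a).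
  by move=> aa; exact: HasLn_pi.
have ha tau : (tau <= t)%N -> (act R M k n tau < nA M n)%N.
  by move=> tt'; have [] := hao k n tau kk nn (leq_trans tt' tt).
apply: HasLn_mul.
  by apply: HasLn_mul; [exact: He|apply: Hp; exact: ha].
apply: HasLn_prod => tau; have tau_t := ltn_ord tau.
apply: HasLn_mul; last by apply: Hp; exact: ha.
apply: Ho; first by apply: ha; exact: ltnW.
have [_] := hao k n tau.+1 kk nn (leq_trans tau_t tt).
by apply.
Qed.

End Agent.

Let fe n i := EU P n i + \sum_(m < i) EU1 P n m.
Let fo n a o i j := EV P n a o i j + \sum_(m < j) EV1 P n a o i m.
Let fp n i a := EPi P n i a.

Lemma rtilde_ge0 k t : (k < KK R M)%N -> (t <= TT R M k)%N -> 0 <= rtilde R M k t.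
Proof.
move=> kk tt; have [_ _ _ [hr /andP[g0 _]] [hp _ _ _ _]] := wM.
rewrite /rtilde divr_ge0 ?mulr_ge0 ?exprn_ge0 ?subr_ge0 ?hr//.
by apply: prodr_ge0 => n _; have /andP[/ltW] := hp k n t kk (ltn_ord n) tt.
Qed.

(** When the rescaled reward is zero, its logarithm in the ELBO is a default value; the weight of
    that term then vanishes too. *)
Lemma rtilde_eq0 k t : (k < KK R M)%N -> (t <= TT R M k)%N -> rtilde R M k t = 0 ->
  nutilde R M P0 k t = 0.
Proof.
move=> kk tt; have [_ _ _ _ [hp _ _ _ _]] := wM.
have p0 : 0 < pPi_all R M k t.
  by apply: prodr_gt0 => n _; have /andP[] := hp k n t kk (ltn_ord n) tt.
rewrite /rtilde => /eqP; rewrite mulf_eq0 invr_eq0 (gt_eqF p0) orbF => /eqP E.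
by rewrite /nutilde E !mul0r.
Qed.

Lemma qz_Eq k t (zz : zvec R M t) : (k < KK R M)%N -> (t <= TT R M k)%N ->
  qz R M P0 k t zz * Eq R M P (fun x => ln (rtilde R M k t *
     \prod_(n < NA M) pjoint R M (ThetaX R M x) k n t (zz n))) =
  qz R M P0 k t zz * ln (rtilde R M k t) +
  qz R M P0 k t zz * \sum_(n < NA M) pathsum fe fo fp k (zz n).
Proof.
move=> kk tt; have := rtilde_ge0 kk tt; rewrite le_eqVlt => /predU1P[r0|r0].
  by rewrite /qz (rtilde_eq0 kk tt (esym r0)) !mul0r addr0.
rewrite -mulrDr; congr (_ * _); apply: HasE_Eq.
have [] // := HasLn_mul (HasLn_cst r0)
  (HasLn_prod (F := fun (n : 'I_(NA M)) x => pjoint R M (ThetaX R M x) k n t (zz n))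
    (fun n => HasLn_pjoint (ltn_ord n) (zz n) kk tt)).
Qed.

Definition data_cst := (KK R M)%:R^-1 * \sum_(k < KK R M) \sum_(t < (TT R M k).+1)
  \sum_(zz : zvec R M t) qz R M P0 k t zz * ln (rtilde R M k t).

Lemma data_term :
  (KK R M)%:R^-1 * \sum_(k < KK R M) \sum_(t < (TT R M k).+1) \sum_(zz : zvec R M t)
     qz R M P0 k t zz *
     Eq R M P (fun x => ln (rtilde R M k t *
                          \prod_(n < NA M) pjoint R M (ThetaX R M x) k n t (zz n))) =
  data_cst + \sum_(n < NA M)
   (\sum_(i < nZ M n) (cU M P0 n i * EU P n i + cU1 M P0 n i * EU1 P n i) +
    \sum_(i < nZ M n) \sum_(a < nA M n) cPi M P0 n i a * EPi P n i a +
    \sum_(a < nA M n) \sum_(o < nO M n) \sum_(i < nZ M n) \sum_(j < nZ M n)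
     (cV M P0 n a o i j * EV P n a o i j + cV1 M P0 n a o i j * EV1 P n a o i j)).
Proof.
rewrite /data_cst.
rewrite [X in _ = _ + X](eq_bigr _ (fun n _ => esym (sum_counts P0 wM (fun n i => EU P n i)
  (fun n i => EU1 P n i) (fun n a o i j => EV P n a o i j) (fun n a o i j => EV1 P n a o i j)
  (fun n i a => EPi P n i a) (ltn_ord n)))).
rewrite avg_sum /avg -mulr_sumr -mulrDr; congr (_ * _).
rewrite -big_split /=; apply: eq_bigr => k _.
rewrite -big_split /=; apply: eq_bigr => t _.
rewrite -(@sum_zvec_path _ M P0 wM k t (fun n z => pathsum fe fo fp k z)).
rewrite -big_split /=; apply: eq_bigr => zz _.
by rewrite qz_Eq// -ltnS.
Qed.

Lemma HasLn_prior_Theta : HasLn (prior_Theta R M)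
  ((\sum_(n < NA M) \sum_(i < nZ M n) (ER P n + (mR P n - 1) * EU1 P n i)) +
   (\sum_(n < NA M) \sum_(a < nA M n) \sum_(o < nO M n) \sum_(i < nZ M n) \sum_(j < nZ M n)
     (EA P n a o i + (mA P n a o i - 1) * EV1 P n a o i j)) +
   (\sum_(n < NA M) \sum_(i < nZ M n) (- ln (dir_cst (nA M n).-1 (htheta R M n i) 0) +
      \sum_(a < nA M n) (htheta R M n i a - 1) * EPi P n i a))).
Proof.
have [_ _ _ _ [_ _ _ _ hth]] := wM.
apply: HasLn_mul; first apply: HasLn_mul.
- by apply: HasLn_prod => n; apply: HasLn_prod => i; exact: HasLn_prior_U.
- apply: HasLn_prod => n; apply: HasLn_prod => a; apply: HasLn_prod => o.
  by apply: HasLn_prod => i; apply: HasLn_prod => j; exact: HasLn_prior_V.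
- apply: HasLn_prod => n; apply: HasLn_prod => i; apply: HasLn_dir => // a aa.
  exact: hth.
Qed.

Lemma HasLn_prior_rhos : HasLn (prior_rho R M)
  (\sum_(n < NA M) ((he R M - 1) * ER P n - hf R M * mR P n + gamma_lncst (he R M) (hf R M))).
Proof. by apply: HasLn_prod => n; exact: HasLn_prior_rho. Qed.

Lemma HasLn_prior_alphas : HasLn (prior_alpha R M)
  (\sum_(n < NA M) \sum_(a < nA M n) \sum_(o < nO M n) \sum_(i < nZ M n)
  ((hc R M n a o - 1) * EA P n a o i - hd R M n a o * mA P n a o i +
   gamma_lncst (hc R M n a o) (hd R M n a o))).
Proof.
apply: HasLn_prod => n; apply: HasLn_prod => a; apply: HasLn_prod => o.
by apply: HasLn_prod => i; exact: HasLn_prior_alpha.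
Qed.

Lemma HasLn_qdens : HasLn (qdens R M P)
  (\sum_(n < NA M) \sum_(i < nZ M n) ent_beta (vdelta R P n i) (vmu R P n i) +
   \sum_(n < NA M) \sum_(a < nA M n) \sum_(o < nO M n) \sum_(i < nZ M n) \sum_(j < nZ M n)
     ent_beta (vsigma R P n a o i j) (vlambda R P n a o i j) +
   \sum_(n < NA M) ent_gamma (vg R P n) (vh R P n) +
   \sum_(n < NA M) \sum_(a < nA M n) \sum_(o < nO M n) \sum_(i < nZ M n)
     ent_gamma (va R P n a o i) (vb R P n a o i) +
   \sum_(n < NA M) \sum_(i < nZ M n) ent_dir M n i (vphi R P n i)).
Proof.
do 4?[apply: HasLn_mul].
- by apply: HasLn_prod => n; apply: HasLn_prod => i; exact: HasLn_ent_U.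
- apply: HasLn_prod => n; apply: HasLn_prod => a; apply: HasLn_prod => o.
  by apply: HasLn_prod => i; apply: HasLn_prod => j; exact: HasLn_ent_V.
- by apply: HasLn_prod => n; exact: HasLn_ent_rho.
- apply: HasLn_prod => n; apply: HasLn_prod => a; apply: HasLn_prod => o.
  by apply: HasLn_prod => i; exact: HasLn_ent_alpha.
- by apply: HasLn_prod => n; apply: HasLn_prod => i; exact: HasLn_ent_dir.
Qed.

End Values.
End ElboFormula.

(** * The ELBO agent by agent *)

Section ElboTerms.
Context {R : realType}.
Variables (M : model R) (P0 : vparams R).

(* ELBO contributions of one Beta factor with parameters [s, l] whose hyperparameter
   has posterior [Gamma(g, h)], of one Gamma factor, and of one Dirichlet factor *)
Definition beta_term (c c1 s l g h : R) : R :=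
  c * Eln_beta s l + c1 * Eln1_beta s l + (Eln_gamma g h + (g / h - 1) * Eln1_beta s l)
  - ent_beta s l.
Definition gamma_term (e f g h : R) : R :=
  (e - 1) * Eln_gamma g h - f * (g / h) - ent_gamma g h.
Definition dir_term n i (phi : nat -> R) : R :=
  \sum_(a < nA M n) (cPi M P0 n i a + (htheta R M n i a - 1)) * Eln_dir M n i phi a
  - ent_dir M n i phi.

(** Each Gamma term stands next to the Beta terms that share its parameters, since a Gamma update
    changes both. *)
Definition elbo_agent (P : vparams R) n : R :=
  \sum_(i < nZ M n) beta_term (cU M P0 n i) (cU1 M P0 n i)
     (vdelta R P n i) (vmu R P n i) (vg R P n) (vh R P n) +
  gamma_term (he R M) (hf R M) (vg R P n) (vh R P n) +
  \sum_(a < nA M n) \sum_(o < nO M n) \sum_(i < nZ M n)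
    (\sum_(j < nZ M n) beta_term (cV M P0 n a o i j) (cV1 M P0 n a o i j)
       (vsigma R P n a o i j) (vlambda R P n a o i j) (va R P n a o i) (vb R P n a o i) +
     gamma_term (hc R M n a o) (hd R M n a o) (va R P n a o i) (vb R P n a o i)) +
  \sum_(i < nZ M n) dir_term n i (vphi R P n i).

Definition elbo_cst : R :=
  data_cst M P0 +
  \sum_(n < NA M) (gamma_lncst (he R M) (hf R M) +
    \sum_(a < nA M n) \sum_(o < nO M n) \sum_(i < nZ M n)
      gamma_lncst (hc R M n a o) (hd R M n a o) +
    \sum_(i < nZ M n) (- ln (dir_cst (nA M n).-1 (htheta R M n i) 0))) -
  (KK R M)%:R^-1 * \sum_(k < KK R M) \sum_(t < (TT R M k).+1) \sum_(zz : zvec R M t)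
     qz R M P0 k t zz * ln (qz R M P0 k t zz).

(* stated on variables, so that [ring] never compares two of the integrals involved *)
Lemma collect_terms (u p v g du dp dv pu pv pp r kr a eu ev er ea ep ka kp : R) :
  u = du + pu - eu -> p = dp + pp - ep - kp -> v = dv + pv + a - ev - ea - ka ->
  g = r - er ->
  du + dp + dv + pu + pv + pp + (r + kr) + a - (eu + ev + er + ea + ep) =
  kr + ka + kp + (u + g + v + p).
Proof. by move=> -> -> -> ->; ring. Qed.

Lemma ELBOE P : wf_model M -> vpos M P ->
  ELBO M P0 P = elbo_cst + \sum_(n < NA M) elbo_agent P n.
Proof.
move=> wM pP; rewrite /ELBO (data_term P0 wM pP).
rewrite (HasE_Eq (HasLn_prior_Theta wM pP).2) (HasE_Eq (HasLn_prior_rhos wM pP).2).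
rewrite (HasE_Eq (HasLn_prior_alphas wM pP).2) (HasE_Eq (HasLn_qdens wM pP).2).
rewrite /elbo_cst; set Z := (KK R M)%:R^-1 * _.
rewrite [RHS]addrAC; congr (_ - _).
rewrite -!addrA; congr (_ + _); rewrite !addrA.
rewrite -!big_split /= -sumrB; apply: eq_bigr => n _.
rewrite /elbo_agent.
have EU : \sum_(i < nZ M n) beta_term (cU M P0 n i) (cU1 M P0 n i)
     (vdelta R P n i) (vmu R P n i) (vg R P n) (vh R P n) =
  \sum_(i < nZ M n) (cU M P0 n i * Eln_beta (vdelta R P n i) (vmu R P n i) +
     cU1 M P0 n i * Eln1_beta (vdelta R P n i) (vmu R P n i)) +
  \sum_(i < nZ M n) (Eln_gamma (vg R P n) (vh R P n) +
     (vg R P n / vh R P n - 1) * Eln1_beta (vdelta R P n i) (vmu R P n i)) -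
  \sum_(i < nZ M n) ent_beta (vdelta R P n i) (vmu R P n i).
  by rewrite -big_split /= -sumrB.
have EP : \sum_(i < nZ M n) dir_term n i (vphi R P n i) =
  \sum_(i < nZ M n) \sum_(a < nA M n) cPi M P0 n i a * Eln_dir M n i (vphi R P n i) a +
  \sum_(i < nZ M n) (- ln (dir_cst (nA M n).-1 (htheta R M n i) 0) +
      \sum_(a < nA M n) (htheta R M n i a - 1) * Eln_dir M n i (vphi R P n i) a) -
  \sum_(i < nZ M n) ent_dir M n i (vphi R P n i) -
    \sum_(i < nZ M n) (- ln (dir_cst (nA M n).-1 (htheta R M n i) 0)).
  rewrite -!big_split /= -!sumrB; apply: eq_bigr => i _; rewrite /dir_term.
  rewrite (eq_bigr _ (fun (a : 'I_(nA M n)) _ => mulrDl (cPi M P0 n i a) (htheta R M n i a - 1)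
    (Eln_dir M n i (vphi R P n i) a))) big_split /=; ring.
have EV : \sum_(a < nA M n) \sum_(o < nO M n) \sum_(i < nZ M n)
    (\sum_(j < nZ M n) beta_term (cV M P0 n a o i j) (cV1 M P0 n a o i j)
       (vsigma R P n a o i j) (vlambda R P n a o i j) (va R P n a o i) (vb R P n a o i) +
     gamma_term (hc R M n a o) (hd R M n a o) (va R P n a o i) (vb R P n a o i)) =
  \sum_(a < nA M n) \sum_(o < nO M n) \sum_(i < nZ M n) \sum_(j < nZ M n)
     (cV M P0 n a o i j * Eln_beta (vsigma R P n a o i j) (vlambda R P n a o i j) +
      cV1 M P0 n a o i j * Eln1_beta (vsigma R P n a o i j) (vlambda R P n a o i j)) +
  \sum_(a < nA M n) \sum_(o < nO M n) \sum_(i < nZ M n) \sum_(j < nZ M n)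
     (Eln_gamma (va R P n a o i) (vb R P n a o i) + (va R P n a o i / vb R P n a o i - 1) *
        Eln1_beta (vsigma R P n a o i j) (vlambda R P n a o i j)) +
  \sum_(a < nA M n) \sum_(o < nO M n) \sum_(i < nZ M n)
   ((hc R M n a o - 1) * Eln_gamma (va R P n a o i) (vb R P n a o i) -
     hd R M n a o * (va R P n a o i / vb R P n a o i) +
     gamma_lncst (hc R M n a o) (hd R M n a o)) -
  \sum_(a < nA M n) \sum_(o < nO M n) \sum_(i < nZ M n) \sum_(j < nZ M n)
     ent_beta (vsigma R P n a o i j) (vlambda R P n a o i j) -
  \sum_(a < nA M n) \sum_(o < nO M n) \sum_(i < nZ M n)
     ent_gamma (va R P n a o i) (vb R P n a o i) -
    \sum_(a < nA M n) \sum_(o < nO M n) \sum_(i < nZ M n)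
      gamma_lncst (hc R M n a o) (hd R M n a o).
  do 3![rewrite -!big_split /= -!sumrB; apply: eq_bigr => ? _].
  rewrite /gamma_term /beta_term sumrB !big_split /=; ring.
have EG : gamma_term (he R M) (hf R M) (vg R P n) (vh R P n) =
  (he R M - 1) * Eln_gamma (vg R P n) (vh R P n) - hf R M * (vg R P n / vh R P n) -
  ent_gamma (vg R P n) (vh R P n) by [].
have H := collect_terms (gamma_lncst (he R M) (hf R M)) EU EP EV EG.
by refine (etrans _ (etrans H _)).
Qed.

End ElboTerms.

(** * Optimality of the updates *)

Section Optimality.
Context {R : realType}.

(** In [beta_term] the expected [ln u] has coefficient [c = (1 + c) - 1] and the expected
    [ln (1 - u)] has [c1 + g / h - 1]; these are the exponents of the announced Beta density. *)
Lemma beta_term_opt (c c1 s l g h : R) : 0 < 1 + c -> 0 < g / h + c1 -> 0 < s -> 0 < l ->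
  beta_term c c1 s l g h <= beta_term c c1 (1 + c) (g / h + c1) g h.
Proof.
move=> c0 c10 s0 l0; have := beta_opt s0 l0 c0 c10; rewrite /beta_term.
move: (Eln_beta s l) (Eln1_beta s l) (ent_beta s l) (Eln_gamma g h)
  (Eln_beta (1 + c) _) (Eln1_beta (1 + c) _) (ent_beta (1 + c) _) => u v w x u' v' w'.
by move: (g / h) => r; clear; lra.
Qed.

(** Isolates the dependence on the concentration: [m] copies of its expected logarithm, and its mean
    times the summed expectations of [ln (1 - u)]. *)
Lemma sum_beta_term (m : nat) (c c1 s l : nat -> R) (g h : R) :
  \sum_(i < m) beta_term (c i) (c1 i) (s i) (l i) g h =
  \sum_(i < m) (c i * Eln_beta (s i) (l i) + c1 i * Eln1_beta (s i) (l i) -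
     Eln1_beta (s i) (l i) - ent_beta (s i) (l i)) +
  m%:R * Eln_gamma g h + (g / h) * \sum_(i < m) Eln1_beta (s i) (l i).
Proof.
rewrite mulr_sumr mulrC mulr_natr -[m in _ *+ m]card_ord -sumr_const -!big_split /=.
apply: eq_bigr => i _; rewrite /beta_term.
move: (Eln_beta _ _) (Eln1_beta _ _) (ent_beta _ _) (Eln_gamma g h) => u v w x.
ring.
Qed.

(** By [sum_beta_term] the expected logarithm of the concentration has total coefficient
    [e + m - 1], and its mean has coefficient [- h']. The rate [h'] is positive because [f] is and
    each subtracted digamma difference is nonpositive. *)
Lemma gamma_term_opt (m : nat) (c c1 s l : nat -> R) (e f g h : R) :
  (forall i, (i < m)%N -> 0 < s i /\ 0 < l i) -> 0 < e -> 0 < f -> 0 < g -> 0 < h ->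
  let g' := e + m%:R in
  let h' := f - \sum_(i < m) (digamma R (l i) - digamma R (s i + l i)) in
  0 < h' /\
  \sum_(i < m) beta_term (c i) (c1 i) (s i) (l i) g h + gamma_term e f g h <=
  \sum_(i < m) beta_term (c i) (c1 i) (s i) (l i) g' h' + gamma_term e f g' h'.
Proof.
move=> sl e0 f0 g0 h0 g' h'.
have SE : \sum_(i < m) (digamma R (l i) - digamma R (s i + l i)) =
    \sum_(i < m) Eln1_beta (s i) (l i).
  by apply: eq_bigr => i _; have [s0 l0] := sl i (ltn_ord i); rewrite Eln1_beta_digamma.
have g'0 : 0 < g' by rewrite ltr_wpDr.
have h'E : h' = f - \sum_(i < m) Eln1_beta (s i) (l i) by rewrite /h' SE.
have h'0 : 0 < h'.
  rewrite h'E ltr_wpDr// oppr_ge0 sumr_le0// => i _.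
  by have [s0 l0] := sl i (ltn_ord i); exact: Eln1_beta_le0.
split; first exact: h'0.
have fE : f = h' + \sum_(i < m) Eln1_beta (s i) (l i) by rewrite h'E subrK.
have := gamma_opt g0 h0 g'0 h'0.
rewrite (sum_beta_term m c c1 s l g h) (sum_beta_term m c c1 s l g' h') /gamma_term.
rewrite fE; clear SE h'E fE h'0; clearbody h'.
move: (\sum_(i < m) Eln1_beta (s i) (l i)) (\sum_(i < m) (c i * _ + _ - _ - _))
  (Eln_gamma g h) (Eln_gamma g' h') (ent_gamma g h) (ent_gamma g' h') (g / h) (g' / h').
rewrite /g' => A B C D E F G H; move: (m%:R : R) => k; clear; lra.
Qed.

End Optimality.

(** * Optimality of the five coordinate updates *)

Section Updates.
Context {R : realType}.
Variables (M : model R) (P0 P : vparams R).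
Hypotheses (wM : wf_model M) (pP : vpos M P).

Lemma dir_term_opt n i (phi psi : nat -> R) : (n < NA M)%N ->
  pos_on M n phi -> pos_on M n psi ->
  (forall a, psi a = htheta R M n i a + cPi M P0 n i a) ->
  dir_term M P0 n i phi <= dir_term M P0 n i psi.
Proof.
move=> nn phi0 psi0 E.
have F a : cPi M P0 n i a + (htheta R M n i a - 1) = psi a - 1 by rewrite E; ring.
rewrite /dir_term.
under eq_bigr do rewrite F; under [X in _ <= X - _]eq_bigr do rewrite F.
exact: (dir_opt i (nA_gt0 wM nn) phi0 psi0).
Qed.

(** Makes all visit counts nonnegative, hence the updated parameters positive. If [Vhat] vanishes,
    the quotient is 0 by convention and the bound persists. *)
Lemma nutilde_ge0 k t : (k < KK R M)%N -> (t <= TT R M k)%N -> 0 <= nutilde R M P0 k t.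
Proof.
move=> kk tt; have [_ _ _ [hr /andP[g0 _]] [hp _ _ _ _]] := wM.
rewrite /nutilde mulr_ge0//.
  rewrite mulr_ge0 ?mulr_ge0 ?exprn_ge0 ?subr_ge0 ?hr//.
  by apply: prodr_ge0 => n _; rewrite ltW ?pact_tilde_gt0.
rewrite invr_ge0 mulr_ge0//.
  by apply: prodr_ge0 => n _; have /andP[/ltW] := hp k n t kk (ltn_ord n) tt.
rewrite /Vhat mulr_ge0 ?invr_ge0 ?ler0n//.
apply: sumr_ge0 => k' _; apply: sumr_ge0 => t' _; rewrite mulr_ge0//.
  by apply: rtilde_ge0 => //; rewrite -ltnS.
by apply: prodr_ge0 => n _; rewrite ltW ?pact_tilde_gt0.
Qed.

Lemma qmarg1_ge0 k n t tau i : (k < KK R M)%N -> (t <= TT R M k)%N -> (n < NA M)%N ->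
  0 <= qmarg1 R M P0 k n t tau i.
Proof.
move=> kk tt nn; rewrite /qmarg1 mulr_ge0 ?nutilde_ge0// divr_ge0 ?(ltW (pact_tilde_gt0 _ _ _ _ _))//.
by apply: sumr_ge0 => z _; rewrite ltW// pjoint_tilde_gt0.
Qed.

Lemma qmarg2_ge0 k n t tau i j : (k < KK R M)%N -> (t <= TT R M k)%N -> (n < NA M)%N ->
  0 <= qmarg2 R M P0 k n t tau i j.
Proof.
move=> kk tt nn; rewrite /qmarg2 mulr_ge0 ?nutilde_ge0// divr_ge0 ?(ltW (pact_tilde_gt0 _ _ _ _ _))//.
by apply: sumr_ge0 => z _; rewrite ltW// pjoint_tilde_gt0.
Qed.

Lemma avg_ge0 (F : nat -> nat -> R) :
  (forall k t, (k < KK R M)%N -> (t <= TT R M k)%N -> 0 <= F k t) -> 0 <= avg R M F.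
Proof.
move=> F0; apply: sumr_ge0 => k _; rewrite mulr_ge0 ?invr_ge0 ?ler0n//.
by apply: sumr_ge0 => t _; apply: F0 => //; rewrite -ltnS.
Qed.

Lemma le_ELBO Q Q' : vpos M Q -> vpos M Q' ->
  (forall n, (n < NA M)%N -> elbo_agent M P0 Q n <= elbo_agent M P0 Q' n) ->
  ELBO M P0 Q <= ELBO M P0 Q'.
Proof.
by move=> pQ pQ' QQ'; rewrite !ELBOE// lerD2l ler_sum// => n _; exact: QQ'.
Qed.

Lemma vpos_set_u n i d m : 0 < d -> 0 < m -> vpos M (set_u P n i d m).
Proof.
move=> d0 m0 n' nn'; have [h1 h2 h3 h4 h5] := pP nn'; split=> //= i' ii'.
by case: ifP => // _; exact: h2.
Qed.

Lemma vpos_set_pi n i v : (forall a, (a < nA M n)%N -> 0 < v a) -> vpos M (set_pi P n i v).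
Proof.
move=> v0 n' nn'; have [h1 h2 h3 h4 h5] := pP nn'; split=> //= i' a ii' aa.
by case: ifP => [/andP[/eqP nE _]|_]; [apply: v0; rewrite -nE|exact: h3].
Qed.

Lemma vpos_set_V n a o i j s l : 0 < s -> 0 < l -> vpos M (set_V P n a o i j s l).
Proof.
move=> d0 m0 n' nn'; have [h1 h2 h3 h4 h5] := pP nn'; split=> //= a' o' i' j' aa oo ii jj.
by case: ifP => // _; exact: h5.
Qed.

Lemma vpos_set_rho n g h : 0 < g -> 0 < h -> vpos M (set_rho P n g h).
Proof.
move=> d0 m0 n' nn'; have [h1 h2 h3 h4 h5] := pP nn'; split=> //=.
by case: ifP => // _; exact: h2.
Qed.

Lemma vpos_set_alpha n a o i g h : 0 < g -> 0 < h -> vpos M (set_alpha P n a o i g h).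
Proof.
move=> d0 m0 n' nn'; have [h1 h2 h3 h4 h5] := pP nn'; split=> //= a' o' i' aa oo ii.
by case: ifP => // _; exact: h4.
Qed.

Lemma u_update_opt n i d m : (n < NA M)%N -> (i < nZ M n)%N -> 0 < d -> 0 < m ->
  ELBO M P0 (set_u P n i d m) <=
  ELBO M P0 (set_u P n i (upd_delta M P0 P n i) (upd_mu M P0 P n i)).
Proof.
move=> nn ii d0 m0; have [[g0 h0] _ _ _ _] := pP nn.
have D0 : 0 < upd_delta M P0 P n i.
  rewrite /upd_delta ltr_wpDr// avg_ge0// => k t kk tt; exact: qmarg1_ge0.
have M0 : 0 < upd_mu M P0 P n i.
  rewrite /upd_mu ltr_wpDr ?divr_gt0// avg_ge0// => k t kk tt.
  by apply: sumr_ge0 => r _; exact: qmarg1_ge0.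
apply: le_ELBO; [exact: vpos_set_u|exact: vpos_set_u|move=> n' nn'].
(* [set_u] changes the first sum of [elbo_agent] only; the other summands coincide and cancel. *)
rewrite /elbo_agent /= !lerD2r; apply: ler_sum => i' _.
case: ifP => [/andP[/eqP n'E /eqP ->]|_]; last exact: lexx.
rewrite n'E.
exact: (@beta_term_opt R (cU M P0 n i) (cU1 M P0 n i)).
Qed.

Lemma pi_update_opt n i (v : nat -> R) : (n < NA M)%N -> (i < nZ M n)%N ->
  (forall a, (a < nA M n)%N -> 0 < v a) ->
  ELBO M P0 (set_pi P n i v) <= ELBO M P0 (set_pi P n i (upd_phi M P0 P n i)).
Proof.
move=> nn ii v0; have [_ _ _ _ [_ _ _ _ hth]] := wM.
have U0 a : (a < nA M n)%N -> 0 < upd_phi M P0 P n i a.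
  move=> aa; rewrite /upd_phi ltr_wpDr ?hth// avg_ge0// => k t kk tt.
  by apply: sumr_ge0 => tau _; rewrite mulr_ge0 ?ler0n//; exact: qmarg1_ge0.
apply: le_ELBO; [exact: vpos_set_pi|exact: vpos_set_pi|move=> n' nn'].
rewrite /elbo_agent /= lerD2l; apply: ler_sum => i' _.
move: (nat_of_ord i') => r {i'}.
case: (boolP ((n' == n) && (r == i))) => [/andP[/eqP -> /eqP ->]|_]; last exact: lexx.
exact: dir_term_opt.
Qed.

Lemma V_update_opt n a o i j s l : (n < NA M)%N -> (a < nA M n)%N -> (o < nO M n)%N ->
  (i < nZ M n)%N -> (j < nZ M n)%N -> 0 < s -> 0 < l ->
  ELBO M P0 (set_V P n a o i j s l) <=
  ELBO M P0 (set_V P n a o i j (upd_sigma M P0 P n a o i j) (upd_lambda M P0 P n a o i j)).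
Proof.
move=> nn aa oo ii jj s0 l0; have [_ _ _ h4 _] := pP nn; have [g0 h0] := h4 a o i aa oo ii.
have D0 : 0 < upd_sigma M P0 P n a o i j.
  rewrite /upd_sigma ltr_wpDr// avg_ge0// => k t kk tt.
  by apply: sumr_ge0 => tau _; rewrite mulr_ge0 ?ler0n//; exact: qmarg2_ge0.
have M0 : 0 < upd_lambda M P0 P n a o i j.
  rewrite /upd_lambda ltr_wpDr ?divr_gt0// avg_ge0// => k t kk tt.
  apply: sumr_ge0 => tau _; apply: sumr_ge0 => r _.
  by rewrite mulr_ge0 ?ler0n//; exact: qmarg2_ge0.
apply: le_ELBO; [exact: vpos_set_V|exact: vpos_set_V|move=> n' nn'].
rewrite /elbo_agent /= lerD2r lerD2l.
apply: ler_sum => a' _; apply: ler_sum => o' _; apply: ler_sum => i' _.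
rewrite lerD2r; apply: ler_sum => j' _.
case: ifP => [/and5P[/eqP n'E /eqP -> /eqP -> /eqP -> /eqP ->]|_]; last exact: lexx.
rewrite n'E.
exact: (@beta_term_opt R (cV M P0 n a o i j) (cV1 M P0 n a o i j)).
Qed.

Lemma rho_update_opt n g h : (n < NA M)%N -> 0 < g -> 0 < h ->
  ELBO M P0 (set_rho P n g h) <= ELBO M P0 (set_rho P n (upd_g M P n) (upd_h M P n)).
Proof.
move=> nn g0 h0; have [_ h2 _ _ _] := pP nn; have [_ _ _ _ [_ e0 f0 _ _]] := wM.
have [H0 H] := gamma_term_opt (cU M P0 n) (cU1 M P0 n) h2 e0 f0 g0 h0.
have G0 : 0 < upd_g M P n by rewrite /upd_g ltr_wpDr.
apply: le_ELBO; [exact: vpos_set_rho|exact: vpos_set_rho|move=> n' nn'].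
rewrite /elbo_agent /= 2!lerD2r.
case: eqVneq => [->|_]; last exact: lexx.
exact: H.
Qed.

Lemma alpha_update_opt n a o i g h : (n < NA M)%N -> (a < nA M n)%N -> (o < nO M n)%N ->
  (i < nZ M n)%N -> 0 < g -> 0 < h ->
  ELBO M P0 (set_alpha P n a o i g h) <=
  ELBO M P0 (set_alpha P n a o i (upd_a M P n a o i) (upd_b M P n a o i)).
Proof.
move=> nn aa oo ii g0 h0; have [_ _ _ _ h5] := pP nn.
have [_ _ _ _ [_ _ _ hcd _]] := wM; have [c0 d0] := hcd n a o nn aa oo.
have [H0 H] := gamma_term_opt (cV M P0 n a o i) (cV1 M P0 n a o i)
  (fun j => h5 a o i j aa oo ii) c0 d0 g0 h0.
have G0 : 0 < upd_a M P n a o i by rewrite /upd_a ltr_wpDr.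
apply: le_ELBO; [exact: vpos_set_alpha|exact: vpos_set_alpha|move=> n' nn'].
rewrite /elbo_agent /= lerD2r lerD2l.
apply: ler_sum => a' _; apply: ler_sum => o' _; apply: ler_sum => i' _.
(* The inner bracket, Beta sum plus Gamma term, is compared as a whole because all its terms share
   the updated parameters. *)
case: (boolP [&& n' == n, (a' : nat) == a, (o' : nat) == o & (i' : nat) == i]); last by move=> _; exact: lexx.
by move=> /and4P[/eqP n'E /eqP -> /eqP -> /eqP ->]; rewrite n'E.
Qed.

End Updates.

Unset Implicit Arguments.

Theorem theorem1 (R : realType) (M : model R) (P0 P : vparams R) :
  wf_model M -> vpos M P0 -> vpos M P ->
  [/\
   (* q(u_n^i) = Beta(delta_n^i, mu_n^i) *)
   (forall n i, (n < NA M)%N -> (i < nZ M n)%N ->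
      forall d m : R, 0 < d -> 0 < m ->
      ELBO M P0 (set_u P n i d m) <=
      ELBO M P0 (set_u P n i (upd_delta M P0 P n i) (upd_mu M P0 P n i))),
   (* q(pi_{n,i}) = Dirichlet(phi_{n,i}) *)
   (forall n i, (n < NA M)%N -> (i < nZ M n)%N ->
      forall v : nat -> R, (forall a, (a < nA M n)%N -> 0 < v a) ->
      ELBO M P0 (set_pi P n i v) <=
      ELBO M P0 (set_pi P n i (upd_phi M P0 P n i))),
   (* q(V_{n,a,o}^{i,j}) = Beta(sigma, lambda) *)
   (forall n a o i j, (n < NA M)%N -> (a < nA M n)%N -> (o < nO M n)%N ->
      (i < nZ M n)%N -> (j < nZ M n)%N ->
      forall s l : R, 0 < s -> 0 < l ->
      ELBO M P0 (set_V P n a o i j s l) <=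
      ELBO M P0 (set_V P n a o i j (upd_sigma M P0 P n a o i j)
                                   (upd_lambda M P0 P n a o i j))),
   (* q(rho_n) = Gamma(g_n, h_n) *)
   (forall n, (n < NA M)%N ->
      forall g h : R, 0 < g -> 0 < h ->
      ELBO M P0 (set_rho P n g h) <=
      ELBO M P0 (set_rho P n (upd_g M P n) (upd_h M P n))) &
   (* q(alpha_{n,a,o}^i) = Gamma(a, b) *)
   (forall n a o i, (n < NA M)%N -> (a < nA M n)%N -> (o < nO M n)%N ->
      (i < nZ M n)%N ->
      forall a' b' : R, 0 < a' -> 0 < b' ->
      ELBO M P0 (set_alpha P n a o i a' b') <=
      ELBO M P0 (set_alpha P n a o i (upd_a M P n a o i) (upd_b M P n a o i)))].
Proof.
move=> wM _ pP; split.
- by move=> n i nn ii d m d0 m0; exact: u_update_opt.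
- by move=> n i nn ii v v0; exact: pi_update_opt.
- by move=> n a o i j nn aa oo ii jj s l s0 l0; exact: V_update_opt.
- by move=> n nn g h g0 h0; exact: rho_update_opt.
- by move=> n a o i nn aa oo ii g h g0 h0; exact: alpha_update_opt.
Qed.
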